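(* Let $\beta>1$. There exist constants $C_3(\beta),C_4(\beta)>0$ depending on $\beta$ such that, for the restricted Glauber dynamics (the dynamics on configurations of non-negative magnetization) for the Ising model on the complete graph $K_n$ with parameter $\beta$, $$C_3(\beta)\,n\log n\le t_{\rm mix}(n)\le C_4(\beta)\,n\log n\qquad\text{for all } n.$$
   Context: For an integer $n\ge1$ let $\Omega=\{-1,1\}^n$. The Ising (Curie-Weiss) measure on $K_n$ with parameter $\beta$ is $\mu_n(\sigma)\propto\exp\big(\frac{\beta}{n}\sum_{1\le i<j\le n}\sigma(i)\sigma(j)\big)$ on $\Omega$. For $\sigma\in\Omega$ let $S(\sigma)=\frac1n\sum_{i=1}^n\sigma(i)$ (normalized magnetization), and let $p_+(s)=\frac{1+\tanh(\beta s)}2$. The Glauber dynamics is the Markov chain on $\Omega$ which, when at $\sigma$, chooses a site $i\in\{1,\dots,n\}$ uniformly at random and replaces the spin at $i$ by $+1$ with probability $p_+(S(\sigma)-\sigma(i)/n)$ and by $-1$ otherwise, leaving all other spins unchanged (it is reversible with respect to $\mu_n$). Let $\Omega^+=\{\sigma\in\Omega: S(\sigma)\ge0\}$. The restricted Glauber dynamics is the Markov chain $(X^+_t)$ on $\Omega^+$ evolving as follows: from the current state generate a candidate move $\eta$ according to the usual Glauber dynamics; if $S(\eta)\ge0$, the new state is $\eta$, while if $S(\eta)<0$, the new state is $-\eta$. Let $\mu^+$ be its stationary distribution. Its mixing time is $t_{\rm mix}(n)=\min\{t:\max_{\sigma\in\Omega^+}\|\mathbf P_\sigma(X^+_t\in\cdot)-\mu^+\|_{\rm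 TV}\le 1/4\}$. *)

(* Defs.v *)
From mathcomp Require Import all_boot all_order all_algebra.
From mathcomp Require Import boolp classical_sets reals sequences exp.

Set Implicit Arguments.
Unset Strict Implicit.
Unset Printing Implicit Defensive.

Import Order.TTheory GRing.Theory Num.Theory.
Local Open Scope ring_scope.

(* The configuration space {-1,1}^n; [true] encodes the spin +1. *)
Definition config (n : nat) : finType := {ffun 'I_n -> bool}.

Definition spin (R : realType) (n : nat) (s : config n) (i : 'I_n) : R :=
  if s i then 1 else -1.

Definition magn (R : realType) (n : nat) (s : config n) : R :=
  n%:R^-1 * \sum_(i < n) spin R s i.

Definition opp_config (n : nat) (s : config n) : config n :=
  [ffun i => ~~ s i].

Definition set_spin (n : nat) (s : config n) (i : 'I_n) (b : bool) : config n :=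
  [ffun j => if j == i then b else s j].

Definition tanh (R : realType) (x : R) : R :=
  (expR x - expR (- x)) / (expR x + expR (- x)).

Definition p_plus (R : realType) (beta s : R) : R :=
  (1 + tanh (beta * s)) / 2.

(* Transition probability from s to t of the (unrestricted) dynamics. *)
Definition glauber (R : realType) (beta : R) (n : nat) (s t : config n) : R :=
  \sum_(i < n) n%:R^-1 *
    (let p := p_plus beta (magn R s - spin R s i / n%:R) in
     p * (t == set_spin s i true)%:R + (1 - p) * (t == set_spin s i false)%:R).

Definition config_plus (R : realType) (n : nat) : finType :=
  {s : config n | 0 <= magn R s}.

Definition fold_config (R : realType) (n : nat) (s : config n) : config n :=
  if 0 <= magn R s then s else opp_config s.

(* Transition probability from s to t of the restricted dynamics: the total
   weight of the candidate moves e that lead to t. *)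
Definition glauber_plus (R : realType) (beta : R) (n : nat)
    (s t : config_plus R n) : R :=
  \sum_(e : config n | fold_config R e == val t) glauber beta (val s) e.

Section FiniteMarkovChains.
Variables (R : realType) (T : finType).
Implicit Types (K : T -> T -> R) (p q : {ffun T -> R}).

(* [law K x t] is the distribution of the state at time t, started at x. *)
Fixpoint law K (x : T) (t : nat) : {ffun T -> R} :=
  if t is t'.+1 then [ffun y => \sum_z law K x t' z * K z y]
  else [ffun y => (y == x)%:R].

Definition stationary K p : Prop :=
  [/\ forall x, 0 <= p x, \sum_x p x = 1
    & forall y, \sum_x p x * K x y = p y].

(* The stationary distribution, by description; it is the null function, which
   is not a probability, when K has no stationary distribution. *)
Definition stationary_law K : {ffun T -> R} :=
  xget [ffun=> 0] [set p | stationary K p]%classic.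

Definition tv_dist p q : R :=
  \big[Num.max/0]_(A : {set T}) `|\sum_(x in A) p x - \sum_(x in A) q x|.

Definition worst_tv K (t : nat) : R :=
  \big[Num.max/0]_(x : T) tv_dist (law K x t) (stationary_law K).

(* [t] is the least time at which the worst-case distance is at most 1/4; no
   such t exists if the chain never gets that close to stationarity. *)
Definition is_mixing_time K (t : nat) : Prop :=
  worst_tv K t <= 4^-1 /\ forall s : nat, worst_tv K s <= 4^-1 -> (t <= s)%N.

End FiniteMarkovChains.

(* Main.v *)
(* The proof works with test functions f and the operator K f x = E_x f(X_1); no
   coupling is needed, and it suffices that K^t f has small oscillation.

   Upper bound. Exchanging two spins commutes with the dynamics (folding
   included), and updating either exchanged site merges the two configurations
   with probability bounded below. So the variation of K^t f under exchanges
   decays like (1 - 2 q / n)^t, and after O(n log n) steps K^t f is nearly a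
   function g of the number k of pluses. On such functions K acts as a
   birth-and-death chain, and the increments g(k + 1) - g(k) evolve under a
   positive operator; it contracts them by 1 - kappa / n in a weighted sup norm
   as soon as the weight is a strict supersolution. With y = 2 k + 1 - n, such a
   weight is cosh (beta y / n) times the sum of a constant and of a function
   equal to y exp (- lambda y^2 / (2 n)) up to the scale sqrt n, where it
   beats the repulsion from magnetization 0, and to 1 / (y (y + 2) (y + 4) ...)
   (r factors) beyond. The factor cosh removes the tanh from the rates, and the
   constant dominates near and above the positive fixed point of
   s = tanh (beta s). The weight varies only polynomially in n, which costs a
   factor log n.

   Lower bound. If the a_i sum to 0, F = sum_i a_i sigma_i is an approximate
   eigenfunction, and F^2 and F^4 are invariant under folding. Started from a
   balanced configuration with F ~ n, F^2 is still at least n^(15/8) / 8 with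
   high probability after n log n / 48 steps, whereas its stationary mean is at
   most 2 n. *)
Require Import Defs.
From mathcomp Require Import all_boot all_order all_fingroup all_algebra zify ring lra.
From mathcomp Require Import boolp classical_sets functions filter reals topology.
From mathcomp Require Import normedtype derive realfun sequences exp.

Set Implicit Arguments.
Unset Strict Implicit.
Unset Printing Implicit Defensive.

Import Order.TTheory GRing.Theory Num.Theory.
Import numFieldNormedType.Exports.
Local Open Scope ring_scope.

(** * Hyperbolic functions *)

(** Near magnetization 0 the drift is repulsive: the increments of a function of the level are
    multiplied there by about [1 + (beta - 1) / n] per step, so a constant weight does not contract.
    What helps is the folding, which reverses or cancels the increment across 0 and so acts on
    increments like an absorbing boundary; the weight near 0 is modelled on the first odd
    eigenfunction of the limiting diffusion. Further out the drift points away from 0, and a weight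
    decreasing like [y^-r] gains about [r] times the relative drift, which beats the loss of the
    constant once [r] is large. Above the fixed point the drift reverses and the power loses, but
    there a constant is strictly contracted because [beta (1 - s tanh (beta s)) < 1]. The constants
    are chosen in this order: gaps depending on [beta], then [r], then the threshold for [n]. In the
    lower bound, a second moment alone would not give a statement of high probability; the fourth
    moment decays at the square of the rate of the second up to [O(1/n^2)] per step, so that the
    leading terms cancel in the variance. *)

Lemma eq_ler (R : numDomainType) (x y : R) : x = y -> x <= y.
Proof. by move=> ->. Qed.

Section Hyperbolic.
Variable R : realType.
Implicit Types x y a b t : R.

Definition cosh x : R := (expR x + expR (- x)) / 2.
Definition sinh x : R := (expR x - expR (- x)) / 2.

Lemma expR_cosh_sinh x : expR x = cosh x + sinh x.
Proof. by rewrite /cosh /sinh; field. Qed.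

Lemma expRN_cosh_sinh x : expR (- x) = cosh x - sinh x.
Proof. by rewrite /cosh /sinh; field. Qed.

Lemma coshN x : cosh (- x) = cosh x.
Proof. by rewrite /cosh opprK addrC. Qed.

Lemma sinhN x : sinh (- x) = - sinh x.
Proof. by rewrite /sinh opprK; field. Qed.

Lemma cosh0 : cosh 0 = 1 :> R.
Proof. by rewrite /cosh oppr0 expR0; field. Qed.

Lemma sinh0 : sinh 0 = 0 :> R.
Proof. by rewrite /sinh oppr0 expR0; field. Qed.

Lemma sinhD x y : sinh (x + y) = sinh x * cosh y + cosh x * sinh y.
Proof. by rewrite /sinh /cosh opprD !expRD; field. Qed.

Lemma sinhB x y : sinh (x - y) = sinh x * cosh y - cosh x * sinh y.
Proof. by rewrite sinhD sinhN coshN mulrN. Qed.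

Lemma coshD x y : cosh (x + y) = cosh x * cosh y + sinh x * sinh y.
Proof. by rewrite /sinh /cosh opprD !expRD; field. Qed.

Lemma cosh_gt0 x : 0 < cosh x.
Proof. by rewrite /cosh divr_gt0 ?ltr0n ?addr_gt0 ?expR_gt0. Qed.

Lemma is_derive_expRM a x :
  is_derive x 1 (fun t => expR (a * t)) (a * expR (a * x)).
Proof.
have h : is_derive x 1 (fun t : R => a * t) a.
  have := is_deriveZ a (is_derive_id x (1 : R)).
  by rewrite /GRing.scale /= mulr1.
by have := is_derive1_comp (is_derive_expR (a * x)) h; rewrite mulrC.
Qed.

Lemma is_derive_coshM a x :
  is_derive x 1 (fun t => cosh (a * t)) (a * sinh (a * x)).
Proof.
pose f t : R := expR (a * t); pose g t : R := expR (- a * t).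
have -> : (fun t => cosh (a * t)) = 2^-1 \*: (f + g).
  by apply/funext => t; rewrite /cosh -mulNr mulrC.
have := is_deriveZ 2^-1 (is_deriveD (f := f) (g := g) (is_derive_expRM a x) (is_derive_expRM (- a) x)).
by move=> h; apply: (is_derive_eq h); rewrite /sinh /GRing.scale /= !mulNr; field.
Qed.

Lemma is_derive_sinhM a x :
  is_derive x 1 (fun t => sinh (a * t)) (a * cosh (a * x)).
Proof.
pose f t : R := expR (a * t); pose g t : R := expR (- a * t).
have -> : (fun t => sinh (a * t)) = 2^-1 \*: (f - g).
  by apply/funext => t; rewrite /sinh -mulNr mulrC.
have := is_deriveZ 2^-1 (is_deriveB (f := f) (g := g) (is_derive_expRM a x) (is_derive_expRM (- a) x)).
by move=> h; apply: (is_derive_eq h); rewrite /cosh /GRing.scale /= !mulNr; field.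
Qed.

Lemma is_derive_coshE x : is_derive x 1 cosh (sinh x).
Proof.
have := is_derive_coshM 1 x; rewrite !mul1r.
by have -> // : (fun t => cosh (1 * t)) = cosh; apply/funext => t; rewrite mul1r.
Qed.

Lemma is_derive_sinhE x : is_derive x 1 sinh (cosh x).
Proof.
have := is_derive_sinhM 1 x; rewrite !mul1r.
by have -> // : (fun t => sinh (1 * t)) = sinh; apply/funext => t; rewrite mul1r.
Qed.

(** The mean value theorem for [g - f]. The polynomial bounds on [sinh] and [cosh] below are
    obtained from one another by integrating once with it. *)
Lemma le_of_derive (f g df dg : R -> R) x :
    (forall t, is_derive t 1 f (df t)) -> (forall t, is_derive t 1 g (dg t)) ->
    0 <= x -> f 0 = g 0 -> (forall t, 0 <= t <= x -> df t <= dg t) ->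
  f x <= g x.
Proof.
move=> fdf gdg x0 fg0 dfg.
have D t := is_deriveB (gdg t) (fdf t).
have cf : {within `[0, x], continuous (g - f)}%classic.
  by apply: derivable_within_continuous => t _; have [] := D t.
have [c] := MVT_segment x0 (fun t _ => D t) cf.
rewrite in_itv /= => cx; rewrite !fctE fg0 subrr !subr0 => E.
by rewrite -subr_ge0 E mulr_ge0// subr_ge0 dfg.
Qed.

Lemma is_derive_monomial c (n : nat) x :
  is_derive x 1 (fun t : R => c * t ^+ n.+1) (c * (n.+1%:R * x ^+ n)).
Proof.
pose f t : R := t.
have -> : (fun t : R => c * t ^+ n.+1) = c \*: (f ^+ n.+1).
  by apply/funext => t; rewrite /= exprfctE.
have h := is_deriveZ c (is_deriveX n.+1 (is_derive_id x (1 : R))).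
by apply: (is_derive_eq h); rewrite /GRing.scale /= mulr1 mulr_natl.
Qed.

Lemma is_derive_quartic c0 c1 c2 c3 c4 x :
  is_derive x 1 (fun t : R => c0 + c1 * t + c2 * t ^+ 2 + c3 * t ^+ 3 + c4 * t ^+ 4)
    (c1 + 2 * c2 * x + 3 * c3 * x ^+ 2 + 4 * c4 * x ^+ 3).
Proof.
have h := is_deriveD (is_deriveD (is_deriveD (is_deriveD (is_derive_cst c0 x (1 : R))
  (is_derive_monomial c1 0 x)) (is_derive_monomial c2 1 x)) (is_derive_monomial c3 2 x))
  (is_derive_monomial c4 3 x).
by apply: (is_derive_eq h); ring.
Qed.

Lemma cosh_ge1 x : 1 <= cosh x.
Proof.
rewrite /cosh expRN; have := expR_gt0 x; set e := expR x => e0.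
rewrite ler_pdivlMr// -subr_ge0.
have -> : e + e^-1 - 1 * 2 = (e - 1) ^+ 2 / e by field; rewrite gt_eqF.
by rewrite divr_ge0 ?sqr_ge0// ltW.
Qed.

Lemma sinh_ge x : 0 <= x -> x <= sinh x.
Proof.
move=> x0.
have := le_of_derive (is_derive_quartic 0 1 0 0 0) is_derive_sinhE x0.
rewrite sinh0 !expr0n /= => H.
have /H : 0 + 1 * 0 + 0 * 0 + 0 * 0 + 0 * 0 = 0 :> R by ring.
suff h : forall t, 0 <= t <= x ->
  1 + 2 * 0 * t + 3 * 0 * t ^+ 2 + 4 * 0 * t ^+ 3 <= cosh t by move=> /(_ h); lra.
by move=> t _; have := cosh_ge1 t; lra.
Qed.

(** Strictness comes from the duplication formula: [cosh (x / 2) = 1] would give [expR (x / 2) *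
    expR (- (x / 2)) = 1 - sinh (x / 2) ^+ 2 < 1]. *)
Lemma sinh_gt x : 0 < x -> x < sinh x.
Proof.
move=> x0; have y0 : 0 < x / 2 by rewrite divr_gt0.
have -> : sinh x = 2 * (sinh (x / 2) * cosh (x / 2)).
  by rewrite [in LHS](_ : x = x / 2 + x / 2) ?sinhD; [ring | field].
have h1 := sinh_ge (ltW y0); have h2 := cosh_ge1 (x / 2).
have : 1 < cosh (x / 2); last by nra.
rewrite lt_neqAle h2 andbT; apply/eqP => E.
have := expR_cosh_sinh (x / 2); rewrite -E => E1.
have := expRN_cosh_sinh (x / 2); rewrite -E => E2.
have := expRD (x / 2) (- (x / 2)); rewrite subrr expR0 E1 E2.
by nra.
Qed.

Lemma cosh_ge x : 0 <= x -> 1 + x ^+ 2 / 2 <= cosh x.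
Proof.
move=> x0.
have := le_of_derive (is_derive_quartic 1 0 2^-1 0 0) is_derive_coshE x0.
rewrite cosh0 !expr0n /= => H.
have /H : 1 + 0 * 0 + 2^-1 * 0 + 0 * 0 + 0 * 0 = 1 :> R by ring.
suff h : forall t, 0 <= t <= x ->
  0 + 2 * 2^-1 * t + 3 * 0 * t ^+ 2 + 4 * 0 * t ^+ 3 <= sinh t by move=> /(_ h); lra.
by move=> t /andP[/sinh_ge]; lra.
Qed.

Lemma cosh_le2 x : 0 <= x <= 2^-1 -> cosh x <= 2.
Proof.
move=> /andP[x0 x1]; rewrite /cosh.
have h1 : expR x <= expR 2^-1 by rewrite ler_expR.
have h2 : expR (- x) <= 1 by rewrite -[leRHS]expR0 ler_expR oppr_le0.
have h3 : expR 2^-1 <= 2 :> R.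
  have := expR_ge1Dx (- 2^-1 : R); rewrite expRN => h.
  rewrite -[leLHS]invrK -[leRHS]invrK lef_pV2 ?posrE ?invr_gt0 ?expR_gt0//.
  by apply: le_trans h; lra.
by lra.
Qed.

Lemma sinh_le x : 0 <= x <= 2^-1 -> sinh x <= x + x ^+ 3.
Proof.
have bound t u : 0 <= t <= 2^-1 -> 0 <= u <= t -> 0 <= u <= 2^-1.
  by move=> /andP[_ t1] /andP[-> ut] /=; exact: le_trans ut t1.
have h1 t : 0 <= t <= 2^-1 -> sinh t <= 2 * t.
  move=> tb; have /andP[t0 _] := tb.
  have := le_of_derive is_derive_sinhE (is_derive_quartic 0 2 0 0 0) t0.
  rewrite sinh0 !expr0n /= => H.
  have /esym/H : 0 + 2 * 0 + 0 * 0 + 0 * 0 + 0 * 0 = 0 :> R by ring.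
  suff h : forall u, 0 <= u <= t -> cosh u <=
    2 + 2 * 0 * u + 3 * 0 * u ^+ 2 + 4 * 0 * u ^+ 3 by move=> /(_ h); lra.
  by move=> u /(bound _ _ tb)/cosh_le2; lra.
have h2 t : 0 <= t <= 2^-1 -> cosh t <= 1 + t ^+ 2.
  move=> tb; have /andP[t0 _] := tb.
  have := le_of_derive is_derive_coshE (is_derive_quartic 1 0 1 0 0) t0.
  rewrite cosh0 !expr0n /= => H.
  have /esym/H : 1 + 0 * 0 + 1 * 0 + 0 * 0 + 0 * 0 = 1 :> R by ring.
  suff h : forall u, 0 <= u <= t -> sinh u <=
    0 + 2 * 1 * u + 3 * 0 * u ^+ 2 + 4 * 0 * u ^+ 3 by move=> /(_ h); lra.
  by move=> u /(bound _ _ tb)/h1; lra.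
move=> xb; have /andP[x0 _] := xb.
have := le_of_derive is_derive_sinhE (is_derive_quartic 0 1 0 1 0) x0.
rewrite sinh0 !expr0n /= => H.
have /esym/H : 0 + 1 * 0 + 0 * 0 + 1 * 0 + 0 * 0 = 0 :> R by ring.
suff h : forall u, 0 <= u <= x -> cosh u <=
  1 + 2 * 0 * u + 3 * 1 * u ^+ 2 + 4 * 0 * u ^+ 3 by move=> /(_ h); lra.
by move=> u /(bound _ _ xb)/h2; have := sqr_ge0 u; lra.
Qed.

Lemma cosh_le x : 0 <= x <= 2^-1 -> cosh x <= 1 + x ^+ 2 / 2 + x ^+ 4.
Proof.
move=> /andP[x0 x1].
have := le_of_derive is_derive_coshE (is_derive_quartic 1 0 2^-1 0 1) x0.
rewrite cosh0 !expr0n /= => H.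
have /esym/H : 1 + 0 * 0 + 2^-1 * 0 + 0 * 0 + 1 * 0 = 1 :> R by ring.
suff h : forall u, 0 <= u <= x -> sinh u <=
  0 + 2 * 2^-1 * u + 3 * 0 * u ^+ 2 + 4 * 1 * u ^+ 3 by move=> /(_ h); lra.
move=> u /andP[u0 ux]; have /sinh_le : 0 <= u <= 2^-1 by rewrite u0 (le_trans ux x1).
by have := exprn_ge0 3 u0; lra.
Qed.

Lemma sinh_ge0 x : 0 <= x -> 0 <= sinh x.
Proof. by move=> x0; exact: le_trans (sinh_ge x0). Qed.

Lemma le_cosh x y : 0 <= x <= y -> cosh x <= cosh y.
Proof.
move=> /andP[x0 xy]; have d0 : 0 <= y - x by rewrite subr_ge0.
rewrite -[y](addrNK x) addrC coshD.
have h1 := mulr_ge0 (sinh_ge0 x0) (sinh_ge0 d0).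
have h2 := mulr_ge0 (ltW (cosh_gt0 x)) (_ : 0 <= cosh (y - x) - 1).
by have := h2; rewrite subr_ge0 cosh_ge1 => /(_ isT); lra.
Qed.

(** With [w = (1 - q) / (1 + q)] and [u = (1 + q) x], the addition formulas turn this into the
    concavity of tanh. *)
Lemma sinh_convex (w u : R) : 0 <= w <= 1 -> 0 <= u -> sinh (w * u) <= w * sinh u.
Proof.
move=> /andP[w0 w1] u0.
have D t : is_derive t 1 (w \*: sinh) (w * cosh t).
  by have := is_deriveZ w (is_derive_sinhE t).
have := le_of_derive (is_derive_sinhM w) D u0.
rewrite mulr0 sinh0 /= sinh0 /GRing.scale /= mulr0; apply=> // t /andP[t0 _].
by rewrite ler_wpM2l// le_cosh// mulr_ge0//= ler_piMl.
Qed.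

(* Concavity of tanh on [0, oo[, without division: tanh (q x) >= q tanh x. *)
Lemma tanh_concave (q x : R) : 0 <= q <= 1 -> 0 <= x ->
  q * (sinh x * cosh (q * x)) <= cosh x * sinh (q * x).
Proof.
move=> /andP[q0 q1] x0.
have q1p : 0 < 1 + q by rewrite ltr_wpDr.
have := @sinh_convex ((1 - q) / (1 + q)) ((1 + q) * x).
rewrite mulrA divfK ?gt_eqF// divr_ge0 ?subr_ge0 ?(ltW q1p)//= ler_pdivrMr// mul1r.
have -> : 1 - q <= 1 + q by lra.
rewrite (mulr_ge0 (ltW q1p) x0) => /(_ isT isT).
have -> : (1 - q) * x = x - q * x by ring.
have -> : (1 + q) * x = x + q * x by ring.
rewrite mulrAC ler_pdivlMr// sinhB sinhD.
by move: (sinh x) (cosh x) (sinh (q * x)) (cosh (q * x)) => S C s c; nra.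
Qed.

Lemma le_tanh x y : 0 <= x <= y -> sinh x * cosh y <= cosh x * sinh y.
Proof.
move=> /andP[_ xy]; have : 0 <= y - x by rewrite subr_ge0.
by move/sinh_ge0; rewrite sinhB; lra.
Qed.

End Hyperbolic.

(** * Markov operators on finite sets *)

Section MarkovOperator.
Variables (R : realType) (T : finType) (K : T -> T -> R).
Implicit Types (f g : T -> R) (x y : T) (p : {ffun T -> R}) (A : {set T}) (t : nat).

Definition expect f x : R := \sum_y K x y * f y.

Lemma eq_expect f g : f =1 g -> expect f =1 expect g.
Proof. by move=> fg x; apply: eq_bigr => y _; rewrite fg. Qed.

Lemma law_expect x t f : \sum_y law K x t y * f y = iter t expect f x.
Proof.
elim: t f => [|t IH] f /=.
  rewrite (bigD1 x)//= ffunE eqxx mul1r big1 ?addr0// => y /negPf yx.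
  by rewrite ffunE yx mul0r.
rewrite -[RHS]/(iter t.+1 expect f x) iterSr -IH.
under eq_bigr do rewrite ffunE mulr_suml.
rewrite exchange_big; apply: eq_bigr => z _; rewrite mulr_sumr.
by apply: eq_bigr => y _; rewrite mulrA.
Qed.

Lemma law_set x t A :
  \sum_(y in A) law K x t y = iter t expect (fun y => (y \in A)%:R) x.
Proof.
rewrite -law_expect big_mkcond; apply: eq_bigr => y _.
by case: (y \in A); rewrite ?mulr1 ?mulr0.
Qed.

Lemma stationary_expect p t f : stationary K p ->
  \sum_x p x * iter t expect f x = \sum_x p x * f x.
Proof.
move=> [_ _ pK]; elim: t => //= t <-; under eq_bigr do rewrite mulr_sumr.
rewrite exchange_big; apply: eq_bigr => y _; rewrite -[in RHS](pK y) mulr_suml.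
by apply: eq_bigr => x _; rewrite mulrA.
Qed.

Hypothesis K_ge0 : forall x y, 0 <= K x y.
Hypothesis K_sum1 : forall x, \sum_y K x y = 1.

Lemma le_expect f g x : (forall y, f y <= g y) -> expect f x <= expect g x.
Proof. by move=> fg; apply: ler_sum => y _; rewrite ler_wpM2l. Qed.

Lemma expect_affine a b f x :
  expect (fun y => a * f y + b) x = a * expect f x + b.
Proof.
rewrite /expect mulr_sumr -[X in _ + X]mul1r -(K_sum1 x) mulr_suml -big_split/=.
by apply: eq_bigr => y _; rewrite mulrDr mulrCA.
Qed.

Lemma le_iter_expect t f g x :
  (forall y, f y <= g y) -> iter t expect f x <= iter t expect g x.
Proof. by move=> fg; elim: t x => //= t IH x; exact: le_expect. Qed.

Lemma iter_expect_affine t a b f x :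
  iter t expect (fun y => a * f y + b) x = a * iter t expect f x + b.
Proof.
by elim: t x => //= t IH x; rewrite (eq_expect IH) expect_affine.
Qed.

Lemma iter_expect_bounds t f l u : (forall y, l <= f y <= u) ->
  forall x, l <= iter t expect f x <= u.
Proof.
move=> fb; elim: t => //= t IH x; apply/andP; split.
  rewrite -[leLHS]addr0 -[leLHS]addrC -[l in leLHS]add0r.
  have -> : 0 + (0 + l) = expect (fun=> 0 * 0 + l) x.
    by rewrite (expect_affine 0 l (fun=> 0)) !mul0r !add0r.
  by apply: le_expect => y; rewrite mul0r add0r; have /andP[] := IH y.
have -> : u = expect (fun=> 0 * 0 + u) x.
  by rewrite (expect_affine 0 u (fun=> 0)) !mul0r !add0r.
by apply: le_expect => y; rewrite mul0r add0r; have /andP[] := IH y.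
Qed.

(** By stationarity the mass of [A] is the stationary average of the iterated indicator, so its
    distance to any single value is at most the oscillation. Existence of a stationary law excludes
    the null default of [stationary_law]. *)
Lemma le_worst_tv t (c : R) : 0 <= c ->
    (exists p, stationary K p) ->
    (forall A x y, `|iter t expect (fun y => (y \in A)%:R) x
                     - iter t expect (fun y => (y \in A)%:R) y| <= c) ->
  worst_tv K t <= c.
Proof.
move=> c0 exp hc; apply: bigmax_le => // x _; apply: bigmax_le => // A _.
have [p0 p1 pK] : stationary K (stationary_law K) := xgetPex _ exp.
set p := stationary_law K in p0 p1 pK *; pose f y : R := (y \in A)%:R.
have sp : stationary K p by split.
rewrite law_set big_mkcond /=.
have -> : \sum_x (if x \in A then p x else 0) = \sum_x p x * iter t expect f x.
  rewrite (stationary_expect _ _ sp); apply: eq_bigr => y _.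
  by rewrite /f; case: (y \in A); rewrite ?mulr1 ?mulr0.
have hcx := hc A x; move: (iter t _ _ x) hcx => E hcx.
rewrite -[E]mul1r -p1 mulr_suml -sumrB.
apply: le_trans (ler_norm_sum _ _ _) _; rewrite -[c]mul1r -p1 mulr_suml.
by apply: ler_sum => y _; rewrite -mulrBr normrM ger0_norm// ler_wpM2l//; exact: hcx.
Qed.

Lemma ge_worst_tv t A x :
  `|\sum_(y in A) law K x t y - \sum_(y in A) stationary_law K y| <= worst_tv K t.
Proof.
apply: le_trans (le_bigmax _ (fun x => tv_dist (law K x t) (stationary_law K)) x).
exact: (le_bigmax _ (fun A : {set T} =>
  `|\sum_(y in A) law K x t y - \sum_(y in A) stationary_law K y|) A).
Qed.

(** * Geometric ergodicity from a minorization condition *)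

Section Minorization.
Variables (m : nat) (d : R) (x0 : T).
Hypothesis d_gt0 : 0 < d.
Hypothesis minor : forall f x, (forall y, 0 <= f y) -> d * f x0 <= iter m expect f x.

Lemma minor_le1 : d <= 1.
Proof.
have b y : 0 <= (fun=> 1 : R) y <= 1 by rewrite ler01 lexx.
have /andP[_] := iter_expect_bounds m b x0; apply: le_trans.
by rewrite -[leLHS]mulr1; apply: (minor (f := fun=> 1)).
Qed.

(** Doeblin's argument: the minorization applied to [f - l] and to [u - f] moves each end of the
    range by the fraction [d] of its distance to [f x0], so the length shrinks by [1 - d]. *)
Lemma minor_contract f l u : (forall y, l <= f y <= u) ->
  exists l', forall x, l' <= iter m expect f x <= l' + (1 - d) * (u - l).
Proof.
move=> fb; exists (l + d * (f x0 - l)) => x; apply/andP; split.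
  have := minor (f := fun y => 1 * f y + - l) x.
  rewrite iter_expect_affine !mul1r => H.
  rewrite addrC -lerBrDr; apply: H => y; rewrite mul1r subr_ge0.
  by have /andP[] := fb y.
have := minor (f := fun y => (-1) * f y + u) x.
rewrite iter_expect_affine !mulN1r => H.
have /H : forall y, 0 <= - 1 * f y + u.
  by move=> y; have /andP[_] := fb y; lra.
by lra.
Qed.

Lemma minor_contract_iter k f l u : (forall y, l <= f y <= u) ->
  exists l', forall x, l' <= iter (k * m) expect f x <= l' + (1 - d) ^+ k * (u - l).
Proof.
move=> fb; elim: k => [|k [l' IH]].
  by exists l => x; rewrite expr0 mul1r addrC subrK.
have [l2 h] := minor_contract IH; exists l2 => x.
by rewrite mulSn iterD exprS -mulrA; have := h x; rewrite [X in _ * X]addrAC subrr add0r.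
Qed.

Lemma minor_mixes e : 0 < e -> exists t, forall f, (forall y, 0 <= f y <= 1) ->
  exists l, forall s x, (t <= s)%N -> l <= iter s expect f x <= l + e.
Proof.
move=> e0.
have d1 : `|1 - d| < 1 by rewrite ger0_norm ?subr_ge0 ?minor_le1// gtrBl.
have := cvg_expr d1 => /cvgrPdist_lt /(_ _ e0) [k _ /(_ k (leqnn k))].
rewrite /= sub0r normrN => /ltW hk; exists (k * m)%N => f fb.
have [l h] := minor_contract_iter k fb; exists l => s x ts.
rewrite -(subnK ts) iterD.
apply: iter_expect_bounds => y; have /andP[-> /le_trans ->//] := h y.
by rewrite lerD2l subr0 mulr1 (le_trans (ler_norm _)).
Qed.

(** The laws started at [x0] are pointwise Cauchy by [minor_mixes]; passing to the limit in the
    one-step recursion makes their limit stationary. *)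
Lemma minor_stationary : exists p, stationary K p.
Proof.
pose a y t := law K x0 t y.
have aE y t : a y t = iter t expect (fun z => (z == y)%:R) x0.
  rewrite -law_expect (bigD1 y)//= eqxx mulr1 big1 ?addr0//.
  by move=> z /negPf ->; rewrite mulr0.
have a_cvg y : cvgn (a y).
  apply: cauchy_cvg; apply: cauchy_exP => e e0.
  have [|t ht] := minor_mixes (e := e / 2); first by rewrite divr_gt0.
  have [|l hl] := ht (fun z => (z == y)%:R).
    by move=> z; case: (z == y); rewrite ?ler01 ?lexx.
  exists l, t => // s /= ts; rewrite /ball /= aE.
  have /andP[h1 h2] := hl _ x0 ts.
  rewrite distrC ger0_norm ?subr_ge0//; lra.
pose p : {ffun T -> R} := [ffun y => limn (a y)].
have pE y : (a y @ \oo --> p y)%classic by rewrite ffunE; exact: a_cvg.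
have a_ge0 y t : 0 <= a y t.
  have b z : 0 <= (fun z => (z == y)%:R : R) z <= 1.
    by case: (z == y); rewrite ?ler01 ?lexx.
  by rewrite aE; have /andP[] := iter_expect_bounds t b x0.
have sum_cvg (c : T -> R) : ((fun t => \sum_y a y t * c y) @ \oo --> \sum_y p y * c y)%classic.
  apply: (@cvg_big _ _ _ _ _ add_continuous) => y _.
  by apply: cvgM; [exact: pE | exact: cvg_cst].
exists p; split.
- by move=> y; rewrite ffunE; apply: limr_ge; [exact: a_cvg | near=> t; exact: a_ge0].
- have h := sum_cvg (fun=> 1).
  have b (z : T) : 1 <= (fun=> 1 : R) z <= 1 by rewrite lexx.
  have e1 : (fun t => \sum_y a y t * 1) = fun=> 1.
    apply/funext => t; rewrite law_expect.
    by apply/eqP; rewrite eq_le andbC; exact: (iter_expect_bounds t b x0).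
  rewrite e1 in h; under eq_bigr do rewrite -[p _]mulr1.
  exact/esym/(cvg_unique _ (cvg_cst _) h).
- move=> y; have h := sum_cvg (K^~ y).
  have e1 : (fun t => \sum_z a z t * K z y) = fun t => a y t.+1.
    by apply/funext => t; rewrite /a /= ffunE.
  rewrite e1 in h; have h' := pE y; rewrite -cvg_shiftS in h'.
  exact: (cvg_unique _ h h').
Unshelve. all: by end_near.
Qed.

End Minorization.
End MarkovOperator.

(** * The restricted dynamics *)

Section UpdateProbability.
Variables (R : realType) (beta : R).

Lemma p_plusE (s : R) :
  p_plus beta s = expR (beta * s) / (expR (beta * s) + expR (- (beta * s))).
Proof.
rewrite /p_plus /tanh; field.
by rewrite gt_eqF// addr_gt0 ?expR_gt0.
Qed.

Lemma p_plus_compl (s : R) :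
  1 - p_plus beta s = expR (- (beta * s)) / (expR (beta * s) + expR (- (beta * s))).
Proof. by rewrite p_plusE; field; rewrite gt_eqF// addr_gt0 ?expR_gt0. Qed.

Lemma p_plus_ge0 (s : R) : 0 <= p_plus beta s.
Proof. by rewrite p_plusE divr_ge0 ?addr_ge0 ?expR_ge0. Qed.

Lemma p_plus_compl_ge0 (s : R) : 0 <= 1 - p_plus beta s.
Proof. by rewrite p_plus_compl divr_ge0 ?addr_ge0 ?expR_ge0. Qed.

Lemma p_plusN (s : R) : p_plus beta (- s) = 1 - p_plus beta s.
Proof. by rewrite p_plus_compl p_plusE mulrN opprK [X in _ / X]addrC. Qed.

(** This is [p_plus beta (-1)], the least probability of either spin when the field lies in
    [[-1, 1]]. *)
Definition min_rate : R := (1 + expR (2 * beta))^-1.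

Lemma min_rate_gt0 : 0 < min_rate.
Proof. by rewrite invr_gt0 addr_gt0 ?expR_gt0. Qed.

Hypothesis beta_ge0 : 0 <= beta.

Lemma min_rate_le (s : R) : s <= 1 -> min_rate <= 1 - p_plus beta s.
Proof.
move=> s1; rewrite p_plus_compl expRN.
set e := expR (beta * s); have e0 : 0 < e := expR_gt0 _.
have -> : e^-1 / (e + e^-1) = (1 + e ^+ 2)^-1.
  by field; rewrite !gt_eqF// ?addr_gt0 ?exprn_gt0// mulr_gt0.
rewrite lef_pV2 ?posrE ?addr_gt0 ?exprn_gt0 ?expR_gt0// lerD2l.
have <- : expR (2 * (beta * s)) = e ^+ 2 by rewrite expRM_natl.
by rewrite ler_expR ler_pM2l// ler_piMr.
Qed.

Lemma min_rate_le_p (s : R) : -1 <= s -> min_rate <= p_plus beta s.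
Proof.
move=> s1; have := @min_rate_le (- s); rewrite p_plusN.
by rewrite opprB addrC subrK lerNl; apply.
Qed.

End UpdateProbability.

Section Configurations.
Variables (R : realType) (n : nat).
Implicit Types (s : config n) (i j : 'I_n) (b : bool).

Definition nplus s : nat := \sum_(i < n) s i.

Lemma nplus_le s : (nplus s <= n)%N.
Proof.
rewrite -[leqRHS]card_ord -sum1_card; apply: leq_sum => i _.
by case: (s i).
Qed.

Lemma magnE s : magn R s = ((nplus s)%:R *+ 2 - n%:R) / n%:R.
Proof.
rewrite /magn mulrC; congr (_ / _).
have -> : n%:R = \sum_(i < n) 1 :> R by rewrite sumr_const card_ord.
rewrite natr_sum -sumrMnl -sumrB; apply: eq_bigr => i _.
by rewrite /spin; case: (s i) => /=; lra.
Qed.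

Lemma magn_ge0 s : (0 <= magn R s) = (n <= (nplus s).*2)%N.
Proof.
rewrite magnE; have [n0|n0] := posnP n.
  have -> : n%:R = 0 :> R by rewrite n0.
  by rewrite invr0 mulr0 lexx; apply/esym; lia.
by rewrite pmulr_lge0 ?invr_gt0 ?ltr0n// subr_ge0 -mulrnA ler_nat muln2.
Qed.

Lemma nplus_opp s : nplus (opp_config s) = (n - nplus s)%N.
Proof.
suff H : (nplus s + nplus (opp_config s) = n)%N by lia.
rewrite -big_split -[RHS]card_ord -sum1_card; apply: eq_bigr => i _ /=.
by rewrite ffunE; case: (s i).
Qed.

Lemma nplus_fold s : nplus (fold_config R s) = maxn (nplus s) (n - nplus s).
Proof.
rewrite /fold_config magn_ge0; have := nplus_le s.
by case: ifP => h; rewrite ?nplus_opp; lia.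
Qed.

Lemma fold_config_ge0 s : 0 <= magn R (fold_config R s).
Proof. by rewrite magn_ge0 nplus_fold; have := nplus_le s; lia. Qed.

Definition fold_plus s : config_plus R n := Sub (fold_config R s) (fold_config_ge0 s).

Lemma nplus_fold_plus s :
  nplus (val (fold_plus s)) = maxn (nplus s) (n - nplus s).
Proof. exact: nplus_fold. Qed.

Lemma nplus_ge (x : config_plus R n) : (n <= (nplus (val x)).*2)%N.
Proof. by rewrite -magn_ge0; exact: (valP x). Qed.

Lemma nplus_setT s i : nplus (set_spin s i true) = (nplus s + ~~ s i)%N.
Proof.
rewrite /nplus (bigD1 i)//= [in RHS](bigD1 i)//= ffunE eqxx.
rewrite (eq_bigr (fun j => nat_of_bool (s j))); last by move=> j /negPf ji; rewrite ffunE ji.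
by case: (s i) => /=; lia.
Qed.

Lemma nplus_setF s i : nplus (set_spin s i false) = (nplus s - s i)%N.
Proof.
rewrite /nplus (bigD1 i)//= [in RHS](bigD1 i)//= ffunE eqxx.
rewrite (eq_bigr (fun j => nat_of_bool (s j))); last by move=> j /negPf ji; rewrite ffunE ji.
by case: (s i) => /=; lia.
Qed.

Definition swap s i j : config n := [ffun k => s (tperm i j k)].

Lemma nplus_swap s i j : nplus (swap s i j) = nplus s.
Proof.
rewrite /nplus [in RHS](reindex_inj (@perm_inj _ (tperm i j))) /=.
by apply: eq_bigr => k _; rewrite ffunE.
Qed.

Lemma magn_swap s i j : magn R (swap s i j) = magn R s.
Proof. by rewrite !magnE nplus_swap. Qed.

Lemma swap_set_spin s i j k b :
  set_spin (swap s i j) (tperm i j k) b = swap (set_spin s k b) i j.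
Proof.
by apply/ffunP => l; rewrite !ffunE (canF_eq (tpermK i j)).
Qed.

Lemma fold_swap s i j : fold_config R (swap s i j) = swap (fold_config R s) i j.
Proof.
rewrite /fold_config magn_swap; case: ifP => // _.
by apply/ffunP => k; rewrite !ffunE.
Qed.

Lemma swap_id s i j : s i = s j -> swap s i j = s.
Proof.
by move=> sij; apply/ffunP => k; rewrite ffunE; case: tpermP => // ->.
Qed.

End Configurations.

(** * Contraction under exchanges of two spins *)

Section Dynamics.
Variables (R : realType) (beta : R) (n : nat).
Hypothesis beta_ge0 : 0 <= beta.
Hypothesis n_gt0 : (0 < n)%N.
Implicit Types (s : config n) (x y : config_plus R n) (i j k : 'I_n).
Implicit Types (f : config_plus R n -> R) (F : config n -> R).

Local Notation K := (@glauber_plus R beta n).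

Definition site_prob s i : R := p_plus beta (magn R s - spin R s i / n%:R).

Definition update_mean F s i : R :=
  site_prob s i * F (set_spin s i true) + (1 - site_prob s i) * F (set_spin s i false).

Definition glauber_mean F s : R := \sum_(i < n) n%:R^-1 * update_mean F s i.

Lemma glauber_meanE F s : \sum_e glauber beta s e * F e = glauber_mean F s.
Proof.
rewrite /glauber; under eq_bigr do rewrite mulr_suml.
rewrite exchange_big; apply: eq_bigr => i _.
have pick (e0 : config n) : \sum_e (e == e0)%:R * F e = F e0.
  rewrite (bigD1 e0)//= eqxx mul1r big1 ?addr0// => e /negPf ->.
  by rewrite mul0r.
rewrite /update_mean /site_prob /=; set p := p_plus _ _.
transitivity (\sum_e (n%:R^-1 * p * ((e == set_spin s i true)%:R * F e) +
    n%:R^-1 * (1 - p) * ((e == set_spin s i false)%:R * F e))).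
  by apply: eq_bigr => e _; ring.
by rewrite big_split -!mulr_sumr !pick /=; ring.
Qed.

Lemma expect_glauberE f x : expect K f x = glauber_mean (f \o @fold_plus R n) (val x).
Proof.
rewrite -glauber_meanE /expect /glauber_plus.
under eq_bigr do rewrite mulr_suml.
rewrite (exchange_big_dep xpredT)//=; apply: eq_bigr => e _.
by rewrite -mulr_sumr (big_pred1 (fold_plus R e)).
Qed.

Lemma magn_shift_bound s i : -1 <= magn R s - spin R s i / n%:R <= 1.
Proof.
have n0 : 0 < n%:R :> R by rewrite ltr0n.
have hN := nplus_le s.
have h1 : (s i <= nplus s)%N by rewrite /nplus (bigD1 i)//= leq_addr.
have h2 : (~~ s i <= n - nplus s)%N.
  by rewrite -nplus_opp /nplus (bigD1 i)//= ffunE leq_addr.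
rewrite magnE -mulrBl ler_pdivlMr// ler_pdivrMr//.
move: h1 h2; rewrite /spin; case: (s i) => /= h1 h2.
  have : (1 : R) <= (nplus s)%:R by rewrite ler1n.
  have : (nplus s)%:R <= n%:R :> R by rewrite ler_nat.
  by move=> *; apply/andP; split; lra.
have : (nplus s)%:R + 1 <= n%:R :> R by rewrite -(natrD _ _ 1) ler_nat; lia.
by have := ler0n R (nplus s); move=> *; apply/andP; split; lra.
Qed.

Local Notation q := (min_rate beta).

Lemma site_prob_ge s i : q <= site_prob s i.
Proof. by apply: min_rate_le_p => //; have /andP[] := magn_shift_bound s i. Qed.

Lemma site_prob_compl_ge s i : q <= 1 - site_prob s i.
Proof. by apply: min_rate_le => //; have /andP[] := magn_shift_bound s i. Qed.

Lemma site_prob_ge0 s i : 0 <= site_prob s i.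
Proof. exact: le_trans (ltW (min_rate_gt0 _)) (site_prob_ge s i). Qed.

Lemma site_prob_compl_ge0 s i : 0 <= 1 - site_prob s i.
Proof. exact: le_trans (ltW (min_rate_gt0 _)) (site_prob_compl_ge s i). Qed.

Lemma glauber_plus_ge0 x y : 0 <= K x y.
Proof.
apply: sumr_ge0 => e _; apply: sumr_ge0 => i _.
rewrite mulr_ge0 ?invr_ge0 ?ler0n// addr_ge0// mulr_ge0 ?ler0n//.
  exact: site_prob_ge0.
exact: site_prob_compl_ge0.
Qed.

Lemma glauber_plus_sum1 x : \sum_y K x y = 1.
Proof.
transitivity (expect K (fun=> 1) x); first by apply: eq_bigr => y _; rewrite mulr1.
rewrite expect_glauberE /glauber_mean /update_mean /=.
under eq_bigr do rewrite !mulr1 addrC subrK mulr1.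
by rewrite sumr_const card_ord -[LHS]mulr_natl divff// pnatr_eq0 -lt0n.
Qed.

Definition swap_lipschitz (l : R) f := forall x y i j,
  val y = swap (val x) i j -> `|f x - f y| <= l.

Lemma swap_lipschitz_fold l f s i j : swap_lipschitz l f ->
  `|f (fold_plus R s) - f (fold_plus R (swap s i j))| <= l.
Proof. by move=> fl; apply: fl; rewrite /= fold_swap. Qed.

Lemma spin_swap s i j k : spin R (swap s i j) (tperm i j k) = spin R s k.
Proof. by rewrite /spin ffunE tpermK. Qed.

Lemma min_rate_contraction : 0 <= 1 - 2 * q / n%:R.
Proof.
have n1 : (1 : R) <= n%:R by rewrite ler1n.
have : 2 * q <= 1.
  have i0 : 'I_n := Ordinal n_gt0.
  by have := site_prob_ge [ffun=> true] i0; have := site_prob_compl_ge [ffun=> true] i0; lra.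
rewrite subr_ge0; move: q => r h; rewrite ler_pdivrMr ?(lt_le_trans ltr01 n1)// mul1r.
exact: le_trans h n1.
Qed.

(** Site [k] of [s] is paired with site [tperm i j k] of the exchanged configuration: both see the
    same field, hence have the same update probability. If the exchanged spins differ and [k] is one
    of them, one of the two outcomes merges the configurations, and it has probability at least
    [q]. *)
Lemma update_mean_swap_le l f s i j k : swap_lipschitz l f ->
  `|update_mean (f \o @fold_plus R n) s k
    - update_mean (f \o @fold_plus R n) (swap s i j) (tperm i j k)|
    <= (1 - q * ((k == i) || (k == j))%:R * (s i != s j)%:R) * l.
Proof.
move=> fl; set F := f \o _; rewrite /update_mean.
have -> : site_prob (swap s i j) (tperm i j k) = site_prob s k.
  by rewrite /site_prob magn_swap spin_swap.
rewrite !swap_set_spin.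
set p := site_prob s k.
have Fb s' : `|F s' - F (swap s' i j)| <= l by exact: swap_lipschitz_fold.
have l0 : 0 <= l := le_trans (normr_ge0 _) (Fb s).
set a := F _; set b := F (set_spin s k false).
set a' := F (swap _ _ _); set b' := F (swap (set_spin s k false) i j).
have -> : p * a + (1 - p) * b - (p * a' + (1 - p) * b') = p * (a - a') + (1 - p) * (b - b').
  by ring.
have pq : q <= p := site_prob_ge s k.
have pq' : q <= 1 - p := site_prob_compl_ge s k.
have q0 := min_rate_gt0 beta.
clearbody p.
have p0 : 0 <= p by lra.
have p1 : 0 <= 1 - p by lra.
apply: le_trans (ler_normD _ _) _; rewrite !normrM (ger0_norm p0) (ger0_norm p1).
have ha : `|a - a'| <= l := Fb _.
have hb : `|b - b'| <= l := Fb _.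
have hpa := ler_wpM2l p0 ha; have hpb := ler_wpM2l p1 hb.
have ql (r : R) : q <= r -> q * l <= r * l by exact: ler_wpM2r.
have gen : p * `|a - a'| + (1 - p) * `|b - b'| <= l by lra.
case sij : (s i == s j); first by rewrite mulr0 subr0 mul1r.
rewrite mulr1; case kij : ((k == i) || (k == j)); last by rewrite mulr0 subr0 mul1r.
rewrite mulr1.
(* [v] is the spin at the other exchanged site: after this update the two sites agree and the
   exchange does nothing. *)
have [v hv] : exists v, F (set_spin s k v) = F (swap (set_spin s k v) i j).
  move: kij sij => /orP[]/eqP ->.
    exists (s j); rewrite swap_id// !ffunE eqxx; by case: eqP.
  exists (s i); rewrite swap_id// !ffunE eqxx; by case: eqP.
case: v hv => hv.
  have -> : a - a' = 0 by rewrite /a /a' hv subrr.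
  by rewrite normr0 mulr0 add0r; have := ql _ pq; lra.
have -> : b - b' = 0 by rewrite /b /b' hv subrr.
by rewrite normr0 mulr0 addr0; have := ql _ pq'; lra.
Qed.

(** Two sites out of [n] yield the gain [q], hence the rate [2 q / n]; when the two spins agree the
    configurations coincide. *)
Lemma swap_contraction l f : swap_lipschitz l f ->
  swap_lipschitz ((1 - 2 * q / n%:R) * l) (expect K f).
Proof.
move=> fl x y i j yx.
have n0 : 0 < n%:R :> R by rewrite ltr0n.
have l0 : 0 <= l := le_trans (normr_ge0 _) (fl x y i j yx).
case sij : (val x i == val x j).
  have -> : y = x by apply: val_inj; rewrite yx swap_id//; exact/eqP.
  by rewrite subrr normr0 mulr_ge0// min_rate_contraction.
rewrite !expect_glauberE yx /glauber_mean.
rewrite [X in _ - X](reindex_inj (@perm_inj _ (tperm i j))) -sumrB /=.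
apply: le_trans (ler_norm_sum _ _ _) _.
under eq_bigr do rewrite -mulrBr normrM ger0_norm ?invr_ge0 ?ler0n//.
apply: (@le_trans _ _ (\sum_(k < n) n%:R^-1 *
    ((1 - q * ((k == i) || (k == j))%:R * (val x i != val x j)%:R) * l))).
  by apply: ler_sum => k _; rewrite ler_wpM2l ?invr_ge0 ?ler0n//; exact: update_mean_swap_le.
rewrite -mulr_sumr -mulr_suml sumrB sumr_const card_ord sij /=.
under [X in _ - X]eq_bigr do rewrite mulr1.
rewrite -mulr_sumr.
have -> : \sum_(k < n) ((k == i) || (k == j))%:R = 2 :> R.
  have ij : j != i by apply: contraFN sij => /eqP ->.
  rewrite (bigD1 i)//= eqxx (bigD1 j)//= eqxx orbT big1 ?addr0//.
  by move=> k /andP[/negPf -> /negPf ->].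
apply: eq_ler; field; exact: lt0r_neq0.
Qed.

End Dynamics.

Section SwapPaths.
Variables (R : realType) (n : nat).
Implicit Types (s : config n) (x y : config_plus R n) (f : config_plus R n -> R).

Definition plus_set s : {set 'I_n} := [set i | s i].

Lemma card_plus_set s : #|plus_set s| = nplus s.
Proof.
rewrite -sum1_card /nplus big_mkcond; apply: eq_bigr => i _.
by rewrite inE; case: (s i).
Qed.

Lemma plus_set_inj : injective plus_set.
Proof.
by move=> s t /finset.setP st; apply/ffunP => i; have := st i; rewrite !inE.
Qed.

(** Exchanging a site that is plus only in [x] with one that is plus only in [y] lowers the
    difference of the plus sets by one; equal cardinalities guarantee that both sites exist. *)
Lemma swap_lipschitz_path (l : R) f y d : swap_lipschitz l f -> 
  forall x, #|plus_set (val x)| = #|plus_set (val y)| ->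
    #|plus_set (val x) :\: plus_set (val y)| = d -> `|f x - f y| <= d%:R * l.
Proof.
move=> fl; elim: d => [|d IH] x xy.
  move/eqP; rewrite cards_eq0 finset.setD_eq0 => sub.
  have -> : x = y.
    by apply/val_inj/plus_set_inj/eqP; rewrite eqEcard sub xy leqnn.
  by rewrite subrr normr0 mul0r.
move=> dS.
have /finset.set0Pn[i] : plus_set (val x) :\: plus_set (val y) != finset.set0.
  by rewrite -card_gt0 dS.
have /finset.set0Pn[j] : plus_set (val y) :\: plus_set (val x) != finset.set0.
  by rewrite -card_gt0 cardsD -xy finset.setIC -cardsD dS.
rewrite !inE => /andP[xj yj] /andP[yi xi].
have x'ge : 0 <= magn R (swap (val x) i j) by rewrite magn_swap (valP x).
pose x' : config_plus R n := Sub (swap (val x) i j) x'ge.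
have dx : #|plus_set (val x') :\: plus_set (val y)| = d.
  have -> : plus_set (val x') :\: plus_set (val y) =
      (plus_set (val x) :\: plus_set (val y)) :\ i.
    apply/finset.setP => k; rewrite !inE /= ffunE.
    by case: tpermP => [->|->|/eqP -> _] //=; rewrite ?eqxx ?yj ?(negPf xj) ?andbF.
  by have := cardsD1 i (plus_set (val x) :\: plus_set (val y)); rewrite dS !inE yi xi => -[].
have := IH x' _ dx; rewrite card_plus_set /= nplus_swap -card_plus_set => /(_ xy) h.
have h1 := fl x x' i j erefl.
rewrite mulrSr mulrDl mul1r; apply: le_trans (lerD h h1).
by rewrite -[f x - f y](subrKA (f x')) addrC ler_normD.
Qed.

Lemma swap_lipschitz_level (l : R) f x y : 0 <= l -> swap_lipschitz l f ->
  nplus (val x) = nplus (val y) -> `|f x - f y| <= n%:R * l.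
Proof.
move=> l0 fl; rewrite -!card_plus_set => xy.
apply: le_trans (swap_lipschitz_path fl xy erefl) _.
by rewrite ler_wpM2r// ler_nat -[leqRHS]card_ord max_card.
Qed.

End SwapPaths.

(** * Minorization, stationary law and mixing for the restricted dynamics *)

Section Minorization.
Variables (R : realType) (beta : R) (n : nat).
Hypothesis beta_ge0 : 0 <= beta.
Hypothesis n_gt0 : (0 < n)%N.
Local Notation K := (@glauber_plus R beta n).
Implicit Types (x y : config_plus R n) (f : config_plus R n -> R).

Definition all_plus : config_plus R n := fold_plus R [ffun=> true].

(** A prescribed minus site is turned to plus with probability at least [min_rate beta / n], and
    folding never lowers the number of pluses. The induction allows any time at least the number of
    minus sites, so the chain may also wait at [all_plus]. *)
Lemma glauber_plus_minor f x : (forall y, 0 <= f y) ->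
  (min_rate beta / n%:R) ^+ n * f all_plus <= iter n (expect K) f x.
Proof.
move=> f0; have q0 := min_rate_gt0 beta; set e := min_rate beta / n%:R.
have e0 : 0 <= e by rewrite divr_ge0// ltW.
have ge0 t y : 0 <= iter t (expect K) f y.
  elim: t y => //= t IH y; apply: sumr_ge0 => z _.
  by rewrite mulr_ge0// glauber_plus_ge0.
suff H t y : (n - nplus (val y) <= t)%N -> e ^+ t * f all_plus <= iter t (expect K) f y.
  by apply: H; exact: leq_subr.
elim: t y => [|t IH] y.
  rewrite leqn0 subn_eq0 => yn; rewrite expr0 mul1r /=.
  have -> // : all_plus = y; apply/val_inj/plus_set_inj/eqP.
  have Ty : val all_plus = [ffun=> true].
    rewrite /= /fold_config magn_ge0 [X in (_ <= X.*2)%N](_ : _ = n) ?leq_addr//.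
      by rewrite -addnn leq_addr.
    by rewrite -card_plus_set -[RHS]card_ord; apply: eq_card => i; rewrite !inE ffunE.
  rewrite eq_sym eqEcard Ty !card_plus_set; apply/andP; split.
    by apply/fintype.subsetP => i _; rewrite inE ffunE.
  exact: leq_trans (nplus_le _) yn.
move=> yt.
have step i : e * iter t (expect K) f (fold_plus R (set_spin (val y) i true)) <=
    iter t.+1 (expect K) f y.
  rewrite iterS expect_glauberE /glauber_mean (bigD1 i)//=.
  rewrite -[leLHS]addr0 lerD//.
    rewrite /e mulrAC mulrC ler_wpM2l ?invr_ge0 ?ler0n//.
    rewrite /update_mean -[leLHS]addr0 lerD// ?ler_wpM2r ?site_prob_ge//=.
    by rewrite mulr_ge0// site_prob_compl_ge0.
  apply: sumr_ge0 => j _; rewrite mulr_ge0 ?invr_ge0 ?ler0n//.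
  by rewrite addr_ge0// mulr_ge0 ?site_prob_ge0 ?site_prob_compl_ge0/=.
have [i hi] : exists i, (n - nplus (val (fold_plus R (set_spin (val y) i true))) <= t)%N.
  have [[i yi]|h] := pselect (exists i, ~~ val y i).
    by exists i; rewrite nplus_fold_plus nplus_setT yi; move: yt; lia.
  (* No minus site is left: setting an arbitrary site to plus keeps the chain at [all_plus]. *)
  exists (Ordinal n_gt0); rewrite nplus_fold_plus nplus_setT.
  have -> : nplus (val y) = n; last by lia.
  rewrite -card_plus_set -[RHS]card_ord; apply: eq_card => i; rewrite !inE.
  by apply: contrapT => hi; apply: h; exists i; apply/negP.
apply: le_trans (step i); rewrite exprS -mulrA ler_wpM2l//.
exact: IH.
Qed.

Lemma minor_rate_gt0 : 0 < (min_rate beta / n%:R) ^+ n.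
Proof. by rewrite exprn_gt0// divr_gt0 ?min_rate_gt0 ?ltr0n. Qed.

Lemma glauber_plus_stationary : exists p, stationary K p.
Proof.
apply: (minor_stationary _ _ minor_rate_gt0 (fun f x => @glauber_plus_minor f x)).
  exact: glauber_plus_ge0.
exact: glauber_plus_sum1.
Qed.

(** A purely qualitative bound, used for the finitely many [n] below the threshold of the
    quantitative argument. *)
Lemma glauber_plus_mixes : exists t : nat, worst_tv K t <= 4^-1.
Proof.
have [|t ht] := minor_mixes (glauber_plus_ge0 beta_ge0 n_gt0) (glauber_plus_sum1 beta n_gt0)
  minor_rate_gt0 (fun f x => @glauber_plus_minor f x) (e := 4^-1).
  by rewrite invr_gt0.
exists t; apply: le_worst_tv.
- by rewrite invr_ge0.
- exact: glauber_plus_stationary.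
move=> A x y; have [|l hl] := ht (fun y => (y \in A)%:R).
  by move=> z; case: (z \in A); rewrite ?ler01 ?lexx.
have /andP[h1 h2] := hl t x (leqnn _); have /andP[h3 h4] := hl t y (leqnn _).
by rewrite ler_norml; apply/andP; split; lra.
Qed.

End Minorization.

(** * Functions of the magnetization *)

Section LevelFunctions.
Variables (R : realType) (beta : R) (n : nat).
Hypothesis beta_ge0 : 0 <= beta.
Hypothesis n_gt0 : (0 < n)%N.
Local Notation K := (@glauber_plus R beta n).
Implicit Types (x y : config_plus R n) (g U : nat -> R) (k : nat).

(** The reflected extension of [g] to all levels: only values of [g] at levels at least [n / 2] are
    read. *)
Definition fold_level g k : R := g (maxn k (n - k)).

(** A minus site sees the field [(2 k - n) / n + 1 / n], a plus site [(2 k - n) / n - 1 / n]; these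
    are the magnetizations at the midpoints of the two adjacent edges. *)
Definition up_rate k : R :=
  (n%:R - k%:R) / n%:R * p_plus beta ((2 * k%:R + 1 - n%:R) / n%:R).

Definition down_rate k : R :=
  k%:R / n%:R * (1 - p_plus beta ((2 * k%:R - 1 - n%:R) / n%:R)).

Definition level_step g k : R :=
  let G := fold_level g in
  G k + up_rate k * (G k.+1 - G k) + down_rate k * (G k.-1 - G k).

Lemma expect_level g x :
  expect K (fun y => g (nplus (val y))) x = level_step g (nplus (val x)).
Proof.
have n0 : n%:R != 0 :> R by rewrite pnatr_eq0 -lt0n.
rewrite expect_glauberE /glauber_mean; set s := val x.
set N := nplus s; set G := fold_level g.
pose a : R := (1 - p_plus beta ((2 * N%:R - 1 - n%:R) / n%:R)) * (G N.-1 - G N).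
pose b : R := p_plus beta ((2 * N%:R + 1 - n%:R) / n%:R) * (G N.+1 - G N).
transitivity (\sum_(i < n) n%:R^-1 * (G N + (s i)%:R * a + (1 - (s i)%:R) * b)).
  apply: eq_bigr => i _; congr (_ * _).
  rewrite /update_mean /site_prob /= !nplus_fold_plus nplus_setT nplus_setF -/N magnE -/N.
  rewrite -/(fold_level g _) -/(fold_level g _) -/G /spin.
  case: (s i) => /=; rewrite ?addn0 ?subn0 ?addn1 ?subn1.
    rewrite /a; set p := p_plus _ (_ - _); set p' := p_plus _ _.
    have -> : p' = p by congr (p_plus _ _); field.
    ring.
  rewrite /b; set p := p_plus _ (_ - _); set p' := p_plus _ _.
  have -> : p' = p by congr (p_plus _ _); field.
  ring.
rewrite -mulr_sumr !big_split /= -!mulr_suml sumrB !sumr_const card_ord -natr_sum -/N.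
rewrite -[G N *+ n]mulr_natl /level_step -/G /up_rate /down_rate -/(nplus s) -/N.
by rewrite /a /b; field.
Qed.

Lemma iter_expect_level t g x :
  iter t (expect K) (fun y => g (nplus (val y))) x = iter t level_step g (nplus (val x)).
Proof.
elim: t x => [//|t IH] x; rewrite !iterS -expect_level.
by apply: eq_expect => y; exact: IH.
Qed.

(** For odd [n] the middle edge is left out: the reflected function has increment 0 across it. *)
Definition level_lipschitz U g := forall k, (n <= k.*2)%N -> (k < n)%N ->
  `|g k.+1 - g k| <= U k.

Lemma up_rate_ge0 k : (k <= n)%N -> 0 <= up_rate k.
Proof.
by move=> kn; rewrite mulr_ge0 ?p_plus_ge0// divr_ge0 ?subr_ge0 ?ler_nat.
Qed.

Lemma down_rate_ge0 k : 0 <= down_rate k.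
Proof. by rewrite mulr_ge0 ?p_plus_compl_ge0// divr_ge0. Qed.

(** Both moves across an edge use the field at its midpoint, so their probabilities are [p] and
    [1 - p]. This makes the coefficient of the edge itself nonnegative in the evolution of
    increments. *)
Lemma rates_le1 k : (k < n)%N -> up_rate k + down_rate k.+1 <= 1.
Proof.
move=> kn; have n0 : 0 < n%:R :> R by rewrite ltr0n.
rewrite /up_rate /down_rate.
have -> : 2 * k.+1%:R - 1 - n%:R = 2 * k%:R + 1 - n%:R :> R by rewrite -natr1; ring.
set p := p_plus _ _.
have p0 : 0 <= p := p_plus_ge0 _ _.
have p1 : 0 <= 1 - p := p_plus_compl_ge0 _ _.
have h1 : (n%:R - k%:R) / n%:R <= 1 :> R by rewrite ler_pdivrMr// mul1r gerBl.
have h2 : k.+1%:R / n%:R <= 1 :> R by rewrite ler_pdivrMr// mul1r ler_nat.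
have := ler_wpM2r p0 h1; have := ler_wpM2r p1 h2; lra.
Qed.

(* At an even n the bottom edge is flipped by the folding, so that its left
   neighbour enters with the opposite sign. *)
Lemma rates_le1_mid k : (1 < n)%N -> k.*2 = n ->
  up_rate k + down_rate k.+1 + down_rate k <= 1.
Proof.
move=> n1 kn; have n0 : 0 < n%:R :> R by rewrite ltr0n.
have n2 : 2 <= n%:R :> R by rewrite ler_nat.
have nE : n%:R = 2 * k%:R :> R by rewrite -kn -muln2 natrM mulrC.
rewrite /up_rate /down_rate.
have -> : 2 * k.+1%:R - 1 - n%:R = 2 * k%:R + 1 - n%:R :> R by rewrite -natr1; ring.
have -> : (2 * k%:R - 1 - n%:R) / n%:R = - ((2 * k%:R + 1 - n%:R) / n%:R) :> R.
  by rewrite nE; field; rewrite nE in n0; rewrite gt_eqF//; lra.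
rewrite p_plusN; set p := p_plus _ _.
have p1 : 0 <= 1 - p := p_plus_compl_ge0 _ _.
have -> : (n%:R - k%:R) / n%:R = 2^-1 :> R.
  by rewrite nE; field; rewrite nE in n0; rewrite gt_eqF//; lra.
have -> : k%:R / n%:R = 2^-1 :> R.
  by rewrite nE; field; rewrite nE in n0; rewrite gt_eqF//; lra.
have -> : k.+1%:R / n%:R = 2^-1 + n%:R^-1 :> R.
  by rewrite -natr1 nE; field; rewrite nE in n0; rewrite gt_eqF//; lra.
have h : n%:R^-1 <= 2^-1 :> R by rewrite lef_pV2 ?posrE.
by have := ler_wpM2r p1 h; lra.
Qed.

Section Contraction.
Variables (U : nat -> R) (c : R).
Hypothesis n_gt1 : (1 < n)%N.
Hypothesis U_odd0 : forall k, k.*2.+1 = n -> 0 <= U k.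
Hypothesis U_even0 : forall k, k.*2 = n -> - U k <= U k.-1.
Hypothesis U_super : forall k, (n <= k.*2)%N -> (k < n)%N ->
  (1 - up_rate k - down_rate k.+1) * U k + up_rate k.+1 * U k.+1
    + down_rate k * U k.-1 <= c * U k.

(** A new increment is a combination of the old ones at the same edge and its two neighbours with
    nonnegative coefficients, so a supersolution dominates it. Beyond the bottom edge, [U_even0] and
    [U_odd0] play the part of the missing increment bound. *)
Lemma level_step_lipschitz e g : 0 <= e -> level_lipschitz (fun k => e * U k) g ->
  level_lipschitz (fun k => (c * e) * U k) (level_step g).
Proof.
move=> e0 gU k nk kn.
apply: (@le_trans _ _ (e * ((1 - up_rate k - down_rate k.+1) * U k
    + up_rate k.+1 * U k.+1 + down_rate k * U k.-1))); last first.
  have -> : c * e * U k = e * (c * U k) by ring.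
  by rewrite ler_wpM2l ?U_super.
rewrite /level_step; set G := fold_level g.
have GE j : (n <= j.*2)%N -> G j = g j.
  by move=> nj; rewrite /G /fold_level; congr g; lia.
pose D j := G j.+1 - G j.
have nrm (a b : R) : 0 <= a -> `|a * b| = a * `|b|.
  by move=> a0; rewrite normrM ger0_norm.
have -> : G k.+1 + up_rate k.+1 * (G k.+2 - G k.+1)
    + down_rate k.+1 * (G k.+1.-1 - G k.+1)
    - (G k + up_rate k * (G k.+1 - G k) + down_rate k * (G k.-1 - G k)) =
    (1 - up_rate k - down_rate k.+1) * D k + up_rate k.+1 * D k.+1
    + down_rate k * (G k - G k.-1).
  by rewrite /D /=; ring.
have up1 : `|up_rate k.+1 * D k.+1| <= up_rate k.+1 * (e * U k.+1).
  have [k1|k1] := ltnP k.+1 n.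
    rewrite normrM ger0_norm ?up_rate_ge0// ler_wpM2l ?up_rate_ge0//.
    by rewrite /D !GE; [apply: gU => //|..]; lia.
  (* The top edge has no right neighbour: the rate out of level [n] vanishes. *)
  have -> : up_rate k.+1 = 0.
    have kE : k.+1 = n by lia.
    by rewrite /up_rate kE subrr !mul0r.
  by rewrite !mul0r normr0.
have Dk : `|D k| <= e * U k by rewrite /D !GE ?gU//; lia.
have h0 := rates_le1 kn; have d0 := down_rate_ge0 k.
have [nk1|nk1] := leqP n (k.-1.*2).
  have Dk1 : `|G k - G k.-1| <= e * U k.-1.
    have h := gU k.-1 nk1; rewrite !GE//.
    have kE : k.-1.+1 = k by lia.
    by rewrite kE in h; apply: h; lia.
  apply: le_trans (ler_normD _ _) _.
  apply: le_trans (lerD (ler_normD _ _) (lexx _)) _.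
  have c0 : 0 <= 1 - up_rate k - down_rate k.+1 by lra.
  rewrite (nrm _ _ c0) (nrm _ _ d0).
  by have := ler_wpM2l c0 Dk; have := ler_wpM2l d0 Dk1; lra.
have [kE|kE] := eqVneq k.*2 n.
  (* Reflection about the even middle level identifies [k.-1] with [k.+1]. *)
  have -> : G k - G k.-1 = - D k.
    rewrite /D opprB; congr (_ - _); rewrite /G /fold_level; congr g; lia.
  have h1 := rates_le1_mid n_gt1 kE.
  have -> : (1 - up_rate k - down_rate k.+1) * D k + up_rate k.+1 * D k.+1
    + down_rate k * - D k = (1 - up_rate k - down_rate k.+1 - down_rate k) * D k
    + up_rate k.+1 * D k.+1 by ring.
  apply: le_trans (ler_normD _ _) _.
  have c0 : 0 <= 1 - up_rate k - down_rate k.+1 - down_rate k by lra.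
  rewrite (nrm _ _ c0).
  have := ler_wpM2l c0 Dk.
  have := ler_wpM2l (mulr_ge0 d0 e0) (U_even0 kE).
  by lra.
(* For odd [n], reflection identifies the two ends [k.-1] and [k] of the middle edge. *)
have -> : G k - G k.-1 = 0.
  by apply/eqP; rewrite subr_eq0 /G /fold_level; apply/eqP; congr g; lia.
rewrite mulr0 addr0; apply: le_trans (ler_normD _ _) _.
have c0 : 0 <= 1 - up_rate k - down_rate k.+1 by lra.
rewrite (nrm _ _ c0).
have k1 : k.-1.*2.+1 = n by lia.
have := ler_wpM2l c0 Dk; have := mulr_ge0 (mulr_ge0 d0 e0) (U_odd0 k1).
by lra.
Qed.

Hypothesis c_ge0 : 0 <= c.

Lemma iter_level_step_lipschitz t e g : 0 <= e ->
  level_lipschitz (fun k => e * U k) g ->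
  level_lipschitz (fun k => (c ^+ t * e) * U k) (iter t level_step g).
Proof.
move=> e0 gU; elim: t => [|t IH] k nk kn /=; first by rewrite expr0 mul1r gU.
have := level_step_lipschitz (mulr_ge0 (exprn_ge0 t c_ge0) e0) IH nk kn.
by rewrite mulrA -exprS.
Qed.

End Contraction.

Lemma level_lipschitz_osc (e : R) g k l : 0 <= e -> level_lipschitz (fun=> e) g ->
  (n <= k.*2)%N -> (k <= l <= n)%N -> `|g l - g k| <= n%:R * e.
Proof.
move=> e0 gU nk /andP[kl ln].
suff H d : (k + d <= n)%N -> `|g (k + d)%N - g k| <= d%:R * e.
  have -> : l = (k + (l - k))%N by lia.
  apply: le_trans (H _ _) _; first by lia.
  by rewrite ler_wpM2r// ler_nat; lia.
elim: d => [|d IH] kd; first by rewrite addn0 subrr normr0 mul0r.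
have h1 := IH (ltac:(lia)).
have h2 := gU (k + d)%N (ltac:(lia)) (ltac:(lia)).
rewrite addnS mulrSr mulrDl mul1r.
have -> : g (k + d).+1 - g k = (g (k + d)%N - g k) + (g (k + d).+1 - g (k + d)%N) by ring.
exact: le_trans (ler_normD _ _) (lerD h1 h2).
Qed.

End LevelFunctions.

(** * A weight contracted by the edge operator *)

Section ConstantWeight.
Variable R : realType.
Implicit Types (b h s y x : R).

Lemma expR_le_quad x : 0 <= x <= 2^-1 -> expR x <= 1 + x + 2 * x ^+ 2.
Proof.
move=> /andP[x0 x1]; have := expR_ge1Dx (- x); rewrite expRN => h.
have e0 := expR_gt0 x.
have h1 : (1 - x) * expR x <= 1.
  by have := ler_wpM2r (ltW e0) h; rewrite mulVf ?gt_eqF.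
have : 0 <= 1 - x by lra.
rewrite le_eqVlt => /orP[/eqP|p0]; first lra.
rewrite -(ler_pM2l p0); apply: le_trans h1 _.
by have := mulr_ge0 x0 x0; nra.
Qed.

(* The edge operator conjugated by cosh, in units where the edge between k and
   k+1 pluses sits at s = (2 k + 1 - n) / n and h = 1 / n. *)
Definition edge_diag b h s : R := (1 + h) * cosh (b * s) - s * sinh (b * s).

Definition edge_gain b h s : R := expR (2 * b * h) / 2 * ((1 - s - h) * expR (b * s)).

Definition edge_loss b h s : R := expR (2 * b * h) / 2 * ((1 + s - h) * expR (- (b * s))).

(** Positive exactly where a constant is strictly contracted. At [s = 0] it is about
    [- 2 h (b - 1)], which is why another weight is required near 0. *)
Definition flat_defect b h s : R := edge_diag b h s - edge_gain b h s - edge_loss b h s.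

Lemma flat_defectE b h s : flat_defect b h s =
  edge_diag b h s - expR (2 * b * h) * ((1 - h) * cosh (b * s) - s * sinh (b * s)).
Proof.
by rewrite /flat_defect /edge_gain /edge_loss expRN_cosh_sinh (expR_cosh_sinh (b * s)); field.
Qed.

(** To first order in [h] the defect is [2 h (1 - b (1 - s tanh (b s))) cosh (b s)]; [tau] is a
    lower bound for [s tanh (b s)], and [1 + 4 b h] absorbs the second order of the exponential. *)
Lemma flat_defect_ge b h s tau : 0 <= b -> 0 <= h -> 0 <= s ->
    4 * b * h <= 1 -> tau <= 1 -> tau * cosh (b * s) <= s * sinh (b * s) ->
  (2 * h - 2 * b * h * (1 + 4 * b * h) * (1 - tau)) * cosh (b * s) <= flat_defect b h s.
Proof.
move=> b0 h0 s0 bh tau1 htau.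
rewrite flat_defectE /edge_diag.
set C := cosh (b * s) in htau *; set S := sinh (b * s) in htau *.
have C0 : 0 < C := cosh_gt0 _.
have bh0 : 0 <= b * h by rewrite mulr_ge0.
have e1 : 1 <= expR (2 * b * h).
  by rewrite -[leLHS]expR0 ler_expR -mulrA mulr_ge0.
have e2 : expR (2 * b * h) <= 1 + 2 * b * h + 2 * (2 * b * h) ^+ 2.
  by apply: expR_le_quad; apply/andP; split; lra.
set e := expR _ in e1 e2 *.
have E0 : 0 <= e - 1 by lra.
have h1 : (e - 1) * (tau * C) <= (e - 1) * (s * S) by exact: ler_wpM2l.
have h2 : 0 <= (e - 1) * (h * C) by rewrite mulr_ge0// mulr_ge0// ltW.
have h3 : (e - 1) * ((1 - tau) * C) <= (2 * b * h * (1 + 4 * b * h)) * ((1 - tau) * C).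
  apply: ler_wpM2r; first by rewrite mulr_ge0 ?subr_ge0 ?(ltW C0).
  have -> : 2 * b * h * (1 + 4 * b * h) = 2 * b * h + 2 * (2 * b * h) ^+ 2 by ring.
  by lra.
lra.
Qed.

End ConstantWeight.

(** * The discrete power weight *)

Section PowerWeight.
Variable R : realType.
Implicit Types (b h s y x : R) (r : nat).

(** A discrete form of [y^-r]: neighbouring edges differ by 2 in [y], so the ratio of neighbouring
    values telescopes to an exact rational function. *)
Definition power_weight r y : R := \prod_(j < r) (y + 2 * j%:R)^-1.

Lemma power_weight_gt0 r y : 0 < y -> 0 < power_weight r y.
Proof.
by move=> y0; apply: prodr_gt0 => j _; rewrite invr_gt0 ltr_wpDr// mulr_ge0.
Qed.

Lemma power_weight_le r y y' : 0 < y <= y' -> power_weight r y' <= power_weight r y.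
Proof.
move=> /andP[y0 yy']; have y'0 := lt_le_trans y0 yy'; apply: ler_prod => j _.
have j0 : 0 <= 2 * j%:R :> R by rewrite mulr_ge0.
by rewrite invr_ge0 addr_ge0 ?(ltW y'0)//= lef_pV2 ?posrE ?ltr_wpDr// lerD2r.
Qed.

Lemma power_weight_le1 r y : 1 <= y -> power_weight r y <= 1.
Proof.
move=> y1; apply: le_trans (power_weight_le r (y := 1) _) _; first by rewrite ltr01.
rewrite [leRHS](_ : _ = \prod_(j < r) 1); last by rewrite prodr_const expr1n.
apply: ler_prod => j _; have j0 : 0 <= 2 * j%:R :> R by rewrite mulr_ge0.
by rewrite invr_ge0 addr_ge0//= invf_le1 ?lerDl// ltr_wpDr.
Qed.

Lemma power_weight_shift r y : 0 < y ->
  power_weight r (y + 2) = y / (y + 2 * r%:R) * power_weight r y.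
Proof.
move=> y0; elim: r => [|r IH].
  by rewrite /power_weight !big_ord0 mulr0 addr0 divff ?gt_eqF// mulr1.
have j0 : 0 <= 2 * r%:R :> R by rewrite mulr_ge0.
rewrite /power_weight !big_ord_recr /= -!/(power_weight _ _) IH -natr1.
by field; rewrite !gt_eqF//; lra.
Qed.

(** Since [x <= y], the factor [(y + 2 j) / (x + 2 j)] decreases with [j] and is at least its value
    at [j = r]. *)
Lemma power_weight_ratio r x y : 0 < x <= y ->
  ((y + 2 * r%:R) / (x + 2 * r%:R)) ^+ r * power_weight r y <= power_weight r x.
Proof.
move=> /andP[x0 xy].
have -> : ((y + 2 * r%:R) / (x + 2 * r%:R)) ^+ r =
    \prod_(j < r) ((y + 2 * r%:R) / (x + 2 * r%:R)) by rewrite prodr_const card_ord.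
rewrite -big_split /=; apply: ler_prod => j _.
have y0 := lt_le_trans x0 xy.
have j0 : 0 <= j%:R :> R by [].
have r0 : 0 <= r%:R :> R by [].
have jr : j%:R <= r%:R :> R by rewrite ler_nat ltnW.
have p1 : 0 < x + 2 * r%:R by lra.
have p2 : 0 < x + 2 * j%:R by lra.
have p3 : 0 < y + 2 * j%:R by lra.
apply/andP; split; first by rewrite mulr_ge0 ?invr_ge0 ?divr_ge0; lra.
rewrite ler_pdivrMr// ler_pdivrMr// -mulrA ler_pdivlMl//; nra.
Qed.

Lemma power_weight_lower r y : 0 < y -> (y + 2 * r%:R) ^- r <= power_weight r y.
Proof.
move=> y0; have r0 : 0 <= r%:R :> R by [].
have -> : (y + 2 * r%:R) ^- r = \prod_(j < r) (y + 2 * r%:R)^-1.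
  by rewrite prodr_const card_ord exprVn.
apply: ler_prod => j _; have j0 : 0 <= j%:R :> R by [].
have jr : j%:R <= r%:R :> R by rewrite ler_nat ltnW.
by rewrite invr_ge0 lef_pV2 ?posrE; lra.
Qed.

(** What the decrease of the power adds to the flat defect, up to [r expR (2 b h)]: the relative
    drop to the right is [2 r / (y + 2 r)] and the relative rise to the left is [2 r / (y - 2)]. *)
Definition power_drift b h r y : R :=
  (1 - y * h - h) * expR (b * (y * h)) / (y + 2 * r%:R)
    - (1 + y * h - h) * expR (- (b * (y * h))) / (y - 2).

Lemma power_weight_defect b h r y : 2 < y ->
  edge_diag b h (y * h) * power_weight r y
    - edge_gain b h (y * h) * power_weight r (y + 2)
    - edge_loss b h (y * h) * power_weight r (y - 2) =
  (flat_defect b h (y * h) + r%:R * expR (2 * b * h) * power_drift b h r y) * power_weight r y.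
Proof.
move=> y2; rewrite power_weight_shift; last lra.
have -> : power_weight r (y - 2) = (y - 2 + 2 * r%:R) / (y - 2) * power_weight r y.
  have := @power_weight_shift r (y - 2); rewrite subrK => ->; last lra.
  have : 0 <= r%:R :> R by []; move=> r0.
  by field; rewrite !gt_eqF//; lra.
have r0 : 0 <= r%:R :> R by [].
rewrite /power_drift /flat_defect /edge_gain /edge_loss.
by field; rewrite !gt_eqF//; lra.
Qed.

(** The main term is the drift [tanh (b s) - s] at [s = y h], cleared of its denominator; the term
    in [1 / y] collects the corrections from [h], [y - 2] and [y + 2 r]. *)
Lemma power_drift_ge b h r y : 0 <= b -> 0 < h -> 4 <= y -> y * h + h <= 1 ->
  2 * (sinh (b * (y * h)) - y * h * cosh (b * (y * h)))
    - (10 + 2 * r%:R * (1 + 2 * (b * (y * h)))) / y * cosh (b * (y * h))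
  <= y * power_drift b h r y.
Proof.
move=> b0 h0 y4 yh; have y0 : 0 < y by lra.
have s0 : 0 <= y * h by rewrite mulr_ge0 ?(ltW h0) ?(ltW y0).
rewrite /power_drift; set s := y * h in yh s0 *; set x := b * s.
have x0 : 0 <= x by rewrite mulr_ge0.
have C1 := cosh_ge1 x; have S0 := sinh_ge0 x0.
have E0 := expR_gt0 x; have F0 := expR_gt0 (- x).
have EE := expR_cosh_sinh x; have FE := expRN_cosh_sinh x.
have F1 : expR (- x) <= 1 by rewrite -[leRHS]expR0 ler_expR oppr_le0.
have E2 : expR x <= 2 * cosh x by lra.
(* The factor [1 + 2 x] instead of 2 keeps the correction close to [2 r / y] for small [x], where
   the comparison with the drift has little room. *)
have EC : expR x <= (1 + 2 * x) * cosh x.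
  have h1 := expR_ge1Dx (- (2 * x)).
  have : expR (- (2 * x)) * expR x = expR (- x) by rewrite -expRD; congr expR; ring.
  by have := ler_wpM2r (ltW E0) h1; nra.
have r0 : 0 <= r%:R :> R by [].
have hy : h <= y^-1 by rewrite -[leRHS]mul1r ler_pdivlMr// mulrC -/s; lra.
have yi0 : 0 < y^-1 by rewrite invr_gt0.
have -> : y * ((1 - s - h) * expR x / (y + 2 * r%:R)
    - (1 + s - h) * expR (- x) / (y - 2)) =
    ((1 - s - h) * expR x) * (y / (y + 2 * r%:R))
    - ((1 + s - h) * expR (- x)) * (y / (y - 2)) by ring.
have f1 : 1 - 2 * r%:R * y^-1 <= y / (y + 2 * r%:R).
  rewrite ler_pdivlMr; last lra.
  have -> : (1 - 2 * r%:R * y^-1) * (y + 2 * r%:R) = y - 4 * r%:R ^+ 2 * y^-1.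
    by field; rewrite gt_eqF.
  by rewrite gerBl mulr_ge0// ?(ltW yi0)// mulr_ge0// sqr_ge0.
have f2 : y / (y - 2) <= 1 + 4 * y^-1.
  rewrite ler_pdivrMr; last lra.
  have -> : (1 + 4 * y^-1) * (y - 2) = y + 2 - 8 * y^-1 by field; rewrite gt_eqF.
  have : y^-1 <= 4^-1 by rewrite lef_pV2 ?posrE.
  lra.
set z := y^-1 in hy yi0 f1 f2 *.
have g0 : 0 <= (1 - s - h) * expR x by rewrite mulr_ge0 ?(ltW E0)//; lra.
have l0 : 0 <= (1 + s - h) * expR (- x) by rewrite mulr_ge0 ?(ltW F0)//; lra.
have G := ler_wpM2l g0 f1; have L := ler_wpM2l l0 f2.
have hE : h * expR x <= z * (2 * cosh x) by rewrite ler_pM// ?(ltW h0) ?(ltW E0).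
have hF : 0 <= h * expR (- x) by rewrite mulr_ge0 ?(ltW h0) ?(ltW F0).
have gE : (1 - s - h) * expR x <= (1 + 2 * x) * cosh x.
  by apply: le_trans EC; rewrite ler_piMl ?(ltW E0)//; lra.
have lF : (1 + s - h) * expR (- x) <= 2 * cosh x.
  by rewrite ler_pM ?(ltW F0)//; lra.
have rz : 0 <= 2 * r%:R * z by rewrite mulr_ge0 ?(ltW yi0)// mulr_ge0.
have z4 : 0 <= 4 * z by lra.
have G2 := ler_wpM2l rz gE; have L2 := ler_wpM2l z4 lF.
have main : 2 * (sinh x - s * cosh x) = (1 - s) * expR x - (1 + s) * expR (- x).
  by rewrite EE FE; ring.
rewrite main; lra.
Qed.

End PowerWeight.

(** * The Gaussian weight at scale sqrt n *)

Section GaussWeight.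
Variable R : realType.
Implicit Types (b h s y x : R).

Lemma sinh_near x : `|x| <= 2^-1 -> `|sinh x - x| <= `|x| ^+ 3.
Proof.
move=> hx.
wlog x0 : x hx / 0 <= x => [hw|].
  have [/hw|xn] := leP 0 x; first exact.
  have := hw (- x); rewrite normrN oppr_ge0 => /(_ hx (ltW xn)).
  by rewrite sinhN -opprD normrN.
rewrite !ger0_norm//; last by rewrite subr_ge0 sinh_ge.
by rewrite lerBlDl sinh_le// x0 -(ger0_norm x0).
Qed.

Lemma cosh_near x : `|x| <= 2^-1 -> cosh x <= 1 + x ^+ 2 / 2 + x ^+ 4.
Proof.
move=> hx; have -> : cosh x = cosh `|x|.
  by have [x0|x0] := ger0P x; rewrite ?coshN.
have -> : x ^+ 2 = `|x| ^+ 2 by rewrite real_normK// num_real.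
have -> : x ^+ 4 = `|x| ^+ 4 by rewrite -[4%N]/(2 * 2)%N !exprM real_normK// num_real.
by apply: cosh_le; rewrite normr_ge0.
Qed.

(** An expansion to first order in [h] and [s^2], with [s^2 = O(h)]: the left side is [1 + h (1 - al
    / 2) + s^2 (al^2 / 4 - 1) / 2], while [edge_diag] is [1 + h + s^2 (al^2 - 1) / 2]. All
    remainders are multiples of [M^6 h^2]. *)
Lemma gauss_bound al M h s : 0 < al -> 1 + al <= M -> 0 < h -> 0 < s ->
    s ^+ 2 <= M * h -> 300 * M ^+ 6 * h <= 1 -> 300 * M ^+ 6 * h <= al ->
  expR (2 * (1 + al / 4) * h) *
    ((1 - 3 * h) * cosh ((1 - al / 2) * s) - s * sinh ((1 - al / 2) * s)
     + 2 * h * (1 - h) * (sinh ((1 - al / 2) * s) / s)) <=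
  edge_diag (1 + al) h s - al / 4 * h * cosh ((1 + al) * s).
Proof.
move=> al0 alM h0 s0 sM hM1 hMa.
have M1 : 1 <= M by lra.
have M0 : 0 <= M by lra.
set m := 1 - al / 2; set a := 1 + al / 4; set be := 1 + al.
have mM : `|m| <= M by rewrite ler_norml /m; apply/andP; split; lra.
have aM : a <= M by rewrite /a; lra.
have a0 : 0 <= a by rewrite /a; lra.
have M12 : M <= M ^+ 2 by rewrite expr2 ler_peMr.
have M23 : M ^+ 2 <= M ^+ 3 by rewrite [leRHS]exprS ler_peMl// exprn_ge0.
have M34 : M ^+ 3 <= M ^+ 4 by rewrite [leRHS]exprS ler_peMl// exprn_ge0.
have M45 : M ^+ 4 <= M ^+ 5 by rewrite [leRHS]exprS ler_peMl// exprn_ge0.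
have M56 : M ^+ 5 <= M ^+ 6 by rewrite [leRHS]exprS ler_peMl// exprn_ge0.
have up c (c0 : 0 <= c) (i : nat) : (i <= 6)%N -> M ^+ i * c <= M ^+ 6 * c.
  by move=> i6; rewrite ler_wpM2r// ler_weXn2l.
have hs i := up h (ltW h0) i; have hhs i := up (h ^+ 2) (sqr_ge0 h) i.
set t := s ^+ 2 in sM *; have t0 : 0 <= t by rewrite sqr_ge0.
have tt : t ^+ 2 <= M ^+ 2 * h ^+ 2.
  by rewrite -exprMn lerXn2r ?nnegrE// mulr_ge0// ltW.
have small b : `|b| <= M -> `|b * s| <= 2^-1.
  move=> bM; rewrite -(@ler_pXn2r _ 2)// ?nnegrE ?normr_ge0 ?invr_ge0//.
  rewrite normrM exprMn real_normK ?num_real// -/t [`|s| ^+ 2]real_normK ?num_real// -/t.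
  have : b ^+ 2 <= M ^+ 2 by rewrite -(real_normK (num_real b)) lerXn2r ?nnegrE.
  move=> b2; apply: le_trans (ler_pM (sqr_ge0 b) t0 b2 sM) _.
  have -> : M ^+ 2 * (M * h) = M ^+ 3 * h by ring.
  by have := hs 3%N isT; lra.
have bM : `|be| <= M by rewrite ger0_norm /be; lra.
have [ms bs] := (small _ mM, small _ bM).
pose w := sinh (m * s) / s - m.
have wM : `|w| <= M ^+ 3 * t.
  have -> : w = (sinh (m * s) - m * s) / s by rewrite /w; field; rewrite gt_eqF.
  rewrite normrM normfV (ger0_norm (ltW s0)) ler_pdivrMr//.
  apply: le_trans (sinh_near ms) _; rewrite normrM exprMn (ger0_norm (ltW s0)).
  have -> : M ^+ 3 * t * s = M ^+ 3 * s ^+ 3 by rewrite /t; ring.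
  by rewrite ler_wpM2r ?exprn_ge0 ?(ltW s0)// lerXn2r ?nnegrE.
have wM2 : `|w| <= M ^+ 4 * h.
  apply: le_trans wM _; have -> : M ^+ 4 * h = M ^+ 3 * (M * h) by ring.
  by rewrite ler_wpM2l ?exprn_ge0.
have sE : sinh (m * s) = s * (m + w) by rewrite /w; field; rewrite gt_eqF.
have sE' : sinh (m * s) / s = m + w by rewrite /w; ring.
rewrite sE' sE mulrA -expr2 -/t.
have Cm := cosh_near ms; have Cm1 := cosh_ge1 (m * s).
have Cm' : cosh (m * s) <= 1 + m ^+ 2 * t / 2 + M ^+ 6 * h ^+ 2.
  apply: le_trans Cm _; rewrite !exprMn -/t lerD2l.
  have -> : s ^+ 4 = t ^+ 2 by rewrite /t -exprM.
  have m4 : m ^+ 4 <= M ^+ 4.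
    rewrite -[4%N]/(2 * 2)%N !exprM lerXn2r ?nnegrE ?sqr_ge0//.
    by rewrite -(real_normK (num_real m)) lerXn2r ?nnegrE.
  have m40 : 0 <= m ^+ 4 by rewrite -[4%N]/(2 * 2)%N exprM sqr_ge0.
  apply: le_trans (ler_pM m40 (sqr_ge0 t) m4 tt) _.
  by rewrite mulrA -exprD.
have tw : - (t * w) <= M ^+ 6 * h ^+ 2.
  apply: le_trans (ler_norm _) _; rewrite normrN normrM (ger0_norm t0).
  apply: le_trans (ler_pM t0 (normr_ge0 w) sM wM2) _.
  have -> : M * h * (M ^+ 4 * h) = M ^+ 5 * h ^+ 2 by ring.
  exact: hhs.
have hw : 2 * h * (1 - h) * w <= 2 * (M ^+ 6 * h ^+ 2).
  apply: le_trans (ler_norm _) _; rewrite normrM.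
  have h1 : h <= 1 by have := hs 0%N isT; clear -hM1; lra.
  have hh : `|2 * h * (1 - h)| <= 2 * h.
    rewrite ger0_norm ?mulr_ge0 ?subr_ge0 ?(ltW h0)//.
    by rewrite ler_piMr ?mulr_ge0 ?(ltW h0)// gerBl ltW.
  apply: le_trans (ler_pM (normr_ge0 _) (normr_ge0 w) hh wM2) _.
  by have := hhs 4%N isT; clear; lra.
have hm : - (2 * h ^+ 2 * m) <= 2 * (M ^+ 6 * h ^+ 2).
  have : - m <= M by rewrite -normrN in mM; exact: le_trans (ler_norm _) mM.
  move=> mm; have := ler_wpM2r (sqr_ge0 h) mm; have := hhs 1%N isT.
  by rewrite expr1; clear; lra.
pose P := 1 + h * (2 * m - 3) + t * (m ^+ 2 / 2 - m) + 6 * (M ^+ 6 * h ^+ 2).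
have LP : (1 - 3 * h) * cosh (m * s) - t * (m + w) + 2 * h * (1 - h) * (m + w) <= P.
  have : h * 1 <= h * cosh (m * s) by rewrite ler_pM2l.
  by rewrite /P; clear -Cm' tw hw hm; lra.
have hM6 : M ^+ 6 * h ^+ 2 <= h / 300.
  by rewrite expr2 mulrA; have := ler_wpM2r (ltW h0) hM1; clear; lra.
have mM' : -M <= m <= M by rewrite -ler_norml.
have m2M : m ^+ 2 <= M ^+ 2 by rewrite -(real_normK (num_real m)) lerXn2r ?nnegrE.
have m20 := sqr_ge0 m.
have q1 : m ^+ 2 / 2 - m <= 2 * M ^+ 2 by have /andP[] := mM'; clear -m2M M12; lra.
have q2 : - M <= m ^+ 2 / 2 - m by have /andP[] := mM'; clear -m20; lra.
have tq1 : t * (m ^+ 2 / 2 - m) <= 2 * (M ^+ 3 * h).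
  apply: le_trans (ler_wpM2l t0 q1) _.
  apply: le_trans (ler_wpM2r (_ : 0 <= 2 * M ^+ 2) sM) _; first by rewrite mulr_ge0// exprn_ge0.
  by apply: eq_ler; ring.
have tq2 : - (M ^+ 3 * h) <= t * (m ^+ 2 / 2 - m).
  apply: le_trans (_ : t * - M <= _); last exact: ler_wpM2l.
  have u := ler_wpM2r M0 sM; have v := ler_wpM2r (ltW h0) M23.
  by clear -u v; lra.
have hmM : h * m <= M * h by rewrite mulrC ler_wpM2r ?(ltW h0)//; case/andP: mM'.
have hmM' : - (M * h) <= h * m.
  by rewrite -mulNr mulrC ler_wpM2l ?(ltW h0)//; case/andP: mM'.
have k1 : M * h <= M ^+ 3 * h.
  by rewrite ler_wpM2r ?(ltW h0)// (le_trans M12).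
have k2 : M ^+ 3 * h <= 300^-1 by have := hs 3%N isT; clear -hM1; lra.
have k0 : h <= M ^+ 3 * h by have := ler_wpM2r (ltW h0) M1; clear -k1; lra.
have P1 : P - 1 <= 5 * (M ^+ 3 * h).
  by rewrite /P; clear -hmM tq1 hM6 k0 k1 h0; lra.
have P0 : 0 <= P.
  have := mulr_ge0 (exprn_ge0 6 M0) (sqr_ge0 h).
  by rewrite /P; clear -hmM' tq2 k0 k1 k2 h0; lra.
have ah : 2 * a * h <= 2 * (M * h) by rewrite -mulrA ler_pM2l// ler_wpM2r ?(ltW h0).
have ah0 : 0 <= 2 * a * h by rewrite mulr_ge0 ?(ltW h0)// mulr_ge0.
have e1 : expR (2 * a * h) <= 1 + 2 * a * h + 2 * (2 * a * h) ^+ 2.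
  by apply: expR_le_quad; rewrite ah0/=; clear -ah k1 k2; lra.
have e2 : (2 * a * h) ^+ 2 <= 4 * (M ^+ 6 * h ^+ 2).
  apply: le_trans (_ : (2 * (M * h)) ^+ 2 <= _); first by rewrite lerXn2r ?nnegrE// (le_trans ah0).
  by rewrite !exprMn; have := hhs 2%N isT; clear; lra.
have L1 : expR (2 * a * h) * ((1 - 3 * h) * cosh (m * s) - t * (m + w)
    + 2 * h * (1 - h) * (m + w)) <= (1 + 2 * a * h + 2 * (2 * a * h) ^+ 2) * P.
  apply: le_trans (ler_wpM2l (expR_ge0 _) LP) _; exact: ler_wpM2r.
apply: le_trans L1 _.
have p1 : 2 * a * h * (P - 1) <= 10 * (M ^+ 6 * h ^+ 2).
  have [PP|PP] := leP 0 (P - 1).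
    apply: le_trans (ler_pM ah0 PP ah P1) _.
    have -> : 2 * (M * h) * (5 * (M ^+ 3 * h)) = 10 * (M ^+ 4 * h ^+ 2) by ring.
    by have := hhs 4%N isT; clear; lra.
  apply: le_trans (mulr_ge0_le0 ah0 (ltW PP)) _.
  by rewrite mulr_ge0// mulr_ge0 ?exprn_ge0 ?(ltW h0).
have p2 : 2 * (2 * a * h) ^+ 2 * P <= 16 * (M ^+ 6 * h ^+ 2).
  have P2 : P <= 2 by clear -P1 k2; lra.
  apply: le_trans (ler_pM _ P0 (_ : _ <= 8 * (M ^+ 6 * h ^+ 2)) P2) _.
  - by rewrite mulr_ge0// sqr_ge0.
  - by clear -e2; lra.
  - by clear; lra.
have PP : (1 + 2 * a * h + 2 * (2 * a * h) ^+ 2) * P <= P + 2 * a * h + 26 * (M ^+ 6 * h ^+ 2).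
  by clear -p1 p2; lra.
apply: le_trans PP _.
have be0 : 0 <= be by rewrite /be; clear -al0; lra.
have bs0 : 0 <= be * s by rewrite mulr_ge0 ?(ltW s0).
have Cb := cosh_ge bs0.
have Sb : sinh (be * s) <= be * s + (be * s) ^+ 3.
  by apply: sinh_le; rewrite bs0 -(ger0_norm bs0).
have Cb2 : cosh (be * s) <= 3 / 2.
  apply: le_trans (cosh_near bs) _.
  move: bs; rewrite (ger0_norm bs0) => b12.
  have x2 : (be * s) ^+ 2 <= 2^-1 ^+ 2 by rewrite lerXn2r ?nnegrE ?invr_ge0.
  have x4 : (be * s) ^+ 4 <= 2^-1 ^+ 4 by rewrite lerXn2r ?nnegrE ?invr_ge0.
  by move: x2 x4; clear; rewrite !exprVn; lra.
rewrite /edge_diag.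
have sS : s * sinh (be * s) <= be * t + M ^+ 6 * h ^+ 2.
  apply: le_trans (ler_wpM2l (ltW s0) Sb) _.
  have -> : s * (be * s + (be * s) ^+ 3) = be * t + be ^+ 3 * t ^+ 2 by rewrite /t; ring.
  rewrite lerD2l.
  have b3 : be ^+ 3 <= M ^+ 3 by rewrite lerXn2r ?nnegrE// /be.
  apply: le_trans (ler_pM (exprn_ge0 3 be0) (sqr_ge0 t) b3 tt) _.
  rewrite mulrA -exprD; exact: hhs.
have hC : (1 + h) * (1 + be ^+ 2 * t / 2) <= (1 + h) * cosh (be * s).
  by rewrite ler_wpM2l//; [clear -h0; lra | move: Cb; rewrite exprMn].
have hbt : 0 <= h * (be ^+ 2 * t / 2).
  by rewrite mulr_ge0 ?(ltW h0)// divr_ge0// mulr_ge0// sqr_ge0.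
have alC : al / 4 * h * cosh (be * s) <= al / 4 * h * (3 / 2).
  by rewrite ler_wpM2l// mulr_ge0 ?(ltW h0)// divr_ge0// ltW.
(* With [cosh <= 3 / 2] the margin left is [al h (1 / 2 - 3 / 8) = al h / 8], and the remainders
   total [33 M^6 h^2]; 300 works since [33 / 300 < 1 / 8]. *)
have alh : M ^+ 6 * h ^+ 2 * 300 <= al * h.
  by rewrite expr2; have := ler_wpM2r (ltW h0) hMa; clear; lra.
have tpos : 0 <= al ^+ 2 * t by rewrite mulr_ge0// sqr_ge0.
have key : P + 2 * a * h + 26 * (M ^+ 6 * h ^+ 2) =
  1 + h * (1 - al / 2) + t * ((al ^+ 2 / 4 - 1) / 2) + 32 * (M ^+ 6 * h ^+ 2).
  by rewrite /P /m /a; field.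
have key2 : be ^+ 2 * t / 2 - be * t = t * ((al ^+ 2 - 1) / 2) by rewrite /be; field.
have alh0 : 0 <= al * h by rewrite mulr_ge0 ?(ltW al0) ?(ltW h0).
rewrite key; clear -hC hbt alC alh alh0 tpos key2 sS; clearbody be t; lra.
Qed.

End GaussWeight.

Section GaussDefect.
Variable R : realType.
Implicit Types (al h y : R).

(** In the diffusive limit an increment [phi] evolves by [phi'' + al h (y phi)'], which multiplies
    this function by [h (2 al - 3 lam - lam (al - lam) y^2 h)]. For [lam = al] it is the first odd
    eigenfunction; [lam = 3 al / 4] keeps the rate [- al / 4] and gains a negative term in [y^2]. *)
Definition gauss_weight (lam h y : R) : R := y * expR (- (lam * y ^+ 2 * h / 2)).

(** Expanding [(y + 2)^2] and [(y - 2)^2] in the Gaussian changes the tilt from [1 + al] to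
    [1 + al - 2 lam = 1 - al / 2] and the prefactor exponent to [2 (1 + al - lam) h]. *)
Lemma gauss_weight_defect al h y (lam := 3 / 4 * al) : h != 0 -> y != 0 ->
  edge_gain (1 + al) h (y * h) * gauss_weight lam h (y + 2)
    + edge_loss (1 + al) h (y * h) * gauss_weight lam h (y - 2) =
  gauss_weight lam h y * (expR (2 * (1 + al / 4) * h) *
    ((1 - 3 * h) * cosh ((1 - al / 2) * (y * h)) - y * h * sinh ((1 - al / 2) * (y * h))
     + 2 * h * (1 - h) * (sinh ((1 - al / 2) * (y * h)) / (y * h)))).
Proof.
move=> h0 y0; rewrite /edge_gain /edge_loss /gauss_weight.
set g := expR (- (lam * y ^+ 2 * h / 2)).
set a := expR (2 * (1 + al / 4) * h).
have e1 : expR (2 * (1 + al) * h) * expR ((1 + al) * (y * h)) *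
    expR (- (lam * (y + 2) ^+ 2 * h / 2)) = g * a * expR ((1 - al / 2) * (y * h)).
  by rewrite -!expRD; congr expR; rewrite /lam; field.
have e2 : expR (2 * (1 + al) * h) * expR (- ((1 + al) * (y * h))) *
    expR (- (lam * (y - 2) ^+ 2 * h / 2)) = g * a * expR (- ((1 - al / 2) * (y * h))).
  by rewrite -!expRD; congr expR; rewrite /lam; field.
set m := (1 - al / 2) * (y * h) in e1 e2 *.
transitivity ((1 - y * h - h) / 2 * (y + 2) * (g * a * expR m)
    + (1 + y * h - h) / 2 * (y - 2) * (g * a * expR (- m))).
  by rewrite -e1 -e2; field.
by rewrite expRN_cosh_sinh (expR_cosh_sinh m); field; rewrite h0 y0.
Qed.

End GaussDefect.

(** * Gaps depending on beta only *)

Section Constants.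
Variables (R : realType) (be : R).
Hypothesis be_gt1 : 1 < be.

(* With sg = sqrt (1 - 1/be), be sg^2 = be - 1: once sg < tanh (be sg), the
   constant weight is already contracted slightly below sg, where
   be s tanh (be s) > be - 1. That inequality is sinh t > t at
   t = ln ((1 + sg) / (1 - sg)). *)
Lemma drift_gap : exists sg c1 : R, [/\ 0 < sg < 1, 0 < c1, be * (1 - sg ^+ 2) = 1,
  (1 + c1) * sg <= 1 &
  forall s, 0 <= s <= sg -> (1 + c1) * s * cosh (be * s) <= sinh (be * s)].
Proof.
have be1 := be_gt1; have be0 : 0 < be by lra.
pose sg := Num.sqrt (1 - be^-1).
have bi : be^-1 < 1 by rewrite invf_lt1.
have bi0 : 0 < be^-1 by rewrite invr_gt0.
have sg2 : sg ^+ 2 = 1 - be^-1 by rewrite sqr_sqrtr// subr_ge0 ltW.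
have sg0 : 0 < sg by rewrite sqrtr_gt0 subr_gt0.
have sg1 : sg < 1 by rewrite -(@ltr_pXn2r _ 2)// ?nnegrE ?ler01 ?(ltW sg0)// sg2 expr1n gtrBl.
have bsg : be * (1 - sg ^+ 2) = 1 by rewrite sg2; field; rewrite gt_eqF.
pose u := (1 + sg) / (1 - sg).
have p1 : 0 < 1 - sg by lra.
have p2 : 0 < 1 + sg by lra.
have u1 : 1 < u by rewrite /u ltr_pdivlMr//; lra.
have u0 : 0 < u by lra.
have lu : ln u < 2 * (be * sg).
  have := sinh_gt (ln_gt0 u1); rewrite /sinh expRN lnK ?posrE// => /lt_le_trans; apply.
  have -> : (u - u^-1) / 2 = 2 * sg / (1 - sg ^+ 2).
    rewrite /u; field; rewrite !gt_eqF//; nra.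
  have -> : 2 * (be * sg) = 2 * sg / (1 - sg ^+ 2); last exact: lexx.
  have -> : be = (1 - sg ^+ 2)^-1.
    by apply: (@mulIf _ (1 - sg ^+ 2)); rewrite ?bsg ?mulVf//; rewrite gt_eqF; nra.
  ring.
set x := be * sg in lu *.
have x0 : 0 < x by rewrite mulr_gt0.
have C0 := cosh_gt0 x.
have Sx : sg * cosh x < sinh x.
  have h1 : u < expR (2 * x) by rewrite -ltr_ln ?posrE ?expR_gt0// expRK.
  have E0 := expR_gt0 x.
  have h2 : (1 + sg) * expR (- x) < (1 - sg) * expR x.
    have -> : expR x = expR (2 * x) * expR (- x) by rewrite -expRD; congr expR; ring.
    by rewrite mulrA ltr_pM2r ?expR_gt0// mulrC -ltr_pdivrMr.
  by move: h2; rewrite expRN_cosh_sinh expR_cosh_sinh; lra.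
have sC0 : 0 < sg * cosh x by exact: mulr_gt0.
(* [c1] is the relative excess of [tanh (be * sg)] over [sg]; concavity of tanh transfers it to
   every smaller [s]. *)
clearbody sg; exists sg, (sinh x / (sg * cosh x) - 1); split=> //.
- by rewrite sg0.
- by rewrite subr_gt0 ltr_pdivlMr// mul1r.
- rewrite [1 + _]addrC subrK -ler_pdivlMr// div1r.
  rewrite ler_pdivrMr// mulrA mulVf ?gt_eqF// mul1r.
  by have := expRN_cosh_sinh x; have := expR_gt0 (- x); lra.
move=> s /andP[s0 ssg]; rewrite [1 + _]addrC subrK.
have := @tanh_concave _ (s / sg) x; rewrite divr_ge0 ?(ltW sg0)//= ler_pdivrMr// mul1r ssg.
have -> : s / sg * x = be * s by rewrite /x; field; rewrite gt_eqF.
move=> /(_ isT (ltW x0)) h.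
rewrite -(ler_pM2l C0); apply: le_trans h.
by apply: eq_ler; field; rewrite !gt_eqF.
Qed.

(** At [s = (1 - e) sg] one has [s tanh (be s) >= (1 + c1) s^2], and [e] is taken so that
    [(1 - e)^2 (1 + c1) >= 1 + c1 / 2]. Thus the constant already contracts from [q sg] on, on an
    interval where the drift is still positive. *)
Lemma flat_gap (sg c1 : R) : 0 < sg < 1 -> 0 < c1 -> be * (1 - sg ^+ 2) = 1 ->
    (1 + c1) * sg <= 1 ->
    (forall s, 0 <= s <= sg -> (1 + c1) * s * cosh (be * s) <= sinh (be * s)) ->
  exists q tau c2 : R, [/\ 0 < q < 1, tau <= 1, 0 < c2, be * (1 - tau) = 1 - 2 * c2 &
  forall s, q * sg <= s -> tau * cosh (be * s) <= s * sinh (be * s)].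
Proof.
move=> /andP[sg0 sg1] c10 bsg c1sg hs.
have be1 := be_gt1; have be0 : 0 < be by lra.
pose e := c1 / (4 * (1 + c1)).
have c41 : 0 < 4 * (1 + c1) by lra.
have e0 : 0 < e by rewrite /e divr_gt0.
have e1 : e < 1 by rewrite /e ltr_pdivrMr; lra.
have eE : e * (4 * (1 + c1)) = c1 by rewrite /e divfK// gt_eqF.
have q0 : 0 < 1 - e by lra.
exists (1 - e), (sg ^+ 2 * (1 + c1 / 2)), ((be - 1) * c1 / 4); split.
- by rewrite q0; lra.
- have : sg * ((1 + c1) * sg) <= 1 * 1 by rewrite ler_pM//; nra.
  by have := sqr_ge0 sg; nra.
- by rewrite divr_gt0// mulr_gt0//; lra.
- have -> : be * (1 - sg ^+ 2 * (1 + c1 / 2)) =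
    be * (1 - sg ^+ 2) - (be - be * (1 - sg ^+ 2)) * c1 / 2 by ring.
  by rewrite bsg; field.
move=> s qs; have x0 : 0 < (1 - e) * sg by rewrite mulr_gt0.
have s0 := lt_le_trans x0 qs.
have hx := hs ((1 - e) * sg); have {hx} hx := hx (ltac:(apply/andP; split; nra)).
have := @le_tanh R (be * ((1 - e) * sg)) (be * s).
rewrite ler_pM2l// qs mulr_ge0 ?(ltW be0) ?(ltW x0)// => /(_ isT).
set x := (1 - e) * sg in x0 qs hx *.
have C0 := cosh_gt0 (be * x); have D0 := cosh_gt0 (be * s).
move: (cosh (be * x)) (sinh (be * x)) hx C0 => C S hx C0.
move: (cosh (be * s)) (sinh (be * s)) D0 => D T D0 hT.
have h1 : C * ((1 + c1) * x * D) <= C * T.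
  apply: le_trans hT; apply: le_trans (ler_wpM2r (ltW D0) hx).
  by apply: eq_ler; ring.
rewrite ler_pM2l// in h1.
have T0 : 0 <= T by apply: le_trans h1; rewrite !mulr_ge0 ?(ltW D0) ?(ltW x0)//; lra.
apply: le_trans (ler_wpM2r T0 qs).
apply: le_trans (ler_wpM2l (ltW x0) h1).
have -> : x * ((1 + c1) * x * D) = sg ^+ 2 * ((1 - e) ^+ 2 * (1 + c1)) * D.
  by rewrite /x; ring.
rewrite ler_wpM2r ?(ltW D0)// ler_wpM2l ?sqr_ge0//.
have := sqr_ge0 e; have c11 : 0 <= 1 + c1 by lra.
have := mulr_ge0 (sqr_ge0 e) c11; lra.
Qed.

Lemma exists_expn_le (q e : R) : 0 < q < 1 -> 0 < e -> exists r0 : nat,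
  forall r, (r0 <= r)%N -> q ^+ r <= e.
Proof.
move=> /andP[q0 q1] e0; have q1' : `|q| < 1 by rewrite ger0_norm ?(ltW q0).
have := cvg_expr q1' => /cvgrPdist_lt /(_ _ e0) [k _ hk].
by exists k => r /hk /=; rewrite sub0r normrN => /ltW /(le_trans (ler_norm _)).
Qed.

End Constants.

(** * Defects of the power and constant weights away from 0 *)

Section PowerRegion.
Variables (R : realType) (be sg c1 c4 eta : R) (r : nat).
Hypothesis be_gt1 : 1 < be.
Hypothesis sg_gt0 : 0 < sg.
Hypothesis c4_gt0 : 0 < c4.
Hypothesis c4_al : c4 <= (be - 1) / 4.
Hypothesis c4_c1 : c4 <= c1.
Hypothesis drift : forall s, 0 <= s <= sg -> (1 + c1) * s * cosh (be * s) <= sinh (be * s).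
Hypothesis eta_gt0 : 0 < eta.
Hypothesis eta_be : be * eta <= 64^-1.
Hypothesis eta_be2 : be ^+ 3 * eta ^+ 2 <= (be - 1) / 32.
Hypothesis r80 : 80 <= r%:R :> R.

Lemma sinh_drift_small (x : R) : 0 <= x <= 2^-1 ->
  (1 - x ^+ 2) * x * cosh x <= sinh x.
Proof.
move=> /[dup] /cosh_le C2 /andP[x0 x1]; apply: le_trans (sinh_ge x0).
have x2 : x ^+ 2 <= 4^-1.
  have -> : 4^-1 = 2^-1 ^+ 2 :> R by field.
  by rewrite lerXn2r ?nnegrE ?invr_ge0.
have p : 0 <= 1 - x ^+ 2 by lra.
have x20 := sqr_ge0 x.
have h : (1 - x ^+ 2) * cosh x <= 1.
  apply: le_trans (ler_wpM2l p C2) _.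
  have -> : x ^+ 4 = x ^+ 2 * x ^+ 2 by ring.
  by move: (x ^+ 2) x2 x20 => u; nra.
by rewrite mulrAC ler_piMl.
Qed.

(** For [s <= eta] the drift term is about [2 (be - 1) s], and the correction [2 r / y] is at most
    [(3 / 2) (be - 1) s] because [1 / y <= lam s / r] past the switch, where
    [lam = 3 / 4 * (be - 1)]. For [s > eta] the drift is at least [c1 s] and the correction is
    [O(h)]. *)
Lemma power_drift_near (h y : R) : 0 < h -> 4 <= y -> y * h + h <= 1 ->
    r%:R / (3 / 4 * (be - 1)) <= y ^+ 2 * h -> y * h <= sg ->
    (10 + 2 * r%:R * (1 + 2 * be)) * h <= c1 * eta ^+ 2 ->
  c4 * h * cosh (be * (y * h)) <= power_drift be h r y.
Proof.
move=> h0 y4 yh1 ry ysg hn.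
have be1 := be_gt1; have be0 : 0 < be by lra.
have y0 : 0 < y by lra.
have s0 : 0 < y * h by rewrite mulr_gt0.
have r0 : 0 < r%:R :> R by have := r80; lra.
rewrite -(ler_pM2l y0).
apply: le_trans (power_drift_ge r (ltW be0) h0 y4 yh1).
have ys : y = y * h / h by field; rewrite gt_eqF.
set s := y * h in s0 ysg yh1 ys *.
have C0 := cosh_gt0 (be * s); have sC := mulr_gt0 s0 C0.
have -> : y * (c4 * h * cosh (be * s)) = c4 * s * cosh (be * s) by rewrite /s; ring.
have [se|se] := leP s eta.
  have bse : be * s <= 64^-1 by apply: le_trans eta_be; rewrite ler_pM2l.
  have bs0 : 0 <= be * s by rewrite mulr_ge0 ?(ltW be0) ?(ltW s0).
  have S1 := @sinh_drift_small (be * s).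
  have {S1} S1 := S1 (ltac:(apply/andP; split; lra)).
  have b3 : be * (be * s) ^+ 2 <= (be - 1) / 32.
    apply: le_trans eta_be2; have -> : be * (be * s) ^+ 2 = be ^+ 3 * s ^+ 2 by ring.
    by rewrite ler_wpM2l ?exprn_ge0 ?(ltW be0)// lerXn2r ?nnegrE ?(ltW s0) ?(ltW eta_gt0).
  have yi : y^-1 <= s * (3 / 4 * (be - 1) / r%:R).
    have l0 : 0 < 3 / 4 * (be - 1) by lra.
    have lr0 : 0 < 3 / 4 * (be - 1) / r%:R by rewrite divr_gt0.
    rewrite -[leLHS]mul1r ler_pdivrMr//.
    have -> : s * (3 / 4 * (be - 1) / r%:R) * y = (y ^+ 2 * h) / (r%:R / (3 / 4 * (be - 1))).
      by rewrite /s; field; rewrite !gt_eqF//; lra.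
    by rewrite ler_pdivlMr ?mul1r// divr_gt0.
  have K0 : 0 <= 10 + 2 * r%:R * (1 + 2 * (be * s)) by rewrite addr_ge0// !mulr_ge0//; lra.
  have K1 : (10 + 2 * r%:R * (1 + 2 * (be * s))) / y <=
      s * (3 / 4 * (be - 1)) * (10 / r%:R + 2 * (1 + 2 * (be * s))).
    apply: le_trans (ler_wpM2l K0 yi) _.
    by apply: eq_ler; field; rewrite gt_eqF.
  have K2 : 10 / r%:R <= 8^-1 :> R by rewrite ler_pdivrMr//; have := r80; lra.
  have K3 : (10 + 2 * r%:R * (1 + 2 * (be * s))) / y <=
      s * (3 / 4 * (be - 1)) * (8^-1 + 2 * (1 + 32^-1)).
    apply: le_trans K1 _; rewrite ler_wpM2l ?mulr_ge0 ?(ltW s0)//; lra.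
  have S2 : (be - (be - 1) / 32) * (s * cosh (be * s)) <= sinh (be * s).
    apply: le_trans S1.
    have -> : (1 - (be * s) ^+ 2) * (be * s) * cosh (be * s) =
      (be - be * (be * s) ^+ 2) * (s * cosh (be * s)) by ring.
    by rewrite (ler_wpM2r (ltW sC))//; lra.
  have K4 := ler_wpM2r (ltW C0) K3.
  have c4' := ler_wpM2r (ltW sC) c4_al.
  have al0 : 0 < (be - 1) * (s * cosh (be * s)) by rewrite mulr_gt0 ?subr_gt0.
  by lra.
have /drift S1 : 0 <= s <= sg by rewrite (ltW s0).
have c10 : 0 < c1 := lt_le_trans c4_gt0 c4_c1.
have s1 : s <= 1 by lra.
have K1 : (10 + 2 * r%:R * (1 + 2 * (be * s))) / y <= c1 * s.
  rewrite ler_pdivrMr//.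
  have -> : c1 * s * y = c1 * s ^+ 2 / h by rewrite [in LHS]ys; ring.
  rewrite ler_pdivlMr//; apply: le_trans (_ : c1 * eta ^+ 2 <= _); last first.
    by rewrite ler_pM2l// lerXn2r ?nnegrE ?(ltW s0) ?(ltW eta_gt0) ?(ltW se).
  apply: le_trans hn; rewrite ler_pM2r// lerD2l ler_pM2l ?mulr_gt0//.
  by rewrite lerD2l ler_pM2l// ler_piMr// ltW.
have K2 := ler_wpM2r (ltW C0) K1.
have c4' : c4 * (s * cosh (be * s)) <= c1 * (s * cosh (be * s)).
  by rewrite (ler_wpM2r (ltW sC)).
by lra.
Qed.

(** The drift may be negative here, so the outward term is dropped and only the size of the inward
    one is controlled; the constant weight pays for it. *)
Lemma power_drift_far (h y : R) : 0 < h -> 4 <= y -> y * h + h <= 1 -> sg <= y * h ->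
  - (4 * h / sg) * cosh (be * (y * h)) <= power_drift be h r y.
Proof.
move=> h0 y4 yh1 ysg.
have be1 := be_gt1; have be0 : 0 < be by lra.
have y0 : 0 < y by lra.
have s0 : 0 < y * h by rewrite mulr_gt0.
have r0 : 0 <= r%:R :> R by [].
have C1 := cosh_ge1 (be * (y * h)).
have F1 : expR (- (be * (y * h))) <= 1.
  by rewrite -[leRHS]expR0 ler_expR oppr_le0 mulr_ge0 ?(ltW be0) ?(ltW s0).
have E0 := expR_gt0 (be * (y * h)); have F0 := expR_gt0 (- (be * (y * h))).
have g0 : 0 <= (1 - y * h - h) * expR (be * (y * h)) / (y + 2 * r%:R).
  by rewrite divr_ge0 ?mulr_ge0 ?(ltW E0)//; lra.
have y2 : (y - 2)^-1 <= 2 / y.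
  rewrite -[leLHS]mul1r ler_pdivrMr; last lra.
  by rewrite mulrAC ler_pdivlMr//; lra.
have hy : y^-1 <= h / sg.
  rewrite ler_pdivlMr// mulrC ler_pdivrMr//; lra.
have l1 : (1 + y * h - h) * expR (- (be * (y * h))) / (y - 2) <= 2 * 1 * (2 * (h / sg)).
  have a1 : 0 <= (1 + y * h - h) * expR (- (be * (y * h))) by rewrite mulr_ge0 ?(ltW F0)//; lra.
  have a2 : (1 + y * h - h) * expR (- (be * (y * h))) <= 2 * 1.
    by rewrite ler_pM ?(ltW F0)//; lra.
  have a3 : 0 <= (y - 2)^-1 by rewrite invr_ge0; lra.
  by apply: ler_pM => //; apply: le_trans y2 _; rewrite ler_pM2l.
have hs : 0 <= h / sg by rewrite divr_ge0 ?ltW.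
have := ler_wpM2l hs C1; rewrite /power_drift; lra.
Qed.

Lemma flat_defect_crude (h s : R) : 0 < h -> 0 <= s -> 8 * be ^+ 2 * h <= 1 ->
  - (2 * be * h) * cosh (be * s) <= flat_defect be h s.
Proof.
move=> h0 s0 hb; have be1 := be_gt1; have be0 : 0 < be by lra.
have bs0 : 0 <= be * s by rewrite mulr_ge0 ?(ltW be0).
have b2 : be * h <= be ^+ 2 * h by rewrite ler_pM2r// expr2 ler_pMl// ltW.
apply: le_trans (@flat_defect_ge _ be h s 0 _ _ _ _ _ _); rewrite ?(ltW be0) ?(ltW h0) ?ler01//.
- rewrite ler_wpM2r ?(ltW (cosh_gt0 _))//.
  have : h * (8 * be ^+ 2 * h) <= h * 1 by rewrite ler_pM2l.
  by lra.
- by lra.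
- by rewrite mul0r mulr_ge0 ?sinh_ge0.
Qed.

Lemma flat_defect_far (tau c2 h s : R) : 0 < h -> 0 <= s -> tau <= 1 ->
    be * (1 - tau) = 1 - 2 * c2 -> tau * cosh (be * s) <= s * sinh (be * s) ->
    8 * be ^+ 2 * h <= 1 -> 4 * be * h <= c2 ->
  2 * h * c2 * cosh (be * s) <= flat_defect be h s.
Proof.
move=> h0 s0 tau1 bt ht hb hc; have be1 := be_gt1; have be0 : 0 < be by lra.
have b2 : be * h <= be ^+ 2 * h by rewrite ler_pM2r// expr2 ler_pMl// ltW.
apply: le_trans (@flat_defect_ge _ be h s tau _ _ _ _ _ _) => //; rewrite ?(ltW be0) ?(ltW h0)//.
  rewrite ler_wpM2r ?(ltW (cosh_gt0 _))//.
  have -> : 2 * be * h * (1 + 4 * be * h) * (1 - tau) =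
    2 * h * (1 + 4 * be * h) * (be * (1 - tau)) by ring.
  rewrite bt.
  have c20 : 0 <= 1 - 2 * c2 by rewrite -bt mulr_ge0 ?(ltW be0)// subr_ge0.
  have c2p : 0 <= c2 by apply: le_trans hc; rewrite !mulr_ge0 ?(ltW be0) ?(ltW h0).
  have h1 : 4 * be * h * (1 - 2 * c2) <= c2 * 1 by rewrite ler_pM ?mulr_ge0 ?(ltW be0) ?(ltW h0)//; lra.
  have := ler_wpM2l (ltW h0) h1; lra.
by lra.
Qed.

Hypothesis rc4 : 4 * be <= r%:R * c4.

(** The gain [r c4 h] is at least twice the crude flat loss [2 be h] by [rc4], so half of it
    survives. *)
Lemma power_defect_near (h y : R) : 0 < h -> 4 <= y -> y * h + h <= 1 ->
    r%:R / (3 / 4 * (be - 1)) <= y ^+ 2 * h -> y * h <= sg ->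
    (10 + 2 * r%:R * (1 + 2 * be)) * h <= c1 * eta ^+ 2 -> 8 * be ^+ 2 * h <= 1 ->
  r%:R * c4 / 2 * h * cosh (be * (y * h)) <=
    flat_defect be h (y * h) + r%:R * expR (2 * be * h) * power_drift be h r y.
Proof.
move=> h0 y4 yh1 ry ysg hn hb; have be1 := be_gt1.
have s0 : 0 < y * h by rewrite mulr_gt0//; lra.
have D := power_drift_near h0 y4 yh1 ry ysg hn.
have F := flat_defect_crude h0 (ltW s0) hb.
have C0 := cosh_gt0 (be * (y * h)).
have hC : 0 < h * cosh (be * (y * h)) by rewrite mulr_gt0.
have e1 : 1 <= expR (2 * be * h).
  by rewrite -[leLHS]expR0 ler_expR !mulr_ge0 ?(ltW h0)//; lra.
have r0 : 0 <= r%:R :> R by [].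
have D0 : 0 <= power_drift be h r y.
  apply: le_trans D; apply: mulr_ge0 (ltW C0).
  exact: mulr_ge0 (ltW c4_gt0) (ltW h0).
have rD : 0 <= r%:R * power_drift be h r y by rewrite mulr_ge0.
have h1 : r%:R * power_drift be h r y <= r%:R * expR (2 * be * h) * power_drift be h r y.
  by rewrite mulrAC ler_peMr.
have h2 := ler_wpM2l r0 D.
have h3 := ler_wpM2r (ltW hC) rc4.
lra.
Qed.

Lemma power_defect_far (h y : R) : 0 < h -> 4 <= y -> y * h + h <= 1 -> sg <= y * h ->
    8 * be ^+ 2 * h <= 1 -> 0 <= flat_defect be h (y * h) ->
  - (8 * r%:R / sg) * h * cosh (be * (y * h)) <=
    flat_defect be h (y * h) + r%:R * expR (2 * be * h) * power_drift be h r y.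
Proof.
move=> h0 y4 yh1 ysg hb F0; have be1 := be_gt1; have be0 : 0 < be by lra.
have D := power_drift_far h0 y4 yh1 ysg.
have b2 : be * h <= be ^+ 2 * h by rewrite ler_pM2r// expr2 ler_pMl// ltW.
have bh0 : 0 <= be * h by rewrite mulr_ge0 ?ltW.
have e2 : expR (2 * be * h) <= 2.
  have be4 : 0 <= 2 * be * h <= 2^-1 by apply/andP; split; lra.
  apply: le_trans (expR_le_quad be4) _.
  have b3 : 2 * be * h <= 4^-1 by lra.
  have b4 : 0 <= 2 * be * h by lra.
  by have := ler_pM b4 b4 b3 b3; rewrite -expr2; lra.
have C0 := cosh_gt0 (be * (y * h)).
have r0 : 0 <= r%:R :> R by [].
have h4 : 0 <= 4 * h / sg * cosh (be * (y * h)).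
  by rewrite mulr_ge0 ?(ltW C0)// divr_ge0 ?(ltW sg_gt0)// mulr_ge0 ?ltW.
have rE : r%:R * expR (2 * be * h) <= r%:R * 2 by rewrite ler_wpM2l.
have rE0 : 0 <= r%:R * expR (2 * be * h) by rewrite mulr_ge0 ?expR_ge0.
have h5 := ler_wpM2r h4 rE; have h6 := ler_wpM2l rE0 D.
lra.
Qed.

End PowerRegion.

(** * The composite weight: Gaussian, then power, plus a constant *)

Section Weight.
Variables (R : realType) (be sg c1 c2 c4 q tau eta kap : R) (r n : nat).

(** The position [y]: [n] times the magnetization at the midpoint of the edge from [k] to [k.+1]. *)
Definition edge_pos (k : nat) : R := 2 * k%:R + 1 - n%:R.

Local Notation N := (n%:R : R).
Local Notation h := (n%:R^-1 : R).
Local Notation al := (be - 1).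
Local Notation lam := (3 / 4 * (be - 1)).

(** The point where [lam y^2 h = r]: the logarithmic slopes there are [(1 - r) / y] for the Gaussian
    weight and about [- r / y] for the power, so the power falls slightly faster. *)
Definition switch_scale : R := Num.sqrt (n%:R * (r%:R / (3 / 4 * (be - 1)))).

Definition switch_level : nat := Num.truncn ((switch_scale + n%:R - 1) / 2).

Local Notation y0 := (edge_pos switch_level).

Definition well_weight (k : nat) : R :=
  if (k <= switch_level)%N
  then power_weight r (edge_pos switch_level) /
         gauss_weight (3 / 4 * (be - 1)) n%:R^-1 (edge_pos switch_level) *
       gauss_weight (3 / 4 * (be - 1)) n%:R^-1 (edge_pos k)
  else power_weight r (edge_pos k).

(** Calibrated at [y = sg n]: beyond it the contraction [c2] of the constant pays the loss
    [8 r / sg] of the power with [r / sg] to spare, while below [q sg n] the power is larger by a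
    factor exponential in [r]. *)
Definition floor_weight : R := 9 * r%:R / (sg * c2) * power_weight r (sg * n%:R).

Definition edge_weight (k : nat) : R := well_weight k + floor_weight.

Hypothesis be_gt1 : 1 < be.
Hypothesis sg01 : 0 < sg < 1.
Hypothesis c2_gt0 : 0 < c2.
Hypothesis c2_le1 : c2 <= 1.
Hypothesis c4_gt0 : 0 < c4.
Hypothesis r80 : 80 <= r%:R :> R.
Hypothesis n_gt0 : (0 < n)%N.
Hypothesis n1 : 8 * be ^+ 2 <= n%:R.
Hypothesis n3 : 300 * (be + r%:R / (3 / 4 * (be - 1))) ^+ 6 <= n%:R.
Hypothesis n3' : 300 * (be + r%:R / (3 / 4 * (be - 1))) ^+ 6 <= (be - 1) * n%:R.
Hypothesis n6 : 16 * r%:R ^+ 2 + r%:R + 10 <= switch_scale.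
Hypothesis n7 : 9 * r%:R / (sg * c2) * (32 * be / (be - 1)) <=
  (sg / 2) ^+ 4 * (3 / 4 * (be - 1) / r%:R) ^+ 2 * n%:R.

Let al_gt0 : 0 < al. Proof. by rewrite subr_gt0. Qed.
Let lam_gt0 : 0 < lam. Proof. by rewrite mulr_gt0 ?divr_gt0. Qed.
Let r_gt0 : 0 < r%:R :> R. Proof. by have := r80; lra. Qed.
Let N_gt0 : 0 < N. Proof. by rewrite ltr0n. Qed.
Let h_gt0 : 0 < h. Proof. by rewrite invr_gt0. Qed.
Let R_gt0 : 0 < r%:R / lam. Proof. by rewrite divr_gt0. Qed.
Lemma edge_posS k : edge_pos k.+1 = edge_pos k + 2.
Proof. by rewrite /edge_pos -natr1; ring. Qed.

Lemma edge_posP k : (0 < k)%N -> edge_pos k.-1 = edge_pos k - 2.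
Proof. by case: k => // k _; rewrite edge_posS addrK. Qed.

Lemma edge_pos_ge1 k : (n <= k.*2)%N -> 1 <= edge_pos k.
Proof.
rewrite -(ler_nat R) -muln2 natrM /edge_pos => nk; lra.
Qed.

Lemma edge_pos_range k : (k < n)%N -> edge_pos k * h + h <= 1.
Proof.
rewrite -(ler_nat R) -natr1 /edge_pos => kn.
by rewrite -[X in _ + X]mul1r -mulrDl ler_pdivrMr// mul1r; lra.
Qed.

Lemma switch_scale_sqr : switch_scale ^+ 2 = n%:R * (r%:R / lam).
Proof.
rewrite sqr_sqrtr//; exact: mulr_ge0 (ltW N_gt0) (ltW R_gt0).
Qed.

Lemma switch_scale_ge0 : 0 <= switch_scale. Proof. exact: sqrtr_ge0. Qed.

Lemma switch_bounds : y0 <= switch_scale < y0 + 2.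
Proof.
have Y0 := n6; have r0 := r_gt0; have := sqr_ge0 (r%:R : R) => r20.
have N1 : 1 <= N by rewrite ler1n.
have z0 : 0 <= (switch_scale + N - 1) / 2 by rewrite divr_ge0//; lra.
have /andP[] := truncn_itv z0; rewrite -/switch_level -[switch_level.+1%:R]natr1 /edge_pos.
by move=> t1 t2; apply/andP; split; lra.
Qed.

Lemma edge_pos_le_switch k : (k <= switch_level)%N -> edge_pos k <= y0.
Proof. by rewrite -(ler_nat R) /edge_pos => ?; lra. Qed.

Lemma edge_pos_gt_switch k : (switch_level < k)%N -> y0 + 2 <= edge_pos k.
Proof. by rewrite -(ler_nat R) -natr1 /edge_pos => ?; lra. Qed.

Let y0_large : 16 * r%:R ^+ 2 + r%:R + 8 <= y0.
Proof. by have /andP[_] := switch_bounds; have := n6; lra. Qed.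

Let y0_gt0 : 0 < y0.
Proof. by have := y0_large; have := sqr_ge0 (r%:R : R); have := r_gt0; lra. Qed.

Lemma gauss_weight_gt0 y : 0 < y -> 0 < gauss_weight lam h y.
Proof. by move=> y_gt0; rewrite mulr_gt0 ?expR_gt0. Qed.

Lemma well_weight_gt0 k : (n <= k.*2)%N -> 0 < well_weight k.
Proof.
move=> /edge_pos_ge1 k1; have k0 : 0 < edge_pos k by lra.
rewrite /well_weight; case: ifP => _; last exact: power_weight_gt0.
by rewrite mulr_gt0 ?divr_gt0 ?gauss_weight_gt0 ?power_weight_gt0.
Qed.

Lemma floor_weight_gt0 : 0 < floor_weight.
Proof.
have /andP[s0 _] := sg01.
by rewrite mulr_gt0 ?divr_gt0 ?power_weight_gt0 ?mulr_gt0.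
Qed.

Lemma well_weight_switch : well_weight switch_level = power_weight r y0.
Proof. by rewrite /well_weight leqnn divfK// gt_eqF// gauss_weight_gt0. Qed.

Let lamR : lam * y0 ^+ 2 * h <= r%:R.
Proof.
have /andP[yY _] := switch_bounds.
have : y0 ^+ 2 <= N * (r%:R / lam).
  by rewrite -switch_scale_sqr lerXn2r ?nnegrE ?switch_scale_ge0 ?(ltW y0_gt0).
rewrite -(ler_pM2l lam_gt0) => hh.
rewrite ler_pdivrMr//; apply: le_trans hh _.
by apply: eq_ler; field; rewrite gt_eqF.
Qed.

(* Past the switch the Gaussian lies above the power: the kink of the weight is
   concave, which is the direction preserved by the edge operator. *)
Lemma power_le_gauss_next : power_weight r (y0 + 2) <=
  power_weight r y0 / gauss_weight lam h y0 * gauss_weight lam h (y0 + 2).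
Proof.
have y0p := y0_gt0; have yl := y0_large; have r0 := r_gt0; have h0 := h_gt0.
set u := lam * (2 * y0 + 2) * h; set P := power_weight r y0.
have P0 : 0 < P := power_weight_gt0 r y0p.
(* The margin [2 / y0] of the linear factor must beat a second-order term [32 r^2 / y0^2], whence
   the [16 r^2] required of the switch scale. *)
suff main : y0 / (y0 + 2 * r%:R) <= (y0 + 2) / y0 / expR u.
  rewrite power_weight_shift//; apply: le_trans (ler_wpM2r (ltW P0) main) _.
  rewrite /gauss_weight.
  have -> : expR (- (lam * (y0 + 2) ^+ 2 * h / 2)) =
      expR (- (lam * y0 ^+ 2 * h / 2)) * expR (- u).
    by rewrite -expRD; congr expR; rewrite /u; field; rewrite gt_eqF.
  rewrite [expR (- u)]expRN; apply: eq_ler.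
  by field; rewrite !gt_eqF ?expR_gt0.
rewrite ler_pdivlMr ?expR_gt0// mulrAC ler_pdivrMr; last lra.
rewrite mulrAC ler_pdivlMr//.
have uE : u * y0 ^+ 2 <= r%:R * (2 * y0 + 2).
  have -> : u * y0 ^+ 2 = (lam * y0 ^+ 2 * h) * (2 * y0 + 2) by rewrite /u; ring.
  by rewrite ler_wpM2r//; lra.
have u0 : 0 <= u.
  by apply: mulr_ge0 (ltW h0); apply: mulr_ge0 (ltW lam_gt0) _; lra.
have y1 : 1 <= y0 by have := sqr_ge0 (r%:R : R); lra.
have r2 : 80 * r%:R <= r%:R ^+ 2 :> R by rewrite expr2 ler_wpM2r ?(ltW r0).
have uy : u * y0 <= 4 * r%:R.
  have -> : u * y0 = u * y0 ^+ 2 / y0 by field; rewrite gt_eqF.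
  rewrite ler_pdivrMr//; apply: le_trans uE _; have := ler_wpM2l (ltW r0) y1; lra.
have u2 : u <= 2^-1.
  rewrite -(ler_pM2r y0p); lra.
have e1 := @expR_le_quad _ u; have {e1} e1 := e1 (ltac:(by rewrite u0)).
have uy2 : (u * y0) ^+ 2 <= (4 * r%:R) ^+ 2.
  have u1 : 0 <= u * y0 := mulr_ge0 u0 (ltW y0p).
  by rewrite lerXn2r ?nnegrE// (le_trans u1).
have e2 := ler_wpM2r (sqr_ge0 y0) e1.
have r3 : 32 * r%:R ^+ 2 + 2 * r%:R <= 2 * y0 + 4 * r%:R by lra.
rewrite exprMn in uy2; lra.
Qed.

Let M := be + r%:R / lam.

Lemma well_defect_low k : (n <= k.*2)%N -> (k < n)%N -> (k <= switch_level)%N ->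
  edge_gain be h (edge_pos k * h) * well_weight k.+1
    + edge_loss be h (edge_pos k * h) * well_weight k.-1 <=
  (edge_diag be h (edge_pos k * h)
    - al / 4 * h * cosh (be * (edge_pos k * h))) * well_weight k.
Proof.
move=> nk kn kk.
have k_gt0 : (0 < k)%N by rewrite lt0n; apply: contraTneq nk => ->; rewrite -ltnNge.
have y1 := edge_pos_ge1 nk; have yh := edge_pos_range kn.
have h0 := h_gt0.
set y := edge_pos k in y1 yh *.
have y_gt0 : 0 < y by lra.
set c0 := power_weight r y0 / gauss_weight lam h y0.
have c0p : 0 < c0 by rewrite /c0 divr_gt0 ?power_weight_gt0 ?gauss_weight_gt0.
have W0 : well_weight k = c0 * gauss_weight lam h y by rewrite /well_weight kk.
have W1 : well_weight k.-1 = c0 * gauss_weight lam h (y - 2).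
  by rewrite /well_weight edge_posP// (leq_trans (leq_pred k) kk).
(* At the switch the right neighbour is already on the power branch, which lies below the continued
   Gaussian, so the Gaussian computation remains an upper bound. *)
have W2 : well_weight k.+1 <= c0 * gauss_weight lam h (y + 2).
  rewrite /well_weight; case: ifP => kS; first by rewrite edge_posS.
  have kE : k = switch_level by apply/eqP; rewrite eqn_leq kk leqNgt kS.
  rewrite edge_posS /y kE.
  exact: power_le_gauss_next.
have g0 : 0 <= edge_gain be h (y * h).
  by rewrite /edge_gain mulr_ge0 ?divr_ge0 ?expR_ge0// mulr_ge0 ?expR_ge0//; lra.
apply: le_trans (lerD (ler_wpM2l g0 W2) (lexx _)) _.
rewrite W0 W1 [_ * (c0 * _) as X in X + _]mulrCA [X in _ + X]mulrCA -mulrDr [leRHS]mulrCA.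
rewrite ler_pM2l//.
have hn0 : h != 0 by rewrite gt_eqF.
have yn0 : y != 0 by rewrite gt_eqF.
have := @gauss_weight_defect _ al h y hn0 yn0.
have beE : 1 + al = be by ring.
rewrite beE => ->; rewrite [leRHS]mulrC ler_pM2l ?gauss_weight_gt0//.
have sM : (y * h) ^+ 2 <= M * h.
  rewrite exprMn expr2 -expr2 [h ^+ 2]expr2 mulrA ler_pM2r//.
  rewrite ler_pdivrMr//.
  have /andP[yY _] := switch_bounds.
  have : y ^+ 2 <= switch_scale ^+ 2.
    rewrite lerXn2r ?nnegrE ?switch_scale_ge0 ?(ltW y_gt0)//.
    exact: le_trans (edge_pos_le_switch kk) yY.
  rewrite switch_scale_sqr mulrC => /le_trans; apply; rewrite ler_pM2r// lerDr.
  by have := be_gt1; lra.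
have MN x : 300 * M ^+ 6 <= x * N -> 300 * M ^+ 6 * h <= x by rewrite ler_pdivrMr.
have := @gauss_bound _ al M h (y * h) al_gt0 _ h0 _ sM _ _.
rewrite beE; apply.
- by rewrite lerDl ltW.
- by rewrite mulr_gt0.
- by apply: MN; rewrite mul1r; exact: n3.
- by apply: MN; exact: n3'.
Qed.

Lemma well_defect_high k : (switch_level < k)%N -> 
  edge_gain be h (edge_pos k * h) * well_weight k.+1
    + edge_loss be h (edge_pos k * h) * well_weight k.-1 =
  (edge_diag be h (edge_pos k * h) -
    (flat_defect be h (edge_pos k * h)
     + r%:R * expR (2 * be * h) * power_drift be h r (edge_pos k))) * well_weight k.
Proof.
move=> kk; have k_gt0 : (0 < k)%N := leq_ltn_trans (leq0n _) kk.
have y2 : 2 < edge_pos k by have := edge_pos_gt_switch kk; have := y0_gt0; lra.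
have W0 : well_weight k = power_weight r (edge_pos k) by rewrite /well_weight leqNgt kk.
have W2 : well_weight k.+1 = power_weight r (edge_pos k + 2).
  by rewrite /well_weight leqNgt ltnS (ltnW kk) /= edge_posS.
have W1 : well_weight k.-1 = power_weight r (edge_pos k - 2).
  (* If the left neighbour is the switch itself, the normalization makes both branches agree
     there. *)
  have [kE|kE] := eqVneq k.-1 switch_level.
    by rewrite kE well_weight_switch -kE edge_posP.
  rewrite /well_weight edge_posP// ifF//; apply/negbTE.
  by rewrite -ltnNge ltn_neqAle eq_sym kE -ltnS prednK.
have D := power_weight_defect be h r y2.
rewrite W0 W1 W2; lra.
Qed.

(** Going down from the switch costs the Gaussian branch at most a factor [n], whereas from [sg n]
    to the switch the power grows by at least [rho^4], of order [n^2]. The remaining factor [n]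
    exceeds every constant by [n7]. *)
Lemma floor_small_low k : (n <= k.*2)%N -> (k <= switch_level)%N ->
  32 * be * floor_weight <= al * well_weight k.
Proof.
move=> nk kk; have y1 := edge_pos_ge1 nk; have yy0 := edge_pos_le_switch kk.
have be1 := be_gt1; have be0 : 0 < be by lra.
have /andP[s0 s1] := sg01; have r0 := r_gt0; have N0 := N_gt0.
have /andP[yY _] := switch_bounds; have Y2 := switch_scale_sqr.
have Y6 := n6; have r20 := sqr_ge0 (r%:R : R).
have Y0 : 0 < switch_scale by lra.
have l0 := lam_gt0.
set P := power_weight r (sg * N); have P0 : 0 < P by rewrite power_weight_gt0// mulr_gt0.
pose rho := sg * N / (2 * switch_scale).
have rho0 : 0 <= rho by rewrite divr_ge0 ?mulr_ge0 ?(ltW s0) ?(ltW Y0).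
have rho4 : rho ^+ 4 = (sg / 2) ^+ 4 * (lam / r%:R) ^+ 2 * N * N.
  have -> : rho ^+ 4 = (sg / 2) ^+ 4 * N ^+ 4 / (switch_scale ^+ 2) ^+ 2.
    by rewrite /rho; field; rewrite gt_eqF.
  by rewrite Y2; field; rewrite !gt_eqF.
set K := 9 * r%:R / (sg * c2) * (32 * be / al).
have K1 : K * N <= rho ^+ 4 by rewrite rho4 ler_wpM2r ?(ltW N0).
have K0 : 0 < K.
  by apply: mulr_gt0; apply: divr_gt0; rewrite ?mulr_gt0.
have K2 : 1 <= K.
  have -> : K = (288 * r%:R * be) / (sg * c2 * al).
    by rewrite /K; field; rewrite !gt_eqF.
  rewrite ler_pdivlMr ?mulr_gt0// mul1r.
  have sc : sg * c2 <= 1 * 1 by rewrite ler_pM// ltW.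
  have sc1 := ler_wpM2r (ltW al_gt0) sc; have rb := ler_wpM2r (ltW be0) r80; lra.
have N1 : 1 <= N by rewrite ler1n.
have rho1 : 1 <= rho.
  rewrite -(@expr_ge1 _ 4)//; apply: le_trans K1.
  by apply: le_trans K2 _; rewrite ler_peMr// ltW.
have sgY : 2 * switch_scale <= sg * N.
  by move: rho1; rewrite /rho ler_pdivlMr ?mulr_gt0// mul1r.
have sgN : sg * N <= N by rewrite ler_piMl ?(ltW N0) ?(ltW s1).
have sgN0 : 0 <= sg * N by rewrite mulr_ge0 ?ltW.
have y0N : y0 <= N by lra.
have y00 := y0_gt0; have y0sg : y0 <= sg * N by lra.
have PR := @power_weight_ratio R r y0 (sg * N).
have {PR} PR := PR (ltac:(by rewrite y00)).
have rhoB : rho <= (sg * N + 2 * r%:R) / (y0 + 2 * r%:R).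
  rewrite /rho ler_pdivrMr ?mulr_gt0// mulrAC ler_pdivlMr; last lra.
  have r2 := ler_wpM2l (ltW r0) r80.
  by apply: ler_pM; rewrite ?sgN0//; lra.
have r4 : (4 <= r)%N by rewrite -(ler_nat R); have := r80; lra.
have K3 : K * N * P <= power_weight r y0.
  apply: le_trans PR; rewrite ler_wpM2r ?(ltW P0)//.
  apply: le_trans K1 _; apply: le_trans (ler_weXn2l rho1 r4) _.
  by rewrite lerXn2r ?nnegrE// (le_trans rho0).
have g0 := gauss_weight_gt0 y00.
have gg : gauss_weight lam h y0 <= N * gauss_weight lam h (edge_pos k).
  rewrite /gauss_weight mulrA ler_pM ?expR_ge0 ?(ltW y00)//.
    by apply: le_trans y0N _; rewrite ler_peMr ?(ltW N0).
  rewrite ler_expR lerN2 ler_wpM2r ?invr_ge0// ler_wpM2r ?(ltW h_gt0)//.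
  by rewrite ler_wpM2l ?(ltW l0)// lerXn2r ?nnegrE ?(ltW y00)//; lra.
have W0 : K * P <= well_weight k.
  rewrite /well_weight kk [leRHS]mulrAC ler_pdivlMr// -(ler_pM2l N0).
  have G0 : 0 <= gauss_weight lam h (edge_pos k) by rewrite ltW// gauss_weight_gt0//; lra.
  apply: le_trans (_ : (K * N * P) * gauss_weight lam h y0 <= _).
    by apply: eq_ler; ring.
  apply: le_trans (ler_pM _ (ltW g0) K3 gg) _.
    by apply: mulr_ge0 (ltW P0); exact: mulr_ge0 (ltW K0) (ltW N0).
  by apply: eq_ler; ring.
apply: le_trans (ler_wpM2l (ltW al_gt0) W0).
rewrite /floor_weight -/P /K; apply: eq_ler.
by field; rewrite !gt_eqF.
Qed.

Hypothesis q01 : 0 < q < 1.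
Hypothesis n5 : 2 * r%:R <= sg * n%:R.
Hypothesis rq : ((1 + q) / 2) ^+ r * (144 * be) <= sg * c2 * c4.

(** Between [q sg n] and [sg n] the power drops by at least [(2 / (1 + q))^r] (this uses [n5]), and
    [rq] makes that factor large enough. *)
Lemma floor_small_mid k : (switch_level < k)%N -> edge_pos k * h <= q * sg ->
  16 * be * floor_weight <= r%:R * c4 * well_weight k.
Proof.
move=> kk yq; have yy0 := edge_pos_gt_switch kk; have y00 := y0_gt0.
have be1 := be_gt1; have be0 : 0 < be by lra.
have /andP[s0 s1] := sg01; have r0 := r_gt0; have N0 := N_gt0.
have /andP[q0 q1] := q01; have n5' := n5.
set y := edge_pos k in yq yy0 *; have y_gt0 : 0 < y by lra.
have W0 : well_weight k = power_weight r y by rewrite /well_weight leqNgt kk.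
set P := power_weight r (sg * N); have P0 : 0 < P by rewrite power_weight_gt0// mulr_gt0.
have x0 : 0 < q * sg * N by rewrite !mulr_gt0.
have xle : q * sg * N <= sg * N by rewrite -mulrA ler_piMl ?(ltW q1)// mulr_ge0 ?ltW.
have PR := @power_weight_ratio R r (q * sg * N) (sg * N).
have {PR} PR := PR (ltac:(by rewrite x0)).
have yx : y <= q * sg * N by rewrite -ler_pdivrMr.
have Py : power_weight r (q * sg * N) <= power_weight r y.
  by apply: power_weight_le; rewrite y_gt0.
set p := (1 + q) / 2; have p0 : 0 < p by rewrite divr_gt0//; lra.
have pB : p^-1 <= (sg * N + 2 * r%:R) / (q * sg * N + 2 * r%:R).
  rewrite ler_pdivlMr; last lra.
  rewrite mulrC ler_pdivrMr//.
  have := ler_wpM2l (_ : 0 <= (1 - q) / 2) n5'.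
  by rewrite divr_ge0 ?subr_ge0 ?(ltW q1)// => /(_ isT); rewrite /p; lra.
have PB : p ^- r * P <= power_weight r y.
  apply: le_trans Py; apply: le_trans PR; rewrite ler_wpM2r ?(ltW P0)//.
  by rewrite -exprVn lerXn2r ?nnegrE ?invr_ge0 ?(ltW p0)// (le_trans _ pB)// invr_ge0 ltW.
have pr0 : 0 < p ^+ r by rewrite exprn_gt0.
have rc : 0 < r%:R * c4 by rewrite mulr_gt0.
rewrite W0; apply: le_trans (ler_wpM2l (ltW rc) PB).
rewrite /floor_weight -/P !mulrA ler_wpM2r ?(ltW P0)//.
rewrite ler_pdivlMr// mulrAC ler_pdivrMr ?mulr_gt0//.
have := ler_wpM2l (ltW r0) rq; rewrite -/p; lra.
Qed.

Lemma floor_big_far k : (switch_level < k)%N -> sg <= edge_pos k * h ->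
  9 * r%:R / sg * well_weight k <= c2 * floor_weight.
Proof.
move=> kk ys; have /andP[s0 s1] := sg01; have r0 := r_gt0; have N0 := N_gt0.
have W0 : well_weight k = power_weight r (edge_pos k) by rewrite /well_weight leqNgt kk.
have -> : c2 * floor_weight = 9 * r%:R / sg * power_weight r (sg * N).
  by rewrite /floor_weight; field; rewrite !gt_eqF.
rewrite W0 ler_wpM2l ?divr_ge0 ?mulr_ge0 ?(ltW s0)//.
by apply: power_weight_le; rewrite mulr_gt0//= -ler_pdivlMr.
Qed.

Lemma edge_weight_odd k : k.*2.+1 = n -> 0 <= edge_weight k.
Proof.
move=> kn; have y_0 : edge_pos k = 0.
  rewrite /edge_pos; have -> : N = 2 * k%:R + 1 by rewrite -kn -addn1 natrD -muln2 natrM mulrC.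
  by ring.
have kk : (k <= switch_level)%N.
  rewrite leqNgt; apply/negP => /edge_pos_gt_switch; rewrite y_0.
  by have := y0_gt0; lra.
by rewrite /edge_weight /well_weight kk y_0 /gauss_weight mul0r mulr0 add0r ltW// floor_weight_gt0.
Qed.

(** The two edges sit at [y = 1] and [y = -1], where the odd Gaussian branch cancels and only the
    positive constant remains. *)
Lemma edge_weight_even k : k.*2 = n -> - edge_weight k <= edge_weight k.-1.
Proof.
move=> kn; have k_gt0 : (0 < k)%N.
  by rewrite lt0n; apply: contraTneq n_gt0 => k0; rewrite -kn k0.
have y_1 : edge_pos k = 1.
  rewrite /edge_pos; have -> : N = 2 * k%:R by rewrite -kn -muln2 natrM mulrC.
  by ring.
have kk : (k <= switch_level)%N.
  rewrite leqNgt; apply/negP => /edge_pos_gt_switch; rewrite y_1.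
  by have := y0_gt0; lra.
rewrite /edge_weight /well_weight kk (leq_trans (leq_pred k) kk) edge_posP// y_1.
have -> : 1 - 2 = -1 :> R by ring.
rewrite /gauss_weight sqrrN mulN1r mulrN mul1r.
by have := floor_weight_gt0; lra.
Qed.

Lemma edge_weight_ratio k l :
    (n <= k.*2)%N -> (n <= l.*2)%N ->
  edge_weight k <= (1 + expR (r%:R / 2)) * 2 ^+ r * n%:R ^+ r * edge_weight l.
Proof.
move=> /edge_pos_ge1 yk nl; have n5' := n5.
have r0 := r_gt0; have N0 := N_gt0; have /andP[s0 s1] := sg01; have y00 := y0_gt0.
have Wl := well_weight_gt0 nl; have A0 := floor_weight_gt0.
have e1 : 1 <= expR (r%:R / 2) :> R by rewrite -[leLHS]expR0 ler_expR divr_ge0.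
have y01 : 1 <= y0 by have := y0_large; have := sqr_ge0 (r%:R : R); lra.
have Wk : well_weight k <= expR (r%:R / 2).
  rewrite /well_weight; case: ifP => kk; last by apply: le_trans e1; exact: power_weight_le1.
  have yy0 := edge_pos_le_switch kk.
  have g0 := gauss_weight_gt0 y00.
  rewrite mulrAC ler_pdivrMr//; apply: (@le_trans _ _ (gauss_weight lam h (edge_pos k))).
    by rewrite ler_piMl ?power_weight_le1// ltW// gauss_weight_gt0//; lra.
  rewrite /gauss_weight [leRHS]mulrCA ler_pM ?expR_ge0//; first lra.
  rewrite -expRD; apply: (@le_trans _ _ 1).
    rewrite -[leRHS]expR0 ler_expR oppr_le0 divr_ge0//; apply: mulr_ge0 (ltW h_gt0).
    exact: mulr_ge0 (ltW lam_gt0) (sqr_ge0 _).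
  rewrite -[leLHS]expR0 ler_expR -mulrBl divr_ge0// subr_ge0; exact: lamR.
set B := 9 * r%:R / (sg * c2).
have B1 : 1 <= B.
  rewrite /B ler_pdivlMr ?mulr_gt0// mul1r.
  have : sg * c2 <= 1 * 1 by rewrite ler_pM// ltW.
  by have := r80; lra.
have sgN1 : 1 <= sg * N by have := r80; lra.
have AB : floor_weight <= B.
  by rewrite /floor_weight -/B ler_piMr ?power_weight_le1// (le_trans ler01).
have NN : (2 * N) ^- r <= power_weight r (sg * N).
  apply: le_trans (power_weight_lower r _); last by rewrite mulr_gt0.
  have sN : sg * N <= N by rewrite ler_piMl ?(ltW N0) ?(ltW s1).
  rewrite lef_pV2 ?posrE ?exprn_gt0 ?mulr_gt0//; last by lra.
  by rewrite lerXn2r ?nnegrE//; lra.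
have NA : B <= (2 * N) ^+ r * floor_weight.
  rewrite mulrC -ler_pdivrMr ?exprn_gt0 ?mulr_gt0// /floor_weight -/B.
  by rewrite ler_wpM2l// (le_trans ler01).
have lA : floor_weight <= edge_weight l by rewrite /edge_weight lerDr ltW.
have E0 : 0 <= 1 + expR (r%:R / 2) :> R by lra.
apply: le_trans (_ : (1 + expR (r%:R / 2)) * B <= _).
  have : expR (r%:R / 2) * 1 <= expR (r%:R / 2) * B by rewrite ler_wpM2l// (le_trans ler01).
  by rewrite /edge_weight; lra.
apply: le_trans (ler_wpM2l E0 NA) _.
have -> : (1 + expR (r%:R / 2)) * ((2 * N) ^+ r * floor_weight) =
  (1 + expR (r%:R / 2)) * 2 ^+ r * n%:R ^+ r * floor_weight by rewrite exprMn; ring.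
by rewrite ler_wpM2l// !mulr_ge0 ?exprn_ge0.
Qed.

Hypothesis c4_al : c4 <= (be - 1) / 4.
Hypothesis c4_c1 : c4 <= c1.
Hypothesis drift : forall s, 0 <= s <= sg -> (1 + c1) * s * cosh (be * s) <= sinh (be * s).
Hypothesis eta_gt0 : 0 < eta.
Hypothesis eta_be : be * eta <= 64^-1.
Hypothesis eta_be2 : be ^+ 3 * eta ^+ 2 <= (be - 1) / 32.
Hypothesis rc4 : 4 * be <= r%:R * c4.
Hypothesis tau1 : tau <= 1.
Hypothesis be_tau : be * (1 - tau) = 1 - 2 * c2.
Hypothesis flat : forall s, q * sg <= s -> tau * cosh (be * s) <= s * sinh (be * s).
Hypothesis n2 : 4 * be <= c2 * n%:R.
Hypothesis n4 : 10 + 2 * r%:R * (1 + 2 * be) <= c1 * eta ^+ 2 * n%:R.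
Hypothesis kap_gt0 : 0 < kap.
Hypothesis kap_al : kap <= (be - 1) / 16.
Hypothesis kap_c2 : kap <= c2 / 2.
Hypothesis kap2 : kap <= 2^-1.

(** Four ranges: up to the switch the Gaussian pays for the constant; from there to [q sg] the power
    does; between [q sg] and [sg] both contract; beyond [sg] the constant pays for the power. *)
Lemma edge_weight_super k : (n <= k.*2)%N -> (k < n)%N ->
  edge_gain be h (edge_pos k * h) * edge_weight k.+1
    + edge_loss be h (edge_pos k * h) * edge_weight k.-1 <=
  (edge_diag be h (edge_pos k * h)
    - 2 * kap * h * cosh (be * (edge_pos k * h))) * edge_weight k.
Proof.
move=> nk kn; have y1 := edge_pos_ge1 nk; have yh := edge_pos_range kn.
have h0 := h_gt0; have be1 := be_gt1; have N0 := N_gt0; have r0 := r_gt0.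
have /andP[sg0 sg1] := sg01; have /andP[q0 q1] := q01.
have ka := kap_al; have kc := kap_c2; have k2 := kap2; have k0 := kap_gt0; have c2p := c2_gt0.
have W0 := well_weight_gt0 nk; have A0 := floor_weight_gt0.
have hb : 8 * be ^+ 2 * h <= 1 by rewrite ler_pdivrMr// mul1r.
have hc : 4 * be * h <= c2 by rewrite ler_pdivrMr.
have hn : (10 + 2 * r%:R * (1 + 2 * be)) * h <= c1 * eta ^+ 2 by rewrite ler_pdivrMr.
have s0 : 0 < edge_pos k * h by rewrite mulr_gt0//; lra.
have C0 := cosh_gt0 (be * (edge_pos k * h)).
have hC : 0 < h * cosh (be * (edge_pos k * h)) by rewrite mulr_gt0.
have FA := flat_defect_crude be_gt1 h0 (ltW s0) hb.
have FB : q * sg <= edge_pos k * h -> 2 * h * c2 * cosh (be * (edge_pos k * h)) <=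
    flat_defect be h (edge_pos k * h).
  by move=> /flat ht; apply: (flat_defect_far be_gt1 h0 (ltW s0) tau1 be_tau ht hb hc).
have flatE : edge_gain be h (edge_pos k * h) + edge_loss be h (edge_pos k * h) =
  edge_diag be h (edge_pos k * h) - flat_defect be h (edge_pos k * h).
  by rewrite /flat_defect; ring.
rewrite /edge_weight.
set g := edge_gain _ _ _ in flatE *; set l := edge_loss _ _ _ in flatE *.
set d := edge_diag _ _ _ in flatE *; set F := flat_defect _ _ _ in FA FB flatE *.
set C := cosh _ in C0 hC FA FB *; set A := floor_weight in A0 *.
(* [D] is the relative defect of the well part and [F] that of the constant; only their weighted sum
   has to be positive. *)
suff [D hD hk] : exists2 D, g * well_weight k.+1 + l * well_weight k.-1 <= (d - D) * well_weight k
    & 2 * kap * (h * C) * (well_weight k + A) <= D * well_weight k + F * A.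
  have e1 : (g + l) * A = (d - F) * A by rewrite flatE.
  lra.
have A1 := ler_wpM2r (ltW A0) FA.
have hCA0 := mulr_ge0 (ltW hC) (ltW A0).
have hCW0 := mulr_ge0 (ltW hC) (ltW W0).
have [kk|kk] := leqP k switch_level.
  exists (al / 4 * h * C); first exact: well_defect_low nk kn kk.
  have s1 := floor_small_low nk kk; rewrite -/A in s1.
  have s2 := ler_wpM2l (ltW hC) s1.
  have kW := ler_wpM2r (ltW W0) (ler_wpM2l (ltW hC) ka).
  have kA : kap * (h * C * A) <= be * (h * C * A).
    by rewrite (ler_wpM2r hCA0)//; lra.
  lra.
have yy0 := edge_pos_gt_switch kk.
have y4 : 4 <= edge_pos k.
  by have := y0_large; have := sqr_ge0 (r%:R : R); lra.
exists (F + r%:R * expR (2 * be * h) * power_drift be h r (edge_pos k)).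
  by rewrite /F /d well_defect_high.
have [ys|ys] := leP (edge_pos k * h) sg; last first.
  have ysq : q * sg <= edge_pos k * h by apply: le_trans (ltW ys); rewrite ler_piMl ?(ltW sg0) ?(ltW q1).
  have F0 : 0 <= F.
    apply: le_trans (FB ysq); apply: mulr_ge0 (ltW C0).
    by apply: mulr_ge0 (ltW c2p); lra.
  have D := power_defect_far r be_gt1 sg0 h0 y4 yh (ltW ys) hb F0; rewrite -/F -/C in D.
  have DW := ler_wpM2r (ltW W0) D.
  have FAA := ler_wpM2r (ltW A0) (FB ysq).
  have s1 := floor_big_far kk (ltW ys); rewrite -/A in s1.
  have s2 := ler_wpM2l (ltW hC) s1.
  have kA := ler_wpM2r (ltW A0) (ler_wpM2l (ltW hC) kc).
  have rs : 1 <= r%:R / sg.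
    by rewrite ler_pdivlMr// mul1r; have := r80; lra.
  have kW : 2 * kap * (h * C * well_weight k) <= r%:R / sg * (h * C * well_weight k).
    by rewrite (ler_wpM2r hCW0)//; lra.
  lra.
have ry : r%:R / lam <= edge_pos k ^+ 2 * h.
  rewrite ler_pdivlMr// mulrC -switch_scale_sqr lerXn2r ?nnegrE ?switch_scale_ge0//.
    by lra.
  by have /andP[_] := switch_bounds; lra.
have D := power_defect_near be_gt1 c4_gt0 c4_al c4_c1 drift eta_gt0 eta_be eta_be2 r80 rc4
  h0 y4 yh ry ys hn hb; rewrite -/F -/C in D.
have DW := ler_wpM2r (ltW W0) D.
have rc := ler_wpM2r (ltW W0) (ler_wpM2l (ltW hC) rc4).
have kW : kap * (h * C * well_weight k) <= be / 2 * (h * C * well_weight k).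
  by rewrite (ler_wpM2r hCW0)//; lra.
have [yq|yq] := leP (q * sg) (edge_pos k * h).
  have FAA := ler_wpM2r (ltW A0) (FB yq).
  have kA := ler_wpM2r (ltW A0) (ler_wpM2l (ltW hC) kc).
  have hCA := mulr_ge0 (ltW c2p) hCA0.
  have hCW : 0 <= be * (h * C * well_weight k) by apply: mulr_ge0 => //; lra.
  lra.
have s1 := floor_small_mid kk (ltW yq); rewrite -/A in s1.
have s2 := ler_wpM2l (ltW hC) s1.
have kA : kap * (h * C * A) <= be * (h * C * A).
  by rewrite (ler_wpM2r hCA0)//; lra.
lra.
Qed.

End Weight.

Section WeightExists.
Variable R : realType.

Lemma weight_exists (be : R) : 1 < be ->
  exists (kap M : R) (d n0 : nat), [/\ 0 < kap, kap <= 2^-1, 0 < M &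
  forall n, (n0 <= n)%N -> (1 < n)%N /\ exists V : nat -> R,
  [/\ forall k, (n <= k.*2)%N -> 0 < V k,
      forall k l, (n <= k.*2)%N -> (n <= l.*2)%N -> V k <= M * n%:R ^+ d * V l,
      forall k, k.*2.+1 = n -> 0 <= V k,
      forall k, k.*2 = n -> - V k <= V k.-1
    & forall k, (n <= k.*2)%N -> (k < n)%N ->
      let h := n%:R^-1 in let s := edge_pos R n k * h in
      edge_gain be h s * V k.+1 + edge_loss be h s * V k.-1 <=
      (edge_diag be h s - 2 * kap * h * cosh (be * s)) * V k]].
Proof.
move=> be1; have be0 : 0 < be by lra.
have al0 : 0 < be - 1 by lra.
have [sg [c1 [sg01 c1p bsg c1sg drift]]] := drift_gap be1.
have [q [tau [c2 [q01 tau1 c2p bt flat]]]] := flat_gap be1 sg01 c1p bsg c1sg drift.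
have /andP[sg0 sg1] := sg01; have /andP[q0 q1] := q01.
have c2_1 : c2 <= 1.
  have : 0 <= be * (1 - tau) by rewrite mulr_ge0 ?subr_ge0 ?(ltW be0).
  by rewrite bt; lra.
pose c4 := Num.min ((be - 1) / 4) c1.
have c40 : 0 < c4 by rewrite /c4 lt_min divr_gt0.
have c4a : c4 <= (be - 1) / 4 by rewrite /c4 ge_min lexx.
have c41 : c4 <= c1 by rewrite /c4 ge_min lexx orbT.
have b2 : 1 <= be ^+ 2 by rewrite expr_ge1// ltW.
have b3 : be <= be ^+ 3 by rewrite exprS ler_peMr// ltW.
pose eta := (be - 1) / (64 * be ^+ 3).
have e0 : 0 < eta by rewrite divr_gt0 ?mulr_gt0 ?exprn_gt0.
have eb : be * eta <= 64^-1.
  have -> : be * eta = (be - 1) / be ^+ 2 / 64 by rewrite /eta; field; rewrite gt_eqF.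
  rewrite ler_pdivrMr// mulVf ?pnatr_eq0// ler_pdivrMr ?exprn_gt0// mul1r expr2.
  by have := ler_wpM2l (ltW be0) (ltW be1); lra.
have eb2 : be ^+ 3 * eta ^+ 2 <= (be - 1) / 32.
  have -> : be ^+ 3 * eta ^+ 2 = (be - 1) / be ^+ 3 / 4096 * (be - 1).
    by rewrite /eta; field; rewrite gt_eqF.
  rewrite mulrC; apply: ler_wpM2l; first exact: ltW.
  rewrite ler_pdivrMr// ler_pdivrMr ?exprn_gt0//; lra.
have p01 : 0 < (1 + q) / 2 < 1 by clear -q0 q1; apply/andP; split; lra.
have [|r0 hr0] := exists_expn_le p01 (e := sg * c2 * c4 / (144 * be)).
  by rewrite divr_gt0 ?mulr_gt0.
(* Three demands: [r0] makes the constant small below [q sg], 80 makes [10 / r <= 1 / 8] in the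
   drift estimate, and the last gives [4 be <= r c4]. *)
pose r := maxn r0 (maxn 80 (Num.truncn (4 * be / c4)).+1).
have r80 : 80 <= r%:R :> R by rewrite ler_nat !leq_max leqnn !orbT.
have rp : 0 < r%:R :> R by clear -r80; lra.
have rc4 : 4 * be <= r%:R * c4.
  rewrite -ler_pdivrMr//; apply: le_trans (ltW (truncnS_gt _)) _.
  by rewrite ler_nat !leq_max leqnn !orbT.
have rq : ((1 + q) / 2) ^+ r * (144 * be) <= sg * c2 * c4.
  by rewrite -ler_pdivlMr ?mulr_gt0// hr0// leq_maxl.
pose lam := 3 / 4 * (be - 1); have lam0 : 0 < lam by rewrite mulr_gt0 ?divr_gt0.
pose kap := Num.min ((be - 1) / 16) (Num.min (c2 / 2) 2^-1).
have k0 : 0 < kap by rewrite /kap !lt_min !divr_gt0// invr_gt0 ltr0n.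
have ka : kap <= (be - 1) / 16 by rewrite /kap ge_min lexx.
have kc : kap <= c2 / 2 by rewrite /kap !ge_min lexx !orbT.
have k2 : kap <= 2^-1 by rewrite /kap !ge_min lexx !orbT.
pose M6 := 300 * (be + r%:R / lam) ^+ 6.
have M60 : 0 < M6 by rewrite mulr_gt0// exprn_gt0// addr_gt0// divr_gt0.
pose T6 := 16 * r%:R ^+ 2 + r%:R + 10 : R.
have T60 : 0 < T6 by have := sqr_ge0 (r%:R : R); rewrite /T6; clear -rp; lra.
pose t1 := 8 * be ^+ 2; pose t3 := M6 / (be - 1); pose t6 := T6 ^+ 2 * lam / r%:R.
pose t7 := 9 * r%:R / (sg * c2) * (32 * be / (be - 1)) /
  ((sg / 2) ^+ 4 * (lam / r%:R) ^+ 2).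
pose t5 := 2 * r%:R / sg; pose t2 := 4 * be / c2.
pose t4 := (10 + 2 * r%:R * (1 + 2 * be)) / (c1 * eta ^+ 2).
have t10 : 0 <= t1 by rewrite mulr_ge0// sqr_ge0.
have t30 : 0 <= t3 by rewrite divr_ge0 ?ltW.
have t60 : 0 <= t6 by apply: divr_ge0 (ltW rp); exact: mulr_ge0 (sqr_ge0 _) (ltW lam0).
have t50 : 0 <= t5 by apply: divr_ge0 (ltW sg0); rewrite mulr_ge0.
have t20 : 0 <= t2 by apply: divr_ge0 (ltW c2p); rewrite mulr_ge0 ?(ltW be0).
have d40 : 0 < c1 * eta ^+ 2 by rewrite mulr_gt0 ?exprn_gt0.
have d70 : 0 < (sg / 2) ^+ 4 * (lam / r%:R) ^+ 2.
  by rewrite mulr_gt0 ?exprn_gt0 ?divr_gt0.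
have t40 : 0 <= t4.
  apply: divr_ge0 (ltW d40); have : 0 <= r%:R * (1 + 2 * be) by rewrite mulr_ge0//; clear -be0; lra.
  by clear; lra.
have t70 : 0 <= t7.
  apply: divr_ge0 (ltW d70); apply: mulr_ge0; apply: divr_ge0; rewrite ?(ltW al0)//.
  - by rewrite mulr_ge0.
  - exact: mulr_ge0 (ltW sg0) (ltW c2p).
  - by rewrite mulr_ge0 ?(ltW be0).
(* All thresholds are nonnegative, so a bound by their sum enforces each of them. *)
pose T := M6 + t1 + t2 + t3 + t4 + t5 + t6 + t7.
exists kap, ((1 + expR (r%:R / 2)) * 2 ^+ r), r, (Num.truncn T).+2; split=> //.
  by rewrite mulr_gt0 ?exprn_gt0// addr_gt0 ?expR_gt0.
move=> n nn; split; first exact: leq_trans nn.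
have n_gt0 : (0 < n)%N := ltn_trans (ltn0Sn _) nn.
have Tn : T <= n%:R.
  apply: le_trans (ltW (truncnS_gt _)) _; rewrite ler_nat; exact: ltnW.
have [bM [b1 [b2' [b3' [b4 [b5 [b6 b7]]]]]]] : M6 <= n%:R /\ t1 <= n%:R /\ t2 <= n%:R /\
    t3 <= n%:R /\ t4 <= n%:R /\ t5 <= n%:R /\ t6 <= n%:R /\ t7 <= n%:R.
  clear -Tn M60 t10 t20 t30 t40 t50 t60 t70; clearbody M6 t1 t2 t3 t4 t5 t6 t7.
  by rewrite /T in Tn; do ![split]; lra.
have n1 : 8 * be ^+ 2 <= n%:R by exact: b1.
have n3 : 300 * (be + r%:R / (3 / 4 * (be - 1))) ^+ 6 <= n%:R.
  by rewrite -/lam -/M6.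
have n3' : 300 * (be + r%:R / (3 / 4 * (be - 1))) ^+ 6 <= (be - 1) * n%:R.
  by rewrite -/lam -/M6 mulrC -ler_pdivrMr// -/t3.
have n6 : 16 * r%:R ^+ 2 + r%:R + 10 <= switch_scale be r n.
  rewrite -(@ler_pXn2r _ 2)// ?nnegrE ?switch_scale_ge0 ?(ltW T60)//.
  by rewrite switch_scale_sqr// -/T6 -/lam mulrA ler_pdivlMr// -ler_pdivrMr// -/t6.
have n7 : 9 * r%:R / (sg * c2) * (32 * be / (be - 1)) <=
    (sg / 2) ^+ 4 * (3 / 4 * (be - 1) / r%:R) ^+ 2 * n%:R.
  by rewrite -/lam [leRHS]mulrC -ler_pdivrMr// -/t7.
have n5 : 2 * r%:R <= sg * n%:R.
  by rewrite [leRHS]mulrC -ler_pdivrMr// -/t5.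
have n2 : 4 * be <= c2 * n%:R.
  by rewrite [leRHS]mulrC -ler_pdivrMr// -/t2.
have n4 : 10 + 2 * r%:R * (1 + 2 * be) <= c1 * eta ^+ 2 * n%:R.
  by rewrite [leRHS]mulrC -ler_pdivrMr// -/t4.
exists (edge_weight be sg c2 r n); split.
- move=> k nk; rewrite /edge_weight addr_gt0//.
    by apply: well_weight_gt0.
  by apply: floor_weight_gt0.
- by move=> k l nk nl; apply: edge_weight_ratio.
- by move=> k kn; apply: edge_weight_odd.
- by move=> k kn; apply: edge_weight_even.
- by move=> k nk kn; apply: (@edge_weight_super _ be sg c1 c2 c4 q tau eta).
Qed.

End WeightExists.

(** * Upper bound *)

Section LevelWeight.
Variables (R : realType) (be : R) (n : nat).
Hypothesis n_gt0 : (0 < n)%N.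
Local Notation h := (n%:R^-1 : R).
Local Notation s k := (edge_pos R n k * h).

Definition conj_weight (V : nat -> R) k : R :=
  cosh (be * (edge_pos R n k * n%:R^-1)) * V k.

(** The denominator of the rate at level [k.+1] is [2 cosh] of the field at edge [k.+1], which is
    exactly the factor carried by the weight of that edge. *)
Lemma up_rate_gain (V : nat -> R) k :
  up_rate be n k.+1 * (cosh (be * s k.+1) * V k.+1) = edge_gain be h (s k) / 2 * V k.+1.
Proof.
have n0 : n%:R != 0 :> R by rewrite pnatr_eq0 -lt0n.
rewrite /up_rate p_plusE -/(edge_pos R n k.+1) /edge_gain /cosh.
have -> : be * s k.+1 = 2 * be * h + be * s k by rewrite edge_posS; field.
set E := expR _ + expR _.
have E0 : E != 0 by rewrite gt_eqF// addr_gt0 ?expR_gt0.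
by rewrite expRD /edge_pos -natr1; field; rewrite n0 E0.
Qed.

Lemma down_rate_loss (V : nat -> R) k : (0 < k)%N ->
  down_rate be n k * (cosh (be * s k.-1) * V k.-1) = edge_loss be h (s k) / 2 * V k.-1.
Proof.
move=> k0; have n0 : n%:R != 0 :> R by rewrite pnatr_eq0 -lt0n.
rewrite /down_rate p_plus_compl.
have -> : (2 * k%:R - 1 - n%:R) / n%:R = s k.-1 by rewrite edge_posP// /edge_pos; field.
rewrite /edge_loss /cosh.
set E := expR _ + expR _.
have E0 : E != 0 by rewrite gt_eqF// addr_gt0 ?expR_gt0.
have -> : expR (- (be * s k.-1)) = expR (2 * be * h) * expR (- (be * s k)).
  by rewrite -expRD edge_posP//; congr expR; field.
by rewrite /edge_pos; field; rewrite n0 E0.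
Qed.

Lemma rates_diag k :
  (up_rate be n k + down_rate be n k.+1) * cosh (be * s k) = edge_diag be h (s k) / 2.
Proof.
have n0 : n%:R != 0 :> R by rewrite pnatr_eq0 -lt0n.
rewrite /up_rate /down_rate p_plus_compl p_plusE -/(edge_pos R n k).
have -> : 2 * k.+1%:R - 1 - n%:R = edge_pos R n k by rewrite /edge_pos -natr1; ring.
rewrite /edge_diag /cosh /sinh; set E := expR _ + expR _.
have E0 : E != 0 by rewrite gt_eqF// addr_gt0 ?expR_gt0.
by rewrite /E in E0 *; rewrite /edge_pos -natr1; field; rewrite n0 E0.
Qed.

Lemma edge_super_level (V : nat -> R) kap k : (0 < k)%N ->
    edge_gain be h (s k) * V k.+1 + edge_loss be h (s k) * V k.-1 <=
      (edge_diag be h (s k) - 2 * kap * h * cosh (be * s k)) * V k ->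
  (1 - up_rate be n k - down_rate be n k.+1) * conj_weight V k
    + up_rate be n k.+1 * conj_weight V k.+1
    + down_rate be n k * conj_weight V k.-1 <= (1 - kap * h) * conj_weight V k.
Proof.
move=> k0 H; rewrite /conj_weight up_rate_gain down_rate_loss//.
have := rates_diag k => D.
have -> : (1 - up_rate be n k - down_rate be n k.+1) * (cosh (be * s k) * V k) =
  cosh (be * s k) * V k - edge_diag be h (s k) / 2 * V k by rewrite -D; ring.
lra.
Qed.

End LevelWeight.

Section UpperBound.
Variables (R : realType) (be : R).
Hypothesis be_gt1 : 1 < be.

Lemma ln_ge_half n : (1 < n)%N -> 2^-1 <= ln n%:R :> R.
Proof.
move=> n1; rewrite -ler_expR lnK ?posrE ?ltr0n 1?ltnW//.
have e : expR 2^-1 <= 2 :> R.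
  apply: le_trans (expR_le_quad _) _; first by rewrite lexx invr_ge0 ler0n.
  by rewrite exprVn; lra.
by apply: le_trans e _; rewrite ler_nat.
Qed.

Lemma expn_decay (n m t : nat) (a D : R) : (1 < n)%N -> 0 <= 1 - a / n%:R ->
    m%:R <= a * D -> 0 <= a -> D * (n%:R * ln n%:R) <= t%:R ->
  (1 - a / n%:R) ^+ t <= n%:R ^- m.
Proof.
move=> n1 a1 mD a0 tD.
have n0 : 0 < n%:R :> R by rewrite ltr0n ltnW.
have ln0 : 0 <= ln n%:R :> R by apply: le_trans (ln_ge_half n1); rewrite invr_ge0.
apply: (@le_trans _ _ (expR (- (a / n%:R)) ^+ t)).
  by rewrite lerXn2r ?nnegrE ?expR_ge0// expR_ge1Dx.
rewrite -[X in _ <= X ^- _](lnK (_ : n%:R \is Num.pos)) ?posrE//.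
rewrite -!expRM_natl -expRN ler_expR mulrN lerN2.
have h1 := ler_wpM2l a0 tD.
have h2 := ler_wpM2r ln0 mD.
apply: le_trans h2 _.
have -> : t%:R * (a / n%:R) = a * t%:R / n%:R by ring.
by rewrite ler_pdivlMr//; apply: le_trans h1; apply: eq_ler; ring.
Qed.

Local Notation K n := (@glauber_plus R be n).

Lemma iter_expect_close n t (f g : config_plus R n -> R) (d : R) : (0 < n)%N ->
    (forall x, `|f x - g x| <= d) ->
  forall x, `|iter t (expect (K n)) f x - iter t (expect (K n)) g x| <= d.
Proof.
move=> n0 fg x; have be0 : 0 <= be by have := be_gt1; lra.
have G0 := glauber_plus_ge0 be0 n0; have G1 := glauber_plus_sum1 be n0.
have h1 := @le_iter_expect _ _ _ G0 t f (fun y => 1 * g y + d) x.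
have h2 := @le_iter_expect _ _ _ G0 t (fun y => 1 * g y + - d) f x.
rewrite !(iter_expect_affine G1) !mul1r in h1 h2.
have fgd y : g y - d <= f y <= g y + d.
  have := fg y; rewrite ler_norml => /andP[a b]; apply/andP; split; lra.
have {}h1 := h1 (fun y => ltac:(rewrite mul1r; by have /andP[_ a] := fgd y)).
have {}h2 := h2 (fun y => ltac:(rewrite mul1r; by have /andP[a _] := fgd y)).
by rewrite ler_norml; apply/andP; split; lra.
Qed.

(* First the swap contraction turns the test function into a function of the
   number of pluses up to a small error, then the level contraction applies. *)
Lemma glauber_plus_osc (kap M : R) (d n t : nat) (V : nat -> R) :
    (1 < n)%N -> 0 < kap -> kap <= 2^-1 -> 0 < M ->
    (forall k, (n <= k.*2)%N -> 0 < V k) ->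
    (forall k l, (n <= k.*2)%N -> (n <= l.*2)%N -> V k <= M * n%:R ^+ d * V l) ->
    (forall k, k.*2.+1 = n -> 0 <= V k) ->
    (forall k, k.*2 = n -> - V k <= V k.-1) ->
    (forall k, (n <= k.*2)%N -> (k < n)%N ->
      let h := n%:R^-1 in let s := edge_pos R n k * h in
      edge_gain be h s * V k.+1 + edge_loss be h s * V k.-1 <=
      (edge_diag be h s - 2 * kap * h * cosh (be * s)) * V k) ->
  forall (f : config_plus R n -> R), (forall x, 0 <= f x <= 1) -> forall x y,
  `|iter (t + t) (expect (K n)) f x - iter (t + t) (expect (K n)) f y| <=
  2 * (n%:R * (1 - 2 * min_rate be / n%:R) ^+ t)
  + n%:R * ((1 - kap / n%:R) ^+ t * (M * n%:R ^+ d) * (cosh be * (M * n%:R ^+ d))).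
Proof.
move=> n1 kap0 kap2 M0 V0 VM Vodd Veven Vsuper f f01 x y.
have n0 : (0 < n)%N := ltnW n1.
have be0 : 0 <= be by have := be_gt1; lra.
have N0 : 0 < n%:R :> R by rewrite ltr0n.
set rho := 1 - 2 * min_rate be / n%:R; have rho0 : 0 <= rho := min_rate_contraction be0 n0.
set f1 := iter t (expect (K n)) f.
have f1L : swap_lipschitz (rho ^+ t) f1.
  rewrite /f1; clear f1; elim: t => [|u IH].
    move=> a b i j _ /=; rewrite expr0 ler_norml.
    by have /andP[a0 a1] := f01 a; have /andP[b0 b1] := f01 b; apply/andP; split; lra.
  rewrite iterS exprS; by have := swap_contraction be0 n0 IH.
have f1b a : 0 <= f1 a <= 1.
  apply: iter_expect_bounds => //; first exact: glauber_plus_ge0.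
  exact: glauber_plus_sum1.
set dl := n%:R * rho ^+ t.
(* Any representative of a level will do, as [f1] varies by at most [dl] on it; empty levels get
   0. *)
pose g k : R := if [pick a : config_plus R n | nplus (val a) == k] is Some a then f1 a else 0.
have gb k : 0 <= g k <= 1 by rewrite /g; case: pickP => [a _|_]; rewrite ?f1b// lexx ler01.
have fg a : `|f1 a - g (nplus (val a))| <= dl.
  rewrite /g; case: pickP => [b /eqP ba|/(_ a)]; last by rewrite eqxx.
  by apply: swap_lipschitz_level f1L _; rewrite ?exprn_ge0.
have close := iter_expect_close t n0 fg.
rewrite !iterD -/f1.
have cx := close x; have cy := close y; rewrite !iter_expect_level// in cx cy.
pose s k : R := edge_pos R n k * n%:R^-1.
pose U := conj_weight be n V.
have Mn : 0 < M * n%:R ^+ d by rewrite mulr_gt0 ?exprn_gt0.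
have nn : (n <= n.*2)%N by rewrite -addnn leq_addr.
(* Scaled so that [e * U] is at least 1 on every edge, while increments of [g] are at most 1. *)
pose e := M * n%:R ^+ d / V n.
have e0 : 0 <= e by rewrite divr_ge0 ?(ltW Mn) ?(ltW (V0 _ nn)).
have gU : level_lipschitz n (fun k => e * U k) g.
  move=> k nk kn; apply: (@le_trans _ _ 1).
    have /andP[a0 a1] := gb k; have /andP[b0 b1] := gb k.+1.
    by rewrite ler_norml; apply/andP; split; lra.
  have VU : V k <= U k by rewrite /U /conj_weight ler_peMl ?cosh_ge1// ltW// V0.
  apply: le_trans (ler_wpM2l e0 VU).
  by rewrite /e mulrAC ler_pdivlMr ?V0// mul1r VM.
have kn0 k : (n <= k.*2)%N -> (0 < k)%N.
  by rewrite lt0n => nk; apply: contraTneq nk => ->; rewrite -ltnNge.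
have c0 : 0 <= 1 - kap / n%:R.
  have N1 : 1 <= n%:R :> R by rewrite ler1n.
  by rewrite subr_ge0 ler_pdivrMr// mul1r; lra.
have L := @iter_level_step_lipschitz _ be n be0 n0 U (1 - kap / n%:R) n1 _ _ _ c0 t e g e0 gU.
have {}L : level_lipschitz n (fun k => (1 - kap / n%:R) ^+ t * e * U k)
    (iter t (level_step be n) g).
  apply: L.
  - by move=> k kn; rewrite mulr_ge0 ?Vodd// ltW ?cosh_gt0.
  - move=> k kn; have nk : (n <= k.*2)%N by rewrite kn.
    have nE : n%:R = 2 * k%:R :> R by rewrite -kn -muln2 natrM mulrC.
    have sE : s k.-1 = - s k.
      by rewrite /s edge_posP ?kn0// /edge_pos nE; ring.
    by rewrite /U /conj_weight -!/(s _) sE mulrN coshN -mulrN ler_wpM2l ?Veven// ltW// cosh_gt0.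
  - move=> k nk kn; apply: edge_super_level => //; first exact: kn0.
    exact: Vsuper.
set B := (1 - kap / n%:R) ^+ t * (M * n%:R ^+ d) * (cosh be * (M * n%:R ^+ d)).
have ct0 : 0 <= (1 - kap / n%:R) ^+ t by rewrite exprn_ge0.
have LB : level_lipschitz n (fun=> B) (iter t (level_step be n) g).
  move=> k nk kn; apply: le_trans (L k nk kn) _.
  rewrite -[leLHS]mulrA /B -[leRHS]mulrA; apply: ler_wpM2l => //.
  have s01 : 0 <= be * s k <= be.
    have y1 := @edge_pos_ge1 R n k nk.
    have sk0 : 0 <= s k by rewrite mulr_ge0 ?invr_ge0//; lra.
    rewrite mulr_ge0//= ler_piMr//.
    have : s k <= 1 - n%:R^-1 by have := @edge_pos_range R n n0 k kn; rewrite /s; lra.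
    by move/le_trans; apply; rewrite gerBl invr_ge0.
  have Ub : U k <= cosh be * (M * n%:R ^+ d * V n).
    by apply: ler_pM; rewrite ?le_cosh ?VM// ltW ?cosh_gt0 ?V0.
  apply: le_trans (ler_wpM2l e0 Ub) _.
  by rewrite /e; apply: eq_ler; field; rewrite gt_eqF ?V0.
have B0 : 0 <= B.
  apply: mulr_ge0; first exact: mulr_ge0 ct0 (ltW Mn).
  by apply: mulr_ge0 (ltW Mn); rewrite ltW// cosh_gt0.
have osc k l : (n <= k.*2)%N -> (n <= l.*2)%N -> (k <= n)%N -> (l <= n)%N ->
    `|iter t (level_step be n) g k - iter t (level_step be n) g l| <= n%:R * B.
  move=> nk nl kn ln; have [kl|/ltnW lk] := leqP k l.
    by rewrite distrC; apply: level_lipschitz_osc => //; rewrite kl.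
  by apply: level_lipschitz_osc => //; rewrite lk.
have := osc _ _ (nplus_ge x) (nplus_ge y) (nplus_le _) (nplus_le _).
move: cx cy; rewrite !ler_norml => /andP[a1 a2] /andP[b1 b2] /andP[d1 d2].
by apply/andP; split; lra.
Qed.

End UpperBound.

Section MixingUpper.
Variables (R : realType) (be : R).
Hypothesis be_gt1 : 1 < be.
Local Notation K n := (@glauber_plus R be n).

Lemma mixing_upper_large : exists (C : R) (n0 : nat), 0 < C /\
  forall n, (n0 <= n)%N -> exists T : nat,
    worst_tv (K n) T <= 4^-1 /\ T%:R <= C * (n%:R * ln n%:R).
Proof.
have be0 : 0 <= be by have := be_gt1; lra.
have [kap [M [d [n0 [kap0 kap2 M0 hV]]]]] := weight_exists be_gt1.
have q0 := min_rate_gt0 be; set q := min_rate be in q0.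
(* The level error carries [n] times two weight ratios [n^d], so a decay [n^-(2 d + 2)] leaves
   [1 / n]; the term [q^-1] makes the exchange factor at most [n^-2], which with its factor [n] also
   leaves [1 / n]. *)
pose D := (2 * d + 2)%:R / kap + q^-1.
have d2 : 0 < (2 * d + 2)%:R :> R by rewrite ltr0n addn2.
have D0 : 0 < D by apply: addr_gt0; [exact: divr_gt0 | rewrite invr_gt0].
have kD : (2 * d + 2)%:R <= kap * D.
  have -> : kap * D = (2 * d + 2)%:R + kap / q by rewrite /D; field; rewrite !gt_eqF.
  by rewrite lerDl divr_ge0 ?ltW.
have qD : 2%:R <= (2 * q) * D.
  have -> : 2 * q * D = 2 * q * ((2 * d + 2)%:R / kap) + 2.
    by rewrite /D; field; rewrite !gt_eqF.
  rewrite lerDr; apply: mulr_ge0; first by rewrite mulr_ge0 ?(ltW q0).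
  exact: divr_ge0 (ltW d2) (ltW kap0).
(* For [n >= L] the two error terms are at most [1 / 8] each. *)
pose L := 16 + 8 * (M ^+ 2 * cosh be).
have Mc0 : 0 <= M ^+ 2 * cosh be by rewrite mulr_ge0 ?sqr_ge0 ?ltW ?cosh_gt0.
exists (2 * D + 2), (maxn n0 (Num.truncn L).+1); split; first by rewrite addr_gt0 ?mulr_gt0.
move=> n; rewrite geq_max => /andP[nn0 nL].
have [n1 [V [V0 VM Vodd Veven Vsuper]]] := hV n nn0.
have n_gt0 : (0 < n)%N := ltnW n1.
have N0 : 0 < n%:R :> R by rewrite ltr0n.
have Ln : L <= n%:R.
  by apply: le_trans (ltW (truncnS_gt _)) _; rewrite ler_nat.
have ln2 := @ln_ge_half R n n1.
have N2 : 2 <= n%:R :> R by rewrite ler_nat.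
have nln : 1 <= n%:R * ln n%:R :> R.
  have i0 : 0 <= 2^-1 :> R by rewrite invr_ge0.
  by have := ler_pM (ler0n R 2) i0 N2 ln2; rewrite divff ?pnatr_eq0.
set x := n%:R * ln n%:R in nln.
pose t := (Num.truncn (D * x)).+1.
have tge : D * x <= t%:R by rewrite ltW// truncnS_gt.
have tle : t%:R <= D * x + 1.
  by rewrite /t -natr1 lerD2r truncn_le mulr_ge0 ?ltW// (lt_le_trans ltr01).
exists (t + t)%N; split; last by rewrite natrD -/x; lra.
apply: le_worst_tv; rewrite ?invr_ge0 ?ler0n//.
- exact: glauber_plus_stationary.
move=> A a b.
have f01 y : 0 <= ((y \in A)%:R : R) <= 1 by case: (y \in A); rewrite ?lexx ?ler01.
have H := glauber_plus_osc be_gt1 t n1 kap0 kap2 M0 V0 VM Vodd Veven Vsuper f01 a b.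
apply: le_trans H _.
have c0 : 0 <= 1 - kap / n%:R by rewrite subr_ge0 ler_pdivrMr// mul1r; lra.
have e1 := expn_decay n1 (min_rate_contraction be0 n_gt0) qD (_ : 0 <= 2 * q) tge.
have {e1} e1 := e1 (ltac:(by rewrite mulr_ge0 ?ltW)).
have e2 := expn_decay n1 c0 kD (ltW kap0) tge.
have b1 : n%:R * (1 - 2 * q / n%:R) ^+ t <= n%:R^-1.
  apply: le_trans (ler_wpM2l (ltW N0) e1) _.
  by apply: eq_ler; field; rewrite gt_eqF.
have b2 : n%:R * ((1 - kap / n%:R) ^+ t * (M * n%:R ^+ d) * (cosh be * (M * n%:R ^+ d)))
    <= (M ^+ 2 * cosh be) * n%:R^-1.
  have P0 : 0 <= (M ^+ 2 * cosh be) * (n%:R * n%:R ^+ d * n%:R ^+ d).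
    by rewrite mulr_ge0// !mulr_ge0 ?exprn_ge0.
  have -> : n%:R * ((1 - kap / n%:R) ^+ t * (M * n%:R ^+ d) * (cosh be * (M * n%:R ^+ d))) =
    (M ^+ 2 * cosh be) * (n%:R * n%:R ^+ d * n%:R ^+ d) * (1 - kap / n%:R) ^+ t.
    by move: (_ ^+ t) => u; ring.
  apply: le_trans (ler_wpM2l P0 e2) _; rewrite -[leLHS]mulrA ler_wpM2l//.
  rewrite mul2n -addnn exprD exprD.
  have nd : n%:R ^+ d != 0 :> R by rewrite expf_neq0 ?gt_eqF.
  by apply: eq_ler; field; rewrite nd gt_eqF.
have L16 : 16 <= n%:R :> R by clear -Ln Mc0; rewrite /L in Ln; lra.
have L8 : 8 * (M ^+ 2 * cosh be) <= n%:R by clear -Ln Mc0; rewrite /L in Ln; lra.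
have ni : n%:R^-1 <= 16^-1 :> R by rewrite lef_pV2 // posrE.
have mi : (M ^+ 2 * cosh be) * n%:R^-1 <= 8^-1.
  by rewrite ler_pdivrMr// ler_pdivlMl.
apply: le_trans (lerD (ler_wpM2l (ler0n R 2) b1) b2) _.
clear -ni mi; lra.
Qed.

Lemma mixing_upper_small m : exists B : nat, forall n, (0 < n < m)%N ->
  exists T : nat, worst_tv (K n) T <= 4^-1 /\ (T <= B)%N.
Proof.
have be0 : 0 <= be by have := be_gt1; lra.
elim: m => [|m [B IH]]; first by exists 0%N => n; rewrite ltn0 andbF.
have [m0|m0] := posnP m.
  by exists 0%N => n; rewrite m0 ltnS andbC => /andP[]; case: n.
have [T0 hT0] := glauber_plus_mixes be0 m0.
exists (maxn B T0) => n /andP[n0]; rewrite ltnS leq_eqVlt => /orP[/eqP ->|nm].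
  by exists T0; rewrite leq_maxr.
have [|T [hT TB]] := IH n; first by rewrite n0.
by exists T; rewrite leq_max TB.
Qed.

(** For [n = 1] the bound [n ln n] is 0, so mixing is required at time 0; it holds because there is
    a single state. *)
Lemma config_plus1 (x y : config_plus R 1) : x = y.
Proof.
have h (z : config_plus R 1) : val z = [ffun=> true].
  apply/ffunP => i; rewrite ord1 ffunE.
  by have := nplus_ge z; rewrite /nplus big_ord1; case: (val z ord0).
by apply: val_inj; rewrite !h.
Qed.

Lemma mixing_upper : exists2 C : R, 0 < C & forall n, (0 < n)%N ->
  exists T : nat, worst_tv (K n) T <= 4^-1 /\ T%:R <= C * (n%:R * ln n%:R).
Proof.
have be0 : 0 <= be by have := be_gt1; lra.
have [C [n0 [C0 large]]] := mixing_upper_large.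
have [B small] := mixing_upper_small n0.
exists (C + B%:R) => [|n n_gt0]; first by rewrite ltr_wpDr.
have [n1|n1] := leqP n 1.
  have {n1 n_gt0} -> : n = 1%N by lia.
  exists 0%N; rewrite ln1 !mulr0; split=> //.
  apply: le_worst_tv; rewrite ?invr_ge0 ?ler0n//.
  - exact: glauber_plus_stationary.
  - by move=> A x y; rewrite (config_plus1 x y) subrr normr0 invr_ge0.
have ln2 := @ln_ge_half R n n1.
have N2 : 2 <= n%:R :> R by rewrite ler_nat.
have nln : 1 <= n%:R * ln n%:R :> R.
  have i0 : 0 <= 2^-1 :> R by rewrite invr_ge0.
  by have := ler_pM (ler0n R 2) i0 N2 ln2; rewrite divff ?pnatr_eq0.
have [nn|nn] := leqP n0 n.
  have [T [hT TC]] := large n nn; exists T; split=> //.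
  apply: le_trans TC _; rewrite mulrDl lerDl mulr_ge0// (le_trans ler01)//.
have [|T [hT TB]] := small n; first by rewrite n_gt0.
exists T; split=> //; rewrite mulrDl.
have h1 : T%:R <= B%:R :> R by rewrite ler_nat.
have h2 := ler_wpM2l (ler0n R B) nln; rewrite mulr1 in h2.
have h3 : 0 <= C * (n%:R * ln n%:R) by rewrite mulr_ge0 ?(ltW C0)// (le_trans ler01).
lra.
Qed.

End MixingUpper.

(** * Lower bound *)

Section Statistic.
Variables (R : realType) (be : R) (n : nat) (a : 'I_n -> R).
Hypothesis be_ge0 : 0 <= be.
Hypothesis n_gt0 : (0 < n)%N.
Hypothesis a_le1 : forall i, `|a i| <= 1.
Hypothesis a_sum0 : \sum_i a i = 0.
Local Notation K := (@glauber_plus R be n).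
Implicit Types (s : config n) (x : config_plus R n).

Definition stat s : R := \sum_i a i * spin R s i.

Lemma stat_opp s : stat (opp_config s) = - stat s.
Proof.
rewrite /stat -sumrN; apply: eq_bigr => i _.
by rewrite /spin ffunE; case: (s i); rewrite ?mulrN ?mulr1 ?mulrN1 ?opprK.
Qed.

Lemma stat_set s i b : stat (set_spin s i b) =
  stat s + a i * ((if b then 1 else -1) - spin R s i).
Proof.
rewrite /stat (bigD1 i)//= [in RHS](bigD1 i)//=.
rewrite (eq_bigr (fun j => a j * spin R s j)); last first.
  by move=> j /negPf ji; rewrite /spin ffunE ji.
by rewrite /spin ffunE eqxx mulrBr [RHS]addrAC subrKC.
Qed.

Lemma stat_bound s : `|stat s| <= n%:R.
Proof.
apply: le_trans (ler_norm_sum _ _ _) _.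
have -> : n%:R = \sum_(i < n) 1 :> R by rewrite sumr_const card_ord.
apply: ler_sum => i _; rewrite normrM.
have -> : `|spin R s i| = 1 by rewrite /spin; case: (s i); rewrite ?normrN normr1.
by rewrite mulr1.
Qed.

Lemma expect_even (H : config n -> R) x : (forall s, H (opp_config s) = H s) ->
  expect K (fun y => H (val y)) x = glauber_mean be H (val x).
Proof.
move=> Hopp; rewrite expect_glauberE; apply: eq_bigr => i _.
by congr (_ * (_ * _ + _ * _)); rewrite /= /fold_config; case: ifP.
Qed.

(** Minus sites see [magn + 1 / n] and plus sites [magn - 1 / n]. This difference is all that keeps
    [stat] from being an exact eigenfunction before folding. *)
Definition field_slope s : R :=
  p_plus be (magn R s + n%:R^-1) - p_plus be (magn R s - n%:R^-1).

Lemma p_plus_lipschitz (u d : R) : 0 <= d ->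
  0 <= p_plus be (u + d) - p_plus be u <= 2 * be * d.
Proof.
move=> d0; have bd0 : 0 <= be * d by rewrite mulr_ge0.
have pE z : p_plus be z = (1 + expR (- (2 * be * z)))^-1.
  rewrite p_plusE.
  have -> : - (2 * be * z) = - (be * z) + - (be * z) by ring.
  rewrite expRD expRN; have e0 := expR_gt0 (be * z).
  have -> : expR (be * z) + (expR (be * z))^-1 =
      expR (be * z) * (1 + (expR (be * z))^-1 * (expR (be * z))^-1).
    by field; rewrite gt_eqF.
  by rewrite invfM mulrA divff ?mul1r// gt_eqF.
have E : expR (- (2 * be * (u + d))) = expR (- (2 * be * u)) * expR (- (2 * be * d)).
  by rewrite -expRD; congr expR; ring.
rewrite !pE E; set v := expR (- (2 * be * u)); set w := expR _.
have v0 : 0 < v := expR_gt0 _; have w0 : 0 < w := expR_gt0 _.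
have w1 : w <= 1 by rewrite -[leRHS]expR0 ler_expR oppr_le0 -mulrA mulr_ge0.
have w2 : 1 - w <= 2 * be * d by have := expR_ge1Dx (- (2 * be * d)); rewrite -/w; lra.
have vw : 0 < v * w by rewrite mulr_gt0.
have -> : (1 + v * w)^-1 - (1 + v)^-1 = v / ((1 + v * w) * (1 + v)) * (1 - w).
  by field; rewrite !gt_eqF// addr_gt0.
have f0 : 0 <= v / ((1 + v * w) * (1 + v)).
  by rewrite divr_ge0 ?(ltW v0)// mulr_ge0//; lra.
have f1 : v / ((1 + v * w) * (1 + v)) <= 1.
  rewrite ler_pdivrMr ?mul1r; last by rewrite mulr_gt0//; lra.
  by have := mulr_gt0 vw v0; lra.
apply/andP; split; first by rewrite mulr_ge0// subr_ge0.
by apply: le_trans w2; rewrite ler_piMl// subr_ge0.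
Qed.

Lemma field_slope_bound s : 0 <= field_slope s <= 4 * be / n%:R.
Proof.
have h0 : 0 <= 2 / n%:R :> R by rewrite divr_ge0.
have := p_plus_lipschitz (magn R s - n%:R^-1) h0.
have -> : magn R s - n%:R^-1 + 2 / n%:R = magn R s + n%:R^-1 by field; rewrite pnatr_eq0 -lt0n.
have -> : 2 * be * (2 / n%:R) = 4 * be / n%:R by ring.
by [].
Qed.

Definition site_drift s i : R := 2 * site_prob be s i - 1 - spin R s i.

(** The update bias is affine in the spin, [c - field_slope s * spin], and the part [c] common to
    all sites disappears because the [a i] sum to 0. *)
Lemma stat_drift s : \sum_i a i * site_drift s i = - (1 + field_slope s) * stat s.
Proof.
pose c := p_plus be (magn R s + n%:R^-1) + p_plus be (magn R s - n%:R^-1) - 1.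
transitivity (\sum_i (c * a i - (1 + field_slope s) * (a i * spin R s i))).
  apply: eq_bigr => i _; rewrite /site_drift /site_prob /c /field_slope /spin.
  case: (s i); rewrite ?mulN1r ?mul1r ?opprK; ring.
by rewrite sumrB -!mulr_sumr a_sum0 mulr0 sub0r mulNr.
Qed.

Lemma site_prob_bounds s i : 0 <= site_prob be s i <= 1.
Proof.
have := site_prob_ge0 be_ge0 n_gt0 s i; have := site_prob_compl_ge0 be_ge0 n_gt0 s i.
by rewrite subr_ge0 => -> ->.
Qed.

Lemma glauber_mean_add (c : R) (G : 'I_n -> R) :
  \sum_(i < n) n%:R^-1 * (c + G i) = c + n%:R^-1 * \sum_i G i.
Proof.
rewrite -mulr_sumr big_split sumr_const card_ord mulrDr -[c *+ n]mulr_natl mulrA.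
by rewrite mulVf ?mul1r// pnatr_eq0 -lt0n.
Qed.

Lemma stat_sqr_mean s :
  exists2 v, 0 <= v <= 4 &
  glauber_mean be (fun s => stat s ^+ 2) s =
  (1 - 2 * (1 + field_slope s) / n%:R) * stat s ^+ 2 + v.
Proof.
pose v i := a i ^+ 2 * (2 - 2 * spin R s i * (2 * site_prob be s i - 1)).
have n0 : n%:R != 0 :> R by rewrite pnatr_eq0 -lt0n.
exists (n%:R^-1 * \sum_i v i).
  have vb i : 0 <= v i <= 4.
    have /andP[p0 p1] := site_prob_bounds s i.
    have a2 : 0 <= a i ^+ 2 <= 1.
      by rewrite sqr_ge0/= -(real_normK (num_real (a i))) expr_le1 ?normr_ge0// a_le1.
    have : 0 <= 2 - 2 * spin R s i * (2 * site_prob be s i - 1) <= 4.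
      by rewrite /spin; case: (s i); apply/andP; split; lra.
    move: a2; rewrite /v => /andP[a0 a1] /andP[b0 b1].
    rewrite mulr_ge0//=; apply: le_trans (ler_pM a0 b0 a1 b1) _; lra.
  have N0 : 0 < n%:R :> R by rewrite ltr0n.
  rewrite mulr_ge0 ?invr_ge0 ?sumr_ge0//=; last by move=> i _; have /andP[] := vb i.
  rewrite ler_pdivrMl//; have -> : n%:R * 4 = \sum_(i < n) 4 :> R.
    by rewrite sumr_const card_ord mulr_natl.
  by apply: ler_sum => i _; have /andP[] := vb i.
transitivity (\sum_(i < n) n%:R^-1 *
    (stat s ^+ 2 + (2 * stat s * (a i * site_drift s i) + v i))).
  apply: eq_bigr => i _; congr (_ * _); rewrite /update_mean !stat_set /v /site_drift.
  have : spin R s i ^+ 2 = 1 by rewrite /spin; case: (s i); rewrite ?sqrrN expr1n.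
  by move: (spin R s i) (site_prob be s i) => y p y2; ring: y2.
rewrite glauber_mean_add big_split -mulr_sumr stat_drift /=; field.
exact: n0.
Qed.

Lemma stat_quart_mean s :
  glauber_mean be (fun s => stat s ^+ 4) s <=
  (1 - 4 / n%:R) * stat s ^+ 4 + 72 * n%:R ^+ 2.
Proof.
have N0 : 0 < n%:R :> R by rewrite ltr0n.
have N1 : 1 <= n%:R :> R by rewrite ler1n.
have step i : update_mean be (fun s => stat s ^+ 4) s i <=
    stat s ^+ 4 + (4 * stat s ^+ 3 * (a i * site_drift s i) + 72 * n%:R ^+ 2).
  (* The terms beyond first order are at most [24 n^2 + 32 n + 16 <= 72 n^2]. *)
  have rem (d : R) : `|d| <= 2 ->
      (stat s + d) ^+ 4 <= stat s ^+ 4 + 4 * stat s ^+ 3 * d + 72 * n%:R ^+ 2.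
    move=> d2; have Fn := stat_bound s.
    have d22 : d ^+ 2 <= 4.
      rewrite -(real_normK (num_real d)) (_ : 4 = 2 ^+ 2); last by rewrite -natrX.
      by rewrite lerXn2r ?nnegrE.
    have F2 : stat s ^+ 2 <= n%:R ^+ 2.
      by rewrite -(real_normK (num_real (stat s))) lerXn2r ?nnegrE.
    have d20 := sqr_ge0 d; have F20 := sqr_ge0 (stat s).
    have e1 : stat s ^+ 2 * d ^+ 2 <= n%:R ^+ 2 * 4 by rewrite ler_pM.
    have e2 : stat s * d * d ^+ 2 <= n%:R * 2 * 4.
      apply: le_trans (ler_norm _) _; rewrite normrM (ger0_norm d20) normrM.
      exact: ler_pM (mulr_ge0 (normr_ge0 _) (normr_ge0 _)) d20
        (ler_pM (normr_ge0 _) (normr_ge0 _) Fn d2) d22.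
    have e3 : d ^+ 2 * d ^+ 2 <= 4 * 4 by rewrite ler_pM.
    have N2 : n%:R <= n%:R ^+ 2 :> R by rewrite expr2 ler_peMr.
    have -> : (stat s + d) ^+ 4 = stat s ^+ 4 + 4 * stat s ^+ 3 * d
      + 6 * (stat s ^+ 2 * d ^+ 2) + 4 * (stat s * d * d ^+ 2) + d ^+ 2 * d ^+ 2 by ring.
    lra.
  have jump (b : bool) : `|a i * ((if b then 1 else -1) - spin R s i)| <= 2.
    rewrite normrM -[leRHS]mul1r ler_pM// ler_norml /spin.
    by case: b; case: (s i); apply/andP; split; lra.
  have /andP[p0 p1] := site_prob_bounds s i.
  have p1' : 0 <= 1 - site_prob be s i by rewrite subr_ge0.
  rewrite /update_mean !stat_set /site_drift.
  have := ler_wpM2l p0 (rem _ (jump true)).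
  have := ler_wpM2l p1' (rem _ (jump false)); rewrite /=; lra.
apply: le_trans (ler_sum _ (fun i _ => ler_wpM2l (_ : 0 <= n%:R^-1) (step i))) _.
  by rewrite invr_ge0.
rewrite glauber_mean_add big_split -mulr_sumr stat_drift /= sumr_const card_ord.
have /andP[B0 _] := field_slope_bound s.
have -> : stat s ^+ 4 + n%:R^-1 * (4 * stat s ^+ 3 * (- (1 + field_slope s) * stat s)
    + 72 * n%:R ^+ 2 *+ n) = (1 - 4 / n%:R) * stat s ^+ 4 + 72 * n%:R ^+ 2
    - 4 / n%:R * (field_slope s * stat s ^+ 4).
  by rewrite -[_ *+ n]mulr_natl; field; rewrite gt_eqF.
rewrite gerBl; apply: mulr_ge0; first exact: divr_ge0.
by apply: mulr_ge0 => //; rewrite -[4%N]/(2 * 2)%N exprM sqr_ge0.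
Qed.

Let stat_sqr x : R := stat (val x) ^+ 2.
Let stat_quart x : R := stat (val x) ^+ 4.

Lemma expect_stat_sqr x : exists2 v, 0 <= v <= 4 &
  expect K stat_sqr x = (1 - 2 * (1 + field_slope (val x)) / n%:R) * stat_sqr x + v.
Proof.
have [v vb vE] := stat_sqr_mean (val x); exists v => //.
rewrite -vE; apply: (expect_even (H := fun s => stat s ^+ 2)) => s.
by rewrite stat_opp sqrrN.
Qed.

Lemma expect_stat_quart x :
  expect K stat_quart x <= (1 - 4 / n%:R) * stat_quart x + 72 * n%:R ^+ 2.
Proof.
apply: le_trans (stat_quart_mean (val x)).
apply: eq_ler.
apply: (expect_even (H := fun s => stat s ^+ 4)) => s.
by rewrite stat_opp -[4%N]/(2 * 2)%N !exprM sqrrN.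
Qed.

Let K_ge0 := glauber_plus_ge0 be_ge0 n_gt0.
Let K_sum1 := glauber_plus_sum1 be n_gt0.

Lemma iter_stat_sqr t x (rho := 1 - 2 * (1 + 4 * be / n%:R) / n%:R) : 0 <= rho ->
  rho ^+ t * stat_sqr x <= iter t (expect K) stat_sqr x.
Proof.
move=> rho0; elim: t => [|t IH]; first by rewrite expr0 mul1r.
rewrite iterSr exprS.
have h y : rho * stat_sqr y + 0 <= expect K stat_sqr y.
  have [v /andP[v0 _] ->] := expect_stat_sqr y.
  have /andP[_ B1] := field_slope_bound (val y).
  rewrite lerD// ler_wpM2r ?sqr_ge0// lerD2l lerN2 ler_wpM2r ?invr_ge0//.
  by rewrite ler_pM2l// lerD2l.
apply: le_trans (le_iter_expect K_ge0 t x h).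
by rewrite (iter_expect_affine K_sum1) addr0 -mulrA ler_wpM2l.
Qed.

(** [18 n^3] is the fixed point of the affine recursion: [72 n^2] divided by [4 / n]. *)
Lemma iter_stat_quart t x : 4 <= n%:R :> R ->
  iter t (expect K) stat_quart x <= (1 - 4 / n%:R) ^+ t * stat_quart x + 18 * n%:R ^+ 3.
Proof.
move=> n4; have N0 : 0 < n%:R :> R by lra.
have c0 : 0 <= 1 - 4 / n%:R :> R by rewrite subr_ge0 ler_pdivrMr// mul1r.
elim: t => [|t IH]; first by rewrite expr0 mul1r lerDl mulr_ge0 ?exprn_ge0.
rewrite iterSr exprS.
apply: le_trans (le_iter_expect K_ge0 t x expect_stat_quart) _.
rewrite (iter_expect_affine K_sum1).
apply: le_trans (lerD (ler_wpM2l c0 IH) (lexx _)) _.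
by apply: eq_ler; field; rewrite gt_eqF.
Qed.

Lemma stationary_stat_sqr p : stationary K p -> \sum_x p x * stat_sqr x <= 2 * n%:R.
Proof.
move=> sp; have [p0 p1 _] := sp.
have N0 : 0 < n%:R :> R by rewrite ltr0n.
have := stationary_expect 1 stat_sqr sp => /= E.
have h : \sum_x p x * expect K stat_sqr x <=
    \sum_x p x * ((1 - 2 / n%:R) * stat_sqr x + 4).
  apply: ler_sum => x _; rewrite ler_wpM2l//.
  have [v /andP[_ v1] ->] := expect_stat_sqr x.
  have /andP[B0 _] := field_slope_bound (val x).
  rewrite lerD// ler_wpM2r ?sqr_ge0// lerD2l lerN2 ler_wpM2r ?invr_ge0//.
  by rewrite ler_peMr// lerDl.
rewrite E in h; set m := \sum_x p x * stat_sqr x in h *.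
have e : \sum_x p x * ((1 - 2 / n%:R) * stat_sqr x + 4) = (1 - 2 / n%:R) * m + 4.
  transitivity (\sum_x ((1 - 2 / n%:R) * (p x * stat_sqr x) + 4 * p x)).
    by apply: eq_bigr => x _; ring.
  by rewrite big_split -!mulr_sumr p1 mulr1.
rewrite e in h.
have : 2 / n%:R * m <= 4 by lra.
by rewrite mulrAC ler_pdivrMr//; lra.
Qed.

(** The test event is [c / 2 <= stat_sqr]. Markov's inequality bounds its stationary mass by
    [4 n / c]. Under the law at time [t] its indicator is at least [1 - 4 (stat_sqr - c)^2 / c^2];
    centring at [c] instead of the mean only requires [c] to be a lower bound for the mean. *)
Lemma worst_tv_lower t x (c : R) : 0 < c -> c <= iter t (expect K) stat_sqr x ->
  1 - 4 * (iter t (expect K) stat_quart x - c ^+ 2) / c ^+ 2 - 4 * n%:R / c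
  <= worst_tv K t.
Proof.
move=> c0 cm.
pose A : {set config_plus R n} := [set y | c / 2 <= stat_sqr y].
apply: le_trans (ge_worst_tv K t A x); apply: le_trans (ler_norm _).
have sp : stationary K (stationary_law K).
  exact: xgetPex (glauber_plus_stationary be_ge0 n_gt0).
have [p0 p1 _] := sp; set p := stationary_law K in sp p0 p1 *.
have c2 : 0 < c / 2 by rewrite divr_gt0.
have pA : \sum_(y in A) p y <= 4 * n%:R / c.
  rewrite ler_pdivlMr//.
  have : \sum_(y in A) p y * (c / 2) <= \sum_y p y * stat_sqr y.
    rewrite big_mkcond; apply: ler_sum => y _; rewrite inE.
    by case: ifP => h; [rewrite ler_wpM2l | rewrite mulr_ge0 ?sqr_ge0].
  rewrite -mulr_suml; have := stationary_stat_sqr sp; lra.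
pose w y := law K x t y.
have wE f : \sum_y w y * f y = iter t (expect K) f x := law_expect K x t f.
have w0 y : 0 <= w y.
  have b z : 0 <= ((z == y)%:R : R) <= 1 by case: (z == y); rewrite ?lexx ?ler01.
  have /andP[] := iter_expect_bounds K_ge0 K_sum1 t b x; rewrite -wE => + _.
  rewrite (bigD1 y)//= eqxx mulr1 big1 ?addr0// => z /negPf ->.
  by rewrite mulr0.
have w1 : \sum_y w y = 1.
  have b (z : config_plus R n) : 1 <= (fun=> 1 : R) z <= 1 by rewrite lexx.
  have -> : \sum_y w y = iter t (expect K) (fun=> 1) x.
    by rewrite -wE; apply: eq_bigr => y _; rewrite mulr1.
  by apply/eqP; rewrite eq_le andbC; exact: (iter_expect_bounds K_ge0 K_sum1 t b x).
have lA : 1 - 4 * (iter t (expect K) stat_quart x - c ^+ 2) / c ^+ 2 <= \sum_(y in A) w y.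
  apply: (@le_trans _ _ (\sum_y w y * (1 - 4 * (stat_sqr y - c) ^+ 2 / c ^+ 2))); last first.
    rewrite [leRHS]big_mkcond; apply: ler_sum => y _; rewrite inE.
    have sq0 : 0 <= 4 * (stat_sqr y - c) ^+ 2 / c ^+ 2.
      by apply: divr_ge0 (sqr_ge0 c); rewrite mulr_ge0// sqr_ge0.
    case: ifPn => h; first by rewrite ler_piMr// gerBl.
    rewrite -ltNge in h.
    rewrite mulr_ge0_le0// subr_le0 ler_pdivlMr ?exprn_gt0// mul1r.
    have : (c / 2) * (c / 2) <= (c - stat_sqr y) * (c - stat_sqr y).
      by apply: ler_pM; rewrite ?(ltW c2)//; lra.
    lra.
  have -> : \sum_y w y * (1 - 4 * (stat_sqr y - c) ^+ 2 / c ^+ 2) =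
      8 / c * iter t (expect K) stat_sqr x - 4 / c ^+ 2 * iter t (expect K) stat_quart x
      - 3 * 1.
    rewrite -!wE -[X in 3 * X]w1 !mulr_sumr -!sumrB; apply: eq_bigr => y _.
    by rewrite /stat_quart /stat_sqr; field; rewrite gt_eqF.
  have h1 : 8 / c * c <= 8 / c * iter t (expect K) stat_sqr x.
    by rewrite ler_wpM2l// divr_ge0// ltW.
  rewrite divfK ?gt_eqF// in h1.
  have -> : 1 - 4 * (iter t (expect K) stat_quart x - c ^+ 2) / c ^+ 2 =
    5 - 4 / c ^+ 2 * iter t (expect K) stat_quart x by field; rewrite gt_eqF.
  lra.
rewrite -/(w _); lra.
Qed.

End Statistic.

(** * A balanced initial configuration *)

Section Balanced.
Variables (R : realType) (n : nat).
Implicit Types i : 'I_n.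

(** Antisymmetric under reversal of the sites, which makes the sum vanish for either parity of [n];
    the middle site of an odd [n] gets 0. *)
Definition half_sign i : R :=
  if (i < rev_ord i)%N then 1 else if (rev_ord i < i)%N then -1 else 0.

Definition half_plus : config n := [ffun i : 'I_n => (i <= rev_ord i)%N].

Lemma half_sign_le1 i : `|half_sign i| <= 1.
Proof.
by rewrite /half_sign; case: ifP => _; [|case: ifP => _]; rewrite ?normrN ?normr1 ?normr0.
Qed.

Lemma half_sign_sum : \sum_i half_sign i = 0.
Proof.
have E : \sum_i half_sign i = - \sum_i half_sign i.
  rewrite [LHS](reindex_inj rev_ord_inj) -sumrN; apply: eq_bigr => i _.
  rewrite /half_sign rev_ordK.
  by case: (ltngtP (rev_ord i) i) => _; rewrite ?opprK ?oppr0.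
lra.
Qed.

Lemma magn_half_plus : 0 <= magn R half_plus.
Proof.
rewrite /magn mulr_ge0 ?invr_ge0//.
suff : 0 <= \sum_(i < n) spin R half_plus i + \sum_(i < n) spin R half_plus i by lra.
rewrite [X in _ + X](reindex_inj rev_ord_inj) -big_split sumr_ge0// => i _ /=.
by rewrite /spin !ffunE rev_ordK; case: (ltngtP i (rev_ord i)) => _ /=; lra.
Qed.

Lemma stat_half_plus : n%:R - 1 <= stat half_sign half_plus.
Proof.
have -> : stat half_sign half_plus = \sum_(i < n) (1 - (i == rev_ord i :> nat)%:R).
  apply: eq_bigr => i _; rewrite /half_sign /spin ffunE.
  case: (ltngtP i (rev_ord i)) => _; rewrite ?mulr1 ?mulrN1 ?opprK ?subr0 ?mul0r//.
  by rewrite subrr.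
rewrite sumrB sumr_const card_ord lerD2l lerN2 -natr_sum -[leRHS]/(1%:R) ler_nat.
have [/existsP[i /eqP i0]|] := boolP [exists i : 'I_n, i == rev_ord i :> nat].
  rewrite (bigD1 i)//= big1 ?addn0 ?leq_b1// => j ji.
  apply/eqP; rewrite eqb0; apply: contra ji => /eqP j0; apply/eqP/val_inj.
  by move: i0 j0 => /=; lia.
rewrite negb_exists => /forallP h; rewrite big1// => i _.
by apply/eqP; rewrite eqb0; exact: h.
Qed.

End Balanced.

(** Serves to compare the decay of the fourth moment with the square of the decay of the second,
    whose rates differ by [O(1/n^2)]. *)
Lemma expn_le_linear (R : realType) (a b e : R) (t : nat) : 0 <= a <= 1 -> 0 <= b <= 1 -> 0 <= e -> a <= b + e ->
  a ^+ t <= b ^+ t + t%:R * e.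
Proof.
move=> /andP[a0 a1] /andP[b0 b1] e0 ab; elim: t => [|t IH].
  by rewrite !expr0 mul0r addr0.
have bt0 := exprn_ge0 t b0; have bt1 : b ^+ t <= 1 by rewrite exprn_ile1.
rewrite !exprS -natr1.
have h1 := ler_wpM2l a0 IH.
have h2 : a * (t%:R * e) <= t%:R * e by rewrite ler_piMl// mulr_ge0.
have h3 := ler_wpM2r bt0 ab.
have h4 := ler_wpM2l e0 bt1.
lra.
Qed.

Lemma mixing_lower_large (R : realType) (be : R) : 0 <= be ->
  exists n0 : nat, forall n, (n0 <= n)%N ->
  forall t : nat, t%:R <= n%:R * ln n%:R / 48 :> R ->
  4^-1 < worst_tv (@glauber_plus R be n) t.
Proof.
move=> be_ge0.
pose W := 5000 * (1 + be) : R.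
have W5 : 5000 <= W by rewrite /W; clear -be_ge0; lra.
have beW : be <= W by rewrite /W; clear -be_ge0; lra.
have W18 : (3 * be + 18) * 256 <= W by rewrite /W; clear -be_ge0; lra.
clearbody W.
have W0 : 0 <= W by lra.
exists (Num.truncn (W ^+ 8)).+1 => n nW t tn.
have n_gt0 : (0 < n)%N := leq_trans (ltn0Sn _) nW.
have N0 : 0 < n%:R :> R by rewrite ltr0n.
have NW : W ^+ 8 <= n%:R by apply: le_trans (ltW (truncnS_gt _)) _; rewrite ler_nat.
(* [w] is the eighth root of [n], so that all comparisons are between powers of [w]. As
   [rho >= expR (- (6 / n))] and [48 = 6 * 8], the decay up to time [n ln n / 48] costs at most one
   factor [w]. *)
pose w := expR (ln (n%:R : R) / 8).
have w0 : 0 < w := expR_gt0 _.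
have nw : n%:R = w ^+ 8 by rewrite /w -expRM_natl mulrC divfK ?lnK ?posrE// pnatr_eq0.
have Ww : W <= w.
  by rewrite -(@ler_pXn2r _ 8)// ?nnegrE ?(ltW w0)// -nw.
have w5 : 5000 <= w := le_trans W5 Ww.
have w1 : 1 <= w by clear -w5; lra.
have lnw : ln (n%:R : R) <= 8 * w.
  have := expR_ge1Dx (ln (n%:R : R) / 8); rewrite -/w; clear; lra.
have wE : w = expR (ln (n%:R : R) / 8) by [].
clearbody w.
have wpow (i j : nat) : (i <= j)%N -> w ^+ i <= w ^+ j by move=> ij; rewrite ler_weXn2l.
have wpow0 i : 0 < w ^+ i by rewrite exprn_gt0.
have nW2 : W * W <= n%:R.
  rewrite -expr2; apply: le_trans NW; rewrite ler_weXn2l//; clear -W5; lra.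
have n8 : 8 * be <= n%:R.
  have h1 : 5000 * W <= W * W by rewrite ler_wpM2r.
  clear -h1 beW nW2 W0; lra.
have n100 : (100 : R) <= n%:R.
  have h1 : 5000 * W <= W * W by rewrite ler_wpM2r.
  clear -h1 nW2 W5; lra.
pose x0 : config_plus R n := Sub (@half_plus n) (magn_half_plus R n).
set F := stat (@half_sign R n).
have F0 : n%:R / 2 <= F (val x0) by have := stat_half_plus R n; rewrite /= -/F; clear -n100; lra.
have F2 : n%:R ^+ 2 / 4 <= F (val x0) ^+ 2.
  have -> : n%:R ^+ 2 / 4 = (n%:R / 2) ^+ 2 :> R by field.
  by rewrite lerXn2r ?nnegrE ?divr_ge0// (le_trans _ F0)// divr_ge0.
have F4 : F (val x0) ^+ 4 <= n%:R ^+ 4.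
  have Fn := stat_bound (@half_sign_le1 R n) (val x0); rewrite -/F in Fn.
  rewrite -[4%N]/(2 * 2)%N !exprM lerXn2r ?nnegrE ?sqr_ge0//.
  by rewrite -(real_normK (num_real (F _))) lerXn2r ?nnegrE.
set rho := 1 - 2 * (1 + 4 * be / n%:R) / n%:R.
have bn : 4 * be / n%:R <= 2^-1 by rewrite ler_pdivrMr//; clear -n8; lra.
have bn0 : 0 <= 4 * be / n%:R by rewrite divr_ge0// mulr_ge0.
have hn : n%:R^-1 <= 100^-1 :> R by rewrite lef_pV2 ?posrE.
have h0 : 0 < n%:R^-1 :> R by rewrite invr_gt0.
have rho3 : 1 - 3 / n%:R <= rho.
  rewrite /rho lerD2l lerN2 ler_wpM2r ?invr_ge0//; clear -bn; lra.
have rho0 : 0 <= rho by apply: le_trans rho3; clear -hn; lra.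
have rho1 : rho <= 1 by rewrite gerBl mulr_ge0 ?(ltW h0)// mulr_ge0//; clear -bn0; lra.
have rhoE : w^-1 <= rho ^+ t.
  have e1 : expR (- (6 / n%:R)) <= rho.
    apply: le_trans rho3; rewrite expRN.
    have p0 : 0 < 1 + 6 / n%:R :> R by clear -h0; lra.
    apply: (@le_trans _ _ (1 + 6 / n%:R)^-1).
      by rewrite lef_pV2 ?posrE ?expR_gt0// expR_ge1Dx.
    rewrite -[leLHS]mul1r ler_pdivrMr//.
    have h1 : n%:R^-1 * n%:R^-1 <= 100^-1 * n%:R^-1 :> R by rewrite ler_wpM2r// ltW.
    clear -h0 h1; lra.
  apply: (@le_trans _ _ (expR (- (6 / n%:R)) ^+ t)); last first.
    by rewrite lerXn2r ?nnegrE ?expR_ge0.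
  rewrite -expRM_natl wE -expRN ler_expR mulrN lerN2.
  have -> : t%:R * (6 / n%:R) = t%:R * 6 / n%:R :> R by ring.
  by rewrite ler_pdivrMr//; clear -tn; lra.
pose c := rho ^+ t * F (val x0) ^+ 2.
have c1 : w ^+ 15 / 4 <= c.
  have -> : w ^+ 15 / 4 = w^-1 * (n%:R ^+ 2 / 4) by rewrite nw; field; rewrite gt_eqF.
  by rewrite ler_pM ?divr_ge0 ?exprn_ge0 ?invr_ge0// ltW.
have c0 : 0 < c by apply: lt_le_trans c1; rewrite divr_gt0.
have low := worst_tv_lower be_ge0 n_gt0 (@half_sign_le1 R n) (half_sign_sum R n) c0
  (iter_stat_sqr be_ge0 n_gt0 (@half_sign_le1 R n) (half_sign_sum R n) t x0 rho0).
have n4 : 4 <= n%:R :> R by clear -n100; lra.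
have up := iter_stat_quart be_ge0 n_gt0 (@half_sign_le1 R n) (half_sign_sum R n) t x0 n4.
set E4 := iter t _ _ x0 in low up; rewrite -/F in up.
(* The initial value to the fourth power thus cancels in [E4 - c ^+ 2], leaving an error of order
   [w ^+ 25] against [c ^+ 2] of order [w ^+ 30]. *)
have lin : (1 - 4 / n%:R) ^+ t <= (rho ^+ 2) ^+ t + t%:R * (16 * be / n%:R ^+ 2).
  apply: expn_le_linear.
  - by clear -hn h0; apply/andP; split; lra.
  - by rewrite exprn_ge0//= exprn_ile1.
  - by rewrite divr_ge0 ?exprn_ge0// mulr_ge0.
  have -> : rho ^+ 2 + 16 * be / n%:R ^+ 2 =
      1 - 4 / n%:R + 4 * ((1 + 4 * be / n%:R) / n%:R) ^+ 2.
    by rewrite /rho; field; rewrite gt_eqF.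
  by rewrite lerDl mulr_ge0// sqr_ge0.
have var : E4 - c ^+ 2 <= 16 * be * t%:R * n%:R ^+ 2 + 18 * n%:R ^+ 3.
  have F40 : 0 <= F (val x0) ^+ 4 by rewrite -[4%N]/(2 * 2)%N exprM sqr_ge0.
  have h1 := ler_wpM2r F40 lin.
  have cE : c ^+ 2 = (rho ^+ 2) ^+ t * F (val x0) ^+ 4.
    by rewrite /c exprMn -!exprM [(t * 2)%N]mulnC.
  have d0 : 0 <= t%:R * (16 * be / n%:R ^+ 2).
    by apply: mulr_ge0 => //; rewrite divr_ge0 ?exprn_ge0// mulr_ge0.
  have h2 := ler_wpM2l d0 F4.
  have h3 : t%:R * (16 * be / n%:R ^+ 2) * n%:R ^+ 4 = 16 * be * t%:R * n%:R ^+ 2.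
    by field; rewrite gt_eqF.
  rewrite cE; clear -h1 h2 h3 up; lra.
have tw : t%:R <= w ^+ 9 / 6.
  apply: le_trans tn _.
  have h1 : n%:R * ln n%:R <= 8 * w ^+ 9.
    have -> : 8 * w ^+ 9 = n%:R * (8 * w) by rewrite nw; ring.
    by rewrite ler_pM2l.
  clear -h1; lra.
have var2 : E4 - c ^+ 2 <= (3 * be + 18) * w ^+ 25.
  apply: le_trans var _.
  have b0 : 0 <= 16 * be * n%:R ^+ 2 by rewrite mulr_ge0 ?exprn_ge0// mulr_ge0.
  have h1 := ler_wpM2l b0 tw.
  have h2 : 16 * be * n%:R ^+ 2 * (w ^+ 9 / 6) = 16 / 6 * be * w ^+ 25.
    by rewrite nw; field.
  have h3 : n%:R ^+ 3 <= w ^+ 25 by rewrite nw -exprM wpow.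
  have h4 : 0 <= be * w ^+ 25 by rewrite mulr_ge0 ?(ltW (wpow0 _)).
  clear -h1 h2 h3 h4; lra.
have c2 : w ^+ 30 / 16 <= c ^+ 2.
  have -> : w ^+ 30 / 16 = (w ^+ 15 / 4) ^+ 2 by field.
  by rewrite lerXn2r ?nnegrE ?divr_ge0 ?(ltW (wpow0 _)) ?(ltW c0).
have r1 : 4 * (E4 - c ^+ 2) / c ^+ 2 <= 4^-1.
  rewrite ler_pdivrMr ?exprn_gt0//.
  have h1 : (3 * be + 18) * w ^+ 25 * 256 <= w ^+ 30.
    apply: le_trans (_ : w * w ^+ 25 <= _); last by rewrite -exprS wpow.
    rewrite mulrAC ler_wpM2r ?(ltW (wpow0 _))//.
    exact: le_trans W18 Ww.
  clear -h1 c2 var2; lra.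
have r2 : 4 * n%:R / c <= 4^-1.
  rewrite ler_pdivrMr//.
  have h1 : 64 * w ^+ 8 <= w ^+ 15.
    apply: le_trans (_ : w * w ^+ 8 <= _); last by rewrite -exprS wpow.
    by rewrite ler_wpM2r ?(ltW (wpow0 _))//; clear -w5; lra.
  rewrite nw; clear -h1 c1; lra.
apply: lt_le_trans low; clear -r1 r2; lra.
Qed.


(** Two distinct states have total stationary mass at most 1, so one of the two point masses is at
    distance at least 1/2. This gives a mixing time of at least 1 for the small [n] that the
    asymptotic bound does not reach. *)
Lemma worst_tv0_gt (R : realType) (be : R) n : 0 <= be -> (1 < n)%N ->
  4^-1 < worst_tv (@glauber_plus R be n) 0.
Proof.
move=> be0 n1; have n0 := ltnW n1.
set K := @glauber_plus R be n.
have [p0 p1 pK] : stationary K (stationary_law K).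
  exact: xgetPex (glauber_plus_stationary be0 n0).
set p := stationary_law K in p0 p1 pK.
pose i0 : 'I_n := Ordinal n0.
pose x : config_plus R n := all_plus R n.
pose y : config_plus R n := fold_plus R (set_spin [ffun=> true] i0 false).
have xy : x != y.
  apply/eqP => xy; have : nplus (val x) = nplus (val y) by rewrite xy.
  have n_all : nplus ([ffun=> true] : config n) = n.
    by rewrite -card_plus_set -[RHS]card_ord; apply: eq_card => i; rewrite !inE ffunE.
  rewrite /x /y /all_plus !nplus_fold_plus nplus_setF ffunE n_all; lia.
have law0 (z : config_plus R n) : \sum_(v in [set z]) law K z 0 v = 1.
  by rewrite big_set1 ffunE eqxx.
have hx := ge_worst_tv K 0 [set x] x; have hy := ge_worst_tv K 0 [set y] y.
rewrite law0 big_set1 in hx; rewrite law0 big_set1 in hy.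
have pxy : p x + p y <= 1.
  rewrite -p1 (bigD1 x)//= (bigD1 y)/=; last by rewrite eq_sym.
  by rewrite lerD2l lerDl sumr_ge0.
have h1 : 1 - p x <= worst_tv K 0 := le_trans (ler_norm _) hx.
have h2 : 1 - p y <= worst_tv K 0 := le_trans (ler_norm _) hy.
by move: (p x) (p y) (worst_tv K 0) h1 h2 pxy => *; lra.
Qed.

Theorem theorem3 (R : realType) (beta : R) (hbeta : 1 < beta) :
  exists C3 C4 : R, [/\ 0 < C3, 0 < C4 &
    forall n : nat, (1 <= n)%N ->
      exists tmix : nat,
        [/\ is_mixing_time (@glauber_plus R beta n) tmix,
            C3 * (n%:R * ln (n%:R : R)) <= tmix%:R
          & tmix%:R <= C4 * (n%:R * ln (n%:R : R))]].
Proof.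
have beta0 : 0 <= beta by lra.
have [C4 C40 upper] := mixing_upper hbeta.
have [n0 lower] := mixing_lower_large beta0.
have xln_ge0 n : (0 < n)%N -> 0 <= n%:R * ln (n%:R : R).
  by move=> n_gt0; rewrite mulr_ge0// ln_ge0// ler1n.
(* The 48 serves [n >= n0]; the second term makes [C3 * (n ln n) <= 1] for smaller [n], where the
   mixing time is at least 1 unless [n = 1], when the left side is 0. *)
pose C3 : R := (48 + n0.+1%:R * ln n0.+1%:R)^-1.
have D0 : 0 < 48 + n0.+1%:R * ln (n0.+1%:R : R) by rewrite ltr_wpDr// xln_ge0.
exists C3, C4; split=> //; first by rewrite invr_gt0.
move=> n n_gt0.
pose mixed t := worst_tv (@glauber_plus R beta n) t <= 4^-1.
have [T [mixT TC]] := upper n n_gt0.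
have exT : exists t, mixed t by exists T.
exists (ex_minn exT); case: ex_minnP => t mixt tmin; split.
- by split.
- rewrite mulrC ler_pdivrMr//.
  have [n1|n1] := leqP n 1.
    have -> : n = 1%N by apply/eqP; rewrite eqn_leq n1.
    by rewrite ln1 mulr0; exact: mulr_ge0 (ler0n _ _) (ltW D0).
  have t1 : 1 <= t%:R :> R.
    rewrite ler1n lt0n; apply: contraTneq mixt => ->.
    by rewrite /mixed -ltNge worst_tv0_gt.
  have [nn0|nn0] := leqP n0 n.
    have : ~~ (t%:R <= n%:R * ln (n%:R : R) / 48).
      by apply/negP => /(lower n nn0); rewrite ltNge; move: mixt; rewrite /mixed => ->.
    rewrite -ltNge ltr_pdivrMr// => /ltW/le_trans; apply.
    by rewrite ler_wpM2l// lerDl xln_ge0.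
  apply: (@le_trans _ _ (n0.+1%:R * ln (n0.+1%:R : R))).
    have nn : n%:R <= n0.+1%:R :> R by rewrite ler_nat ltnW// ltnW.
    by rewrite ler_pM ?ln_ge0 ?ler1n// ler_ln ?posrE ?ltr0n.
  by apply: le_trans (ler_peMl (ltW D0) t1); rewrite lerDr.
- by apply: le_trans TC; rewrite ler_nat tmin.
Qed.
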